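(* Let $(R,\mathfrak m)$ be a Noetherian local ring and let $x\in\mathfrak m$ be a nonzerodivisor on $R$. Then $R$ satisfies derived $(\mathbf{ldep})$ if and only if $R/x$ satisfies derived $(\mathbf{ldep})$.
   Context: Complexes are complexes of finitely generated modules, graded homologically. For a local ring $(S,\mathfrak n,\ell)$ and an $S$-complex $X$ with injective resolution $I$ (a K-injective complex of injective modules quasi-isomorphic to $X$), $\operatorname{depth}_S(X):=\inf\{i\mid H_{-i}(\operatorname{Hom}_S(\ell,I))\ne0\}$; this agrees with the usual depth for modules. A Noetherian local ring $S$ satisfies derived $(\mathbf{ldep})$ if for all $S$-complexes $X,Y$ such that $X$, $Y$ and $X\otimes^{\mathbf L}_S Y$ have bounded homology, one has $\operatorname{depth}_S(X\otimes^{\mathbf L}_S Y)+\operatorname{depth}(S)\ge\operatorname{depth}_S(X)+\operatorname{depth}_S(Y)$. *)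

(* Defs.v *)
From HB Require Import structures.
From mathcomp Require Import all_boot all_order all_algebra.
From mathcomp Require Import generic_quotient ring_quotient.
From mathcomp Require Import boolp classical_sets constructive_ereal.

Set Implicit Arguments.
Unset Strict Implicit.
Unset Printing Implicit Defensive.

Import Order.TTheory GRing.Theory Num.Theory.
Local Open Scope classical_set_scope.
Local Open Scope quotient_scope.
Local Open Scope ring_scope.

(* Rings are [comPzRingType]s (possibly zero), so that [R / x] is a ring without
   a proof that [x] is not a unit; [local_ring] excludes the zero ring. *)

Definition is_ideal (S : comPzRingType) (I : set S) : Prop :=
  [/\ I 0, forall a b, I a -> I b -> I (a + b) & forall s a, I a -> I (s * a)].

Definition ideal_gen (S : comPzRingType) (A : set S) : set S :=
  \bigcap_(I in [set I | is_ideal I /\ A `<=` I]) I.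

Definition noetherian (S : comPzRingType) : Prop :=
  forall I : set S, is_ideal I ->
    exists s : seq S, I = ideal_gen [set a | a \in s].

Definition maximal_ideal (S : comPzRingType) (n : set S) : Prop :=
  [/\ is_ideal n, n <> setT &
      forall I : set S, is_ideal I -> n `<=` I -> I = n \/ I = setT].

Definition local_ring (S : comPzRingType) (n : set S) : Prop :=
  maximal_ideal n /\ forall I : set S, maximal_ideal I -> I = n.

Definition noetherian_local (S : comPzRingType) (n : set S) : Prop :=
  noetherian S /\ local_ring n.

Arguments noetherian_local : clear implicits.

Lemma ideal_genP (S : comPzRingType) (A : set S) : is_ideal (ideal_gen A).
Proof.
split=> [I [[]]//|a b ha hb I hI|s a ha I hI].
- by case: (hI) => -[_ hD _] _; apply: hD; [apply: ha|apply: hb].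
- by case: (hI) => -[_ _ hM] _; apply: hM; apply: ha.
Qed.

Definition ideal_pred (S : comPzRingType) (A : set S) : {pred S} :=
  fun s => `[< ideal_gen A s >].

Lemma ideal_pred_zmod (S : comPzRingType) (A : set S) :
  zmod_closed (ideal_pred A).
Proof.
have [h0 hD hM] := ideal_genP A.
split=> [|a b /asboolP ha /asboolP hb]; apply/asboolP => //.
by rewrite -mulN1r; apply: hD => //; apply: hM.
Qed.

HB.instance Definition _ (S : comPzRingType) (A : set S) :=
  GRing.isZmodClosed.Build S (ideal_pred A) (ideal_pred_zmod A).

(* [quo S A] is the ring S/(A), where (A) is the ideal generated by A; it is
   also an S-module. [Quotient.quot] provides the additive group. MathComp's own
   ring quotient [{ideal_quot _}] requires a nonzero base ring and a proper
   ideal. *)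
Definition quo (S : comPzRingType) (A : set S) : Type :=
  Quotient.quot (ideal_pred A : zmodClosed S).
HB.instance Definition _ (S : comPzRingType) (A : set S) :=
  GRing.Zmodule.on (quo A).

Definition quo_pi (S : comPzRingType) (A : set S) : S -> quo A :=
  \pi_(Quotient.quot (ideal_pred A : zmodClosed S)).

Section QuotientRing.
Variables (S : comPzRingType) (A : set S).
Local Notation pi := (@quo_pi S A).

Lemma quo_pi_eq a b : pi a = pi b <-> ideal_gen A (a - b).
Proof.
split=> [/eqP|h].
  by rewrite /quo_pi -Quotient.idealrBE => /asboolP.
by apply/eqP; rewrite /quo_pi -Quotient.idealrBE; apply/asboolP.
Qed.

Definition quo_repr (q : quo A) : S :=
  @repr _ (Quotient.quot (ideal_pred A : zmodClosed S)) q.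

Lemma quo_reprK q : pi (quo_repr q) = q.
Proof. exact: reprK. Qed.

Lemma quo_piB a b : pi (a - b) = pi a - pi b.
Proof. exact: pi_is_zmod_morphism. Qed.

Lemma quo_piD a b : pi (a + b) = pi a + pi b.
Proof.
have pi0 : pi 0 = 0 by rewrite -(subrr 0) quo_piB subrr.
by rewrite -{1}[b]opprK -[- b]sub0r !quo_piB pi0 sub0r opprK.
Qed.

Definition quo_one : quo A := pi 1.
Definition quo_mul (p q : quo A) : quo A := pi (quo_repr p * quo_repr q).
Definition quo_scale (s : S) (q : quo A) : quo A := pi (s * quo_repr q).

Lemma quo_scaleE s a : quo_scale s (pi a) = pi (s * a).
Proof.
apply/quo_pi_eq; rewrite -mulrBr; have [_ _ hM] := ideal_genP A.
by apply: hM; apply/quo_pi_eq; rewrite quo_reprK.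
Qed.

Lemma quo_mulE a b : quo_mul (pi a) (pi b) = pi (a * b).
Proof.
rewrite /quo_mul -/(quo_scale _ _) quo_scaleE mulrC -!quo_scaleE.
by rewrite quo_reprK quo_scaleE mulrC -quo_scaleE.
Qed.

Lemma quo_mulA : associative quo_mul.
Proof.
move=> p q r; rewrite -[p]quo_reprK -[q]quo_reprK -[r]quo_reprK.
by rewrite !quo_mulE mulrA.
Qed.

Lemma quo_mulC : commutative quo_mul.
Proof. by move=> p q; rewrite /quo_mul mulrC. Qed.

Lemma quo_mul1 : left_id quo_one quo_mul.
Proof. by move=> q; rewrite -[q]quo_reprK quo_mulE mul1r. Qed.

Lemma quo_mulDl : left_distributive quo_mul +%R.
Proof.
move=> p q r; rewrite -[p]quo_reprK -[q]quo_reprK -[r]quo_reprK.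
by rewrite -quo_piD !quo_mulE mulrDl quo_piD.
Qed.

HB.instance Definition _ :=
  GRing.Zmodule_isComPzRing.Build (quo A) quo_mulA quo_mulC quo_mul1 quo_mulDl.

Lemma quo_scaleA s t q : quo_scale s (quo_scale t q) = quo_scale (s * t) q.
Proof. by rewrite -[q]quo_reprK !quo_scaleE mulrA. Qed.

Lemma quo_scale1 : left_id 1 quo_scale.
Proof. by move=> q; rewrite -[q]quo_reprK quo_scaleE mul1r. Qed.

Lemma quo_scaleDr : right_distributive quo_scale +%R.
Proof.
move=> s p q; rewrite -[p]quo_reprK -[q]quo_reprK.
by rewrite -quo_piD !quo_scaleE mulrDr quo_piD.
Qed.

Lemma quo_scaleDl q : {morph quo_scale^~ q : s t / s + t}.
Proof. by move=> s t; rewrite -[q]quo_reprK !quo_scaleE mulrDl quo_piD. Qed.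

HB.instance Definition _ := GRing.Zmodule_isLmodule.Build S (quo A)
  quo_scaleA quo_scale1 quo_scaleDr quo_scaleDl.

Lemma quo_pi_zmod : zmod_morphism pi.
Proof. exact: quo_piB. Qed.

Lemma quo_pi_monoid : monoid_morphism pi.
Proof. by split=> // a b; rewrite -quo_mulE. Qed.

HB.instance Definition _ := GRing.isZmodMorphism.Build S (quo A) pi quo_pi_zmod.
HB.instance Definition _ :=
  GRing.isMonoidMorphism.Build S (quo A) pi quo_pi_monoid.

End QuotientRing.

Definition finitely_generated (S : comPzRingType) (M : lmodType S) : Prop :=
  exists (k : nat) (g : 'I_k -> M),
    forall u : M, exists c : 'I_k -> S, u = \sum_(i < k) c i *: g i.

Definition injective_module (S : comPzRingType) (E : lmodType S) : Prop :=
  forall (M N : lmodType S) (u : {linear M -> N}) (f : {linear M -> E}),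
    injective u -> exists g : {linear N -> E}, forall a, g (u a) = f a.

Definition projective_module (S : comPzRingType) (P : lmodType S) : Prop :=
  forall (M N : lmodType S) (u : {linear M -> N}) (f : {linear P -> N}),
    (forall b, exists a, u a = b) ->
    exists g : {linear P -> M}, forall p, u (g p) = f p.

(* A Z-graded complex with homological grading. The differential is given
   between all pairs of degrees, and is zero unless it lowers the degree by
   one; this avoids transport along equalities of degrees. *)
Record complex (S : comPzRingType) := Complex {
  cobj :> int -> lmodType S;
  diff : forall i j : int, {linear cobj i -> cobj j};
  diff_shape : forall i j, j != i - 1 -> forall u, diff i j u = 0;
  diff_sq : forall i j k u, diff j k (diff i j u) = 0 }.

Record chain_map (S : comPzRingType) (X Y : complex S) := ChainMap {
  cmap :> forall i, {linear X i -> Y i};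
  cmap_comm : forall i j u, cmap j (diff X i j u) = diff Y i j (cmap i u) }.

Definition cycles (S : comPzRingType) (X : complex S) (i : int) : set (X i) :=
  [set u | diff X i (i - 1) u = 0].

Definition boundaries (S : comPzRingType) (X : complex S) (i : int) :
    set (X i) :=
  range (diff X (i + 1) i).

Definition homology_zero (S : comPzRingType) (X : complex S) (i : int) : Prop :=
  @cycles S X i `<=` @boundaries S X i.

Definition acyclic (S : comPzRingType) (X : complex S) : Prop :=
  forall i, homology_zero X i.

Definition bounded_homology (S : comPzRingType) (X : complex S) : Prop :=
  exists a b : int, forall i, (i < a) || (b < i) -> homology_zero X i.

(* H_i(f) is injective and surjective for every i *)
Definition quasi_iso (S : comPzRingType) (X Y : complex S) (f : chain_map X Y) :
    Prop :=
  forall i,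
    (forall u, @cycles S X i u -> @boundaries S Y i (f i u) ->
          @boundaries S X i u)
    /\ (forall v, @cycles S Y i v ->
          exists2 u, @cycles S X i u & @boundaries S Y i (f i u - v)).

Definition null_homotopic (S : comPzRingType) (X Y : complex S)
    (f : chain_map X Y) : Prop :=
  exists h : forall i j, {linear X i -> Y j}, forall i u,
    f i u = diff Y (i + 1) i (h i (i + 1) u) + h (i - 1) i (diff X i (i - 1) u).

Definition K_injective (S : comPzRingType) (I : complex S) : Prop :=
  forall (A : complex S) (f : chain_map A I), acyclic A -> null_homotopic f.

Definition K_projective (S : comPzRingType) (P : complex S) : Prop :=
  forall (A : complex S) (f : chain_map P A), acyclic A -> null_homotopic f.

Definition injective_resolution (S : comPzRingType) (X I : complex S) : Prop :=
  [/\ K_injective I, forall i, injective_module (I i) &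
      exists f : chain_map X I, quasi_iso f].

Definition projective_resolution (S : comPzRingType) (X P : complex S) : Prop :=
  [/\ K_projective P, forall i, projective_module (P i) &
      exists f : chain_map P X, quasi_iso f].

Definition complex_fg (S : comPzRingType) (X : complex S) : Prop :=
  forall i, finitely_generated (X i).

Definition ring_cobj (S : comPzRingType) (i : int) : lmodType S :=
  if i == 0 then (S^o : lmodType S) else ('rV[S]_0 : lmodType S).

Definition ring_complex (S : comPzRingType) : complex S :=
  @Complex S (ring_cobj S)
    (fun i j => \0 : {linear ring_cobj S i -> ring_cobj S j})
    (fun _ _ _ _ => erefl) (fun _ _ _ _ => erefl).

(* MathComp's bilinear maps require a nonzero base ring. *)
Definition bilinear_map (S : comPzRingType) (M N L : lmodType S)
    (b : M -> N -> L) : Prop :=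
  (forall v, linear (fun u => b u v)) /\ (forall u, linear (b u)).

(* T, with the maps t i j n : X_i x Y_j -> T_n (only used for i + j = n), is the
   total tensor product complex of X and Y: T_n is the direct sum of the
   X_i (x) Y_j over i + j = n, expressed by its universal property, and
   d (u (x) v) = d u (x) v + (-1)^i u (x) d v. *)
Definition is_total_tensor (S : comPzRingType) (X Y T : complex S)
    (t : forall i j n : int, X i -> Y j -> T n) : Prop :=
  [/\ forall i j n : int, i + j = n -> bilinear_map (t i j n),
      forall (n : int) (L : lmodType S) (b : forall i j : int, X i -> Y j -> L),
        (forall i j : int, i + j = n -> bilinear_map (b i j)) ->
        exists f : {linear T n -> L},
          forall (i j : int) u v, i + j = n -> f (t i j n u v) = b i j u v,
      forall (n : int) (L : lmodType S) (f g : {linear T n -> L}),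
        (forall (i j : int) u v, i + j = n ->
          f (t i j n u v) = g (t i j n u v)) ->
        f =1 g
    & forall (i j n : int) u v, i + j = n ->
        diff T n (n - 1) (t i j n u v) =
          t (i - 1) j (n - 1) (diff X i (i - 1) u) v
          + (-1) ^+ `|i|%N *: t i (j - 1) (n - 1) u (diff Y j (j - 1) v)].

(* T represents the derived tensor product of X and Y (determined up to
   isomorphism in the derived category). *)
Definition is_derived_tensor (S : comPzRingType) (X Y T : complex S) : Prop :=
  exists2 P : complex S, projective_resolution X P &
    exists t : forall i j n : int, P i -> Y j -> T n, is_total_tensor t.

(* H_j(Hom_S(M, I)) <> 0, with M in degree 0: a degree j cycle of Hom_S(M, I) is
   a linear map f : M -> I_j with d f = 0. *)
Definition hom_homology_nonzero (S : comPzRingType) (M : lmodType S)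
    (I : complex S) (j : int) : Prop :=
  exists2 f : {linear M -> I j},
    forall a, diff I j (j - 1) (f a) = 0 &
    ~ exists g : {linear M -> I (j + 1)},
        forall a, f a = diff I (j + 1) j (g a).

(* The depth of X over the local ring (S, n), whose residue field is [quo n].
   The homology of Hom(quo n, I) does not depend on the choice of I. The
   infimum is taken in the extended integers, and is +oo for the empty set. *)
Definition depth (S : comPzRingType) (n : set S) (X : complex S) : \bar int :=
  infimum +oo%E [set i%:E%E | i in [set i : int |
    exists2 I : complex S, injective_resolution X I &
      hom_homology_nonzero (quo n : lmodType S) I (- i)]].

(* X and Y are complexes of finitely generated modules; the resolutions used for
   the derived functors, and the complex T, are not restricted. The depths are
   never -oo, as the homology is bounded. *)
Definition derived_ldep (S : comPzRingType) (n : set S) : Prop :=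
  forall X Y T : complex S,
    complex_fg X -> complex_fg Y -> is_derived_tensor X Y T ->
    bounded_homology X -> bounded_homology Y -> bounded_homology T ->
    (depth n X + depth n Y <= depth n T + depth n (ring_complex S))%E.

Arguments derived_ldep : clear implicits.

(* Main.v *)
(** Depths are read off maps from a K-projective resolution of the residue field, and two
    comparisons between [R] and [R' = R/x] are used.

    Rees: if the terms of a complex [Z] have no [x]-torsion and [I] is an injective resolution of
    [Z], then the [x]-torsion of [I], shifted by one, is an injective resolution of [Z/x] over
    [R']; hence [depth_R Z = depth_R' (Z/x) + 1]. Covering two complexes over [R] by complexes of
    torsion-free finitely generated modules and reducing modulo [x] lowers each of the four
    depths in the inequality by one, so the inequality passes from [R'] to [R].

    Eisenbud operators: let [P] be a K-projective complex over [R'] whose terms lift to projective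
    [R]-modules. The differential lifts to some [D] with [D^2 = x s], and [- s] induces a chain
    map [tau : P -> P[-2]]. Over [R], [P] has a K-projective resolution [L] such that [L/x] is the
    cone-like complex [P (+) P[-1]] with [tau] added to the differential (the twist of [P]).
    Resolving the residue field this way gives [depth_R X = depth_R' X] for complexes over [R'].
    Resolving a tensor factor this way shows that, if [T] represents the derived tensor product
    over [R'], then the one over [R] is represented by the twist of [T], whose depth is at most
    [depth_R' T - 1]. As [depth R = depth R' + 1], the inequality passes from [R] to [R'].
    The terms of [P] are made liftable by an Eilenberg swindle. *)

Require Import Defs.
From HB Require Import structures.
From mathcomp Require Import all_boot all_order all_algebra.
From mathcomp Require Import ring_quotient zify.
From mathcomp Require Import boolp classical_sets constructive_ereal functions.
Import Order.TTheory GRing.Theory Num.Theory.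
Local Open Scope classical_set_scope.
Local Open Scope ring_scope.

Set Implicit Arguments.
Unset Strict Implicit.
Unset Printing Implicit Defensive.

(** * Modules *)

(** The resolution [P] in a derived tensor product is an arbitrary K-projective complex, possibly
    unbounded, so its lift [L] to [R] cannot be shown K-projective by induction on degrees. Instead,
    a map from [L] to a torsion-free acyclic complex is contracted modulo [x], where [L] becomes the
    twist of [P]. The contraction is lifted to [R], and what remains of the map is divisible by [x];
    it is null-homotopic because multiplication by [x] is null-homotopic on [L].

    Projective modules over [R/x] have no evident lifts to [R]. The swindle adds contractible
    complexes to [P], which makes [P] a homotopy retract of the enlarged complex; unlike a mere
    quasi-isomorphism, the data of a retract survive tensoring with any [Y].

    The twist is an extension of [P] by a shift of [P], with connecting map [tau]. As [tau] moves
    degrees by two, the lowest nonzero Ext group has nothing to cancel against, and the depth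
    depends on that group alone.

    Tensor products are known through their universal property, so exactness statements about them
    are tested on maps into injective modules. *)

Inductive zexpr := ZVar of nat | ZAdd of zexpr & zexpr | ZOpp of zexpr | ZZero.

Section ZExpr.
Variables (V : zmodType) (env : seq V).

Fixpoint zeval (e : zexpr) : V :=
  match e with
  | ZVar n => nth 0 env n
  | ZAdd a b => zeval a + zeval b
  | ZOpp a => - zeval a
  | ZZero => 0
  end.

Fixpoint zcoef (e : zexpr) (i : nat) : int :=
  match e with
  | ZVar n => (n == i)%:Z
  | ZAdd a b => zcoef a i + zcoef b i
  | ZOpp a => - zcoef a i
  | ZZero => 0
  end.

Lemma zevalE e : zeval e = \sum_(i < size env) nth 0 env i *~ zcoef e i.
Proof.
elim: e => [n|a ha b hb|a ha|] /=.
- case: (ltnP n (size env)) => hn.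
    rewrite (bigD1 (Ordinal hn)) //= eqxx mulr1z big1 ?addr0 // => i.
    by rewrite -val_eqE /= eq_sym => /negPf ->; rewrite mulr0z.
  rewrite nth_default // big1 // => i _; case: eqP => [e|_]; last by rewrite mulr0z.
  by move: hn; rewrite e leqNgt ltn_ord.
- by rewrite ha hb -big_split; apply: eq_bigr => i _; rewrite mulrzDr.
- by rewrite ha -sumrN; apply: eq_bigr => i _; rewrite mulrNz.
- by rewrite big1 // => i _; rewrite mulr0z.
Qed.

Lemma zeval_eq e1 e2 :
  all (fun i => zcoef e1 i == zcoef e2 i) (iota 0 (size env)) ->
  zeval e1 = zeval e2.
Proof.
move=> /allP h; rewrite !zevalE; apply: eq_bigr => i _.
by rewrite (eqP (h i _)) // mem_iota /=.
Qed.

End ZExpr.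

Ltac zindex u env :=
  lazymatch env with
  | ?v :: ?env' =>
    match goal with
    | _ => let _ := match goal with _ => unify u v end in constr:(0%N)
    | _ => let n := zindex u env' in constr:(n.+1)
    end
  end.
Ltac zatoms u env :=
  lazymatch u with
  | (?a + ?b)%R => let env := zatoms a env in zatoms b env
  | (- ?a)%R => zatoms a env
  | 0%R => env
  | _ => match goal with
         | _ => let _ := zindex u env in env
         | _ => constr:(u :: env)
         end
  end.
Ltac zreify u env :=
  lazymatch u with
  | (?a + ?b)%R =>
    let a := zreify a env in let b := zreify b env in constr:(ZAdd a b)
  | (- ?a)%R => let a := zreify a env in constr:(ZOpp a)
  | 0%R => constr:(ZZero)
  | _ => let n := zindex u env in constr:(ZVar n)
  end.
(* Decides abelian group identities, with atoms identified up to unification. *)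
Ltac zmod :=
  lazymatch goal with
  | |- @eq ?T ?u ?v =>
    let env := zatoms u (@nil T) in let env := zatoms v env in
    let a := zreify u env in let b := zreify v env in
    exact: (@zeval_eq _ env a b)
  end.

Lemma dchoice (I : Type) (T : I -> Type) (Q : forall i, T i -> Prop) :
  (forall i, exists t, Q i t) -> exists f : forall i, T i, forall i, Q i (f i).
Proof. by move=> h; exists (fun i => sval (cid (h i))) => i; apply: (svalP (cid (h i))). Qed.

Lemma dchoice2 (I J : Type) (T : I -> J -> Type) (Q : forall i j, T i j -> Prop) :
  (forall i j, exists t, Q i j t) -> exists f : forall i j, T i j, forall i j, Q i j (f i j).
Proof.
move=> h; exists (fun i j => sval (cid (h i j))) => i j.
exact: (svalP (cid (h i j))).
Qed.

(** * Linear maps, submodules and quotient modules *)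

Section Linear.
Variable S : comPzRingType.
Implicit Types M N L : lmodType S.

Definition lin_of M N (f : M -> N) (hf : linear f) : {linear M -> N} :=
  HB.pack f (GRing.isLinear.Build S M N *:%R f hf).

Lemma lin_factor M N L (p : {linear M -> N}) (f : {linear M -> L}) :
  (forall v, exists u, p u = v) -> (forall u, p u = 0 -> f u = 0) ->
  exists g : {linear N -> L}, forall u, g (p u) = f u.
Proof.
move=> /choice[s hs] hf.
have fs u : f (s (p u)) = f u.
  by apply/eqP; rewrite -subr_eq0 -linearB hf // linearB hs subrr.
have hl : linear (f \o s).
  by move=> a u v /=; rewrite -linearP -[RHS]fs linearP !hs.
by exists (lin_of hl) => u /=; rewrite fs.
Qed.

Lemma lin_corestrict M N L (i : {linear N -> M}) (f : {linear L -> M}) :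
  injective i -> (forall u, exists v, i v = f u) ->
  exists g : {linear L -> N}, forall u, i (g u) = f u.
Proof.
move=> i_inj /choice[g hg].
have hl : linear g.
  by move=> a u v; apply: i_inj; rewrite linearP !hg linearP.
by exists (lin_of hl) => u /=; rewrite hg.
Qed.

Lemma lin_inj M N (f : {linear M -> N}) :
  (forall u, f u = 0 -> u = 0) -> injective f.
Proof.
move=> h u v e; apply/eqP; rewrite -subr_eq0; apply/eqP/h.
by rewrite linearB e subrr.
Qed.

Record subm M := Subm {
  subm_set :> M -> Prop;
  subm0 : subm_set 0;
  submD : forall u v, subm_set u -> subm_set v -> subm_set (u + v);
  submZ : forall s u, subm_set u -> subm_set (s *: u) }.

Definition subm_pred M (A : subm M) : {pred M} := fun u => `[< A u >].

Lemma subm_pred_closed M (A : subm M) : submod_closed (subm_pred A).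
Proof.
split=> [|s u v /asboolP hu /asboolP hv]; apply/asboolP; first exact: subm0.
by apply: submD => //; apply: submZ.
Qed.
HB.instance Definition _ M (A : subm M) :=
  GRing.isSubmodClosed.Build S M (subm_pred A) (subm_pred_closed A).

Definition sub M (A : subm M) : Type := {u : M | u \in subm_pred A}.
HB.instance Definition _ M (A : subm M) := [isSub of sub A for @sval _ _].
HB.instance Definition _ M (A : subm M) := [Choice of sub A by <:].
HB.instance Definition _ M (A : subm M) := [SubChoice_isSubLmodule of sub A by <:].

Definition smod M (A : subm M) : lmodType S := GRing.Lmodule.clone S (sub A) _.
Definition sinc M (A : subm M) : {linear smod A -> M} := (val : sub A -> M).
Arguments sinc : simpl never.

Lemma sincP M (A : subm M) (u : smod A) : A (sinc A u).
Proof. exact/asboolP/(valP u). Qed.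

Lemma sinc_inj M (A : subm M) : injective (sinc A).
Proof. exact: val_inj. Qed.

Lemma sinc_mem M (A : subm M) u : A u -> exists v, sinc A v = u.
Proof. by move=> hu; exists (Sub u (asboolT hu) : sub A). Qed.

Lemma smod_lift M N (A : subm M) (f : {linear N -> M}) :
  (forall u, A (f u)) -> exists g : {linear N -> smod A}, forall u, sinc A (g u) = f u.
Proof.
by move=> h; apply: (lin_corestrict (@sinc_inj _ _)) => u; apply: sinc_mem.
Qed.

Section Qmod.
Variables (M : lmodType S) (A : subm M).
Definition quotm : Type := Quotient.quot (subm_pred A : zmodClosed M).
HB.instance Definition _ := GRing.Zmodule.on quotm.
Definition quotp : M -> quotm := \pi_(Quotient.quot (subm_pred A : zmodClosed M))%qT.

Lemma quotp_eq u v : quotp u = quotp v <-> A (u - v).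
Proof.
split=> [/eqP|h].
  by rewrite /quotp -Quotient.idealrBE => /asboolP.
by apply/eqP; rewrite /quotp -Quotient.idealrBE; apply/asboolP.
Qed.

Definition qsec (q : quotm) : M :=
  @repr _ (Quotient.quot (subm_pred A : zmodClosed M)) q.
Lemma qsecK q : quotp (qsec q) = q. Proof. exact: reprK. Qed.
Lemma quotpB u v : quotp (u - v) = quotp u - quotp v.
Proof. exact: pi_is_zmod_morphism. Qed.
Lemma quotpD u v : quotp (u + v) = quotp u + quotp v.
Proof.
have e0 : quotp 0 = 0 by rewrite -(subrr 0) quotpB subrr.
by rewrite -{1}[v]opprK -[- v]sub0r !quotpB e0 sub0r opprK.
Qed.

Definition qscale (s : S) (q : quotm) : quotm := quotp (s *: qsec q).
Lemma qscaleE s u : qscale s (quotp u) = quotp (s *: u).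
Proof.
by apply/quotp_eq; rewrite -scalerBr; apply: submZ; apply/quotp_eq/qsecK.
Qed.
Lemma qscaleA s t q : qscale s (qscale t q) = qscale (s * t) q.
Proof. by rewrite -[q]qsecK !qscaleE scalerA. Qed.
Lemma qscale1 : left_id 1 qscale.
Proof. by move=> q; rewrite -[q]qsecK qscaleE scale1r. Qed.
Lemma qscaleDr : right_distributive qscale +%R.
Proof.
move=> s p q; rewrite -[p]qsecK -[q]qsecK.
by rewrite -quotpD !qscaleE scalerDr quotpD.
Qed.
Lemma qscaleDl q : {morph qscale^~ q : s t / s + t}.
Proof. by move=> s t; rewrite -[q]qsecK !qscaleE scalerDl quotpD. Qed.
HB.instance Definition _ := GRing.Zmodule_isLmodule.Build S quotm
  qscaleA qscale1 qscaleDr qscaleDl.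
Lemma quotp_linear : linear quotp.
Proof. by move=> s u v; rewrite quotpD -qscaleE. Qed.
Definition qmod : lmodType S := GRing.Lmodule.clone S quotm _.
Definition qproj : {linear M -> qmod} := lin_of quotp_linear.
Arguments qproj : simpl never.

Lemma qproj_surj v : exists u, qproj u = v.
Proof. by exists (qsec v); rewrite -[LHS]/(quotp _) qsecK. Qed.
Lemma qproj_eq0 u : qproj u = 0 <-> A u.
Proof. by rewrite -(linear0 qproj) quotp_eq subr0. Qed.
End Qmod.

Definition ker_subm M N (f : {linear M -> N}) : subm M.
Proof.
exists [set u | f u = 0] => [|u v|s u] /=; first exact: linear0.
  by rewrite linearD => -> ->; rewrite addr0.
by rewrite linearZ /= => ->; rewrite scaler0.
Defined.

Definition range_subm M N (f : {linear M -> N}) : subm N.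
Proof.
exists (range f) => [|u v|s u] /=; first by exists 0 => //; rewrite linear0.
  by move=> [a _ <-] [b _ <-]; exists (a + b) => //; rewrite linearD.
by move=> [a _ <-]; exists (s *: a) => //; rewrite linearZ.
Defined.

Definition funm (B : Type) M : lmodType S := GRing.Lmodule.clone S (B -> M) _.

(** The identity if [i = j] and zero otherwise. Being total in [i] and [j], it relates terms whose
    degrees are equal without being convertible, and it is linear without any transport in
    statements. *)
Definition castm (I : eqType) (F : I -> lmodType S) (i j : I) : {linear F i -> F j} :=
  match eqP : reflect (i = j) (i == j) with
  | ReflectT e => ecast k {linear F i -> F k} e (idfun : {linear F i -> F i})
  | ReflectF _ => \0
  end.

Lemma castm_id (I : eqType) (F : I -> lmodType S) i (u : F i) : castm F i i u = u.
Proof. by rewrite /castm; case: eqP => // e; rewrite (eq_irrelevance e erefl). Qed.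
Lemma castm_neq (I : eqType) (F : I -> lmodType S) i j (u : F i) :
  i <> j -> castm F i j u = 0.
Proof. by rewrite /castm; case: eqP. Qed.

End Linear.

(** * Free modules, as coefficient functions of finite formal sums *)

Section Free.
Variable (S : comPzRingType) (B : choiceType).
Implicit Types (M N : lmodType S) (s : seq (S * B)).

Definition coef s (b : B) : S := \sum_(p <- s | p.2 == b) p.1.

Definition leval M (g : B -> M) s : M := \sum_(p <- s) p.1 *: g p.2.

(** An element of [freem] remembers only coefficients, while [leval] runs through a list; this lemma
    makes evaluation well defined on [freem]. The induction removes all entries over one basis
    element at once, since together they contribute a zero coefficient. *)
Lemma leval_coef0 M (g : B -> M) s : (forall b, coef s b = 0) -> leval g s = 0.
Proof.
have [n hn] := ubnP (size s); elim: n => // n IHn in s hn *.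
case: s hn => [|[a b] s hn h]; first by rewrite /leval big_nil.
pose s' := [seq p <- (a, b) :: s | p.2 != b].
have s'0 c : coef s' c = 0.
  have [->|cb] := eqVneq c b.
    by rewrite /coef big_filter_cond big_pred0 // => p; case: eqP.
  rewrite -(h c) /coef big_filter_cond; apply: eq_bigl => p.
  by rewrite andbC; case: eqP => // ->; rewrite cb.
rewrite /leval (bigID (fun p => p.2 == b)) /=.
rewrite (eq_bigr (fun p => p.1 *: g b)) => [|p /eqP -> //].
rewrite -scaler_suml [X in X *: _]h scale0r add0r -big_filter; apply: IHn => //.
by move: hn; rewrite /= eqxx /= ltnS; apply: leq_ltn_trans; rewrite size_filter count_size.
Qed.

Definition lscale a s := [seq (a * p.1, p.2) | p <- s].

Lemma coef_cat s t b : coef (s ++ t) b = coef s b + coef t b.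
Proof. by rewrite /coef big_cat. Qed.
Lemma coef_scale a s b : coef (lscale a s) b = a * coef s b.
Proof. by rewrite /coef big_map mulr_sumr. Qed.
Lemma leval_cat M (g : B -> M) s t : leval g (s ++ t) = leval g s + leval g t.
Proof. by rewrite /leval big_cat. Qed.
Lemma leval_scale M (g : B -> M) a s : leval g (lscale a s) = a *: leval g s.
Proof.
by rewrite /leval big_map scaler_sumr; apply: eq_bigr => p _; rewrite scalerA.
Qed.

Definition freem_subm : subm (funm B (S^o : lmodType S)).
Proof.
exists (fun f => exists s, f = coef s) => [|_ _ [s ->] [t ->]|a _ [s ->]].
- by exists [::]; apply/funext => b; rewrite /coef big_nil.
- by exists (s ++ t); apply/funext => b; rewrite coef_cat.
- by exists (lscale a s); apply/funext => b; rewrite coef_scale.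
Defined.

Definition freem : lmodType S := smod freem_subm.

Lemma delta_mem b : freem_subm (coef [:: (1, b)]). Proof. by exists [:: (1, b)]. Qed.
Definition delta b : freem := sval (cid (sinc_mem (delta_mem b))).
Lemma sinc_delta b : sinc _ (delta b) = coef [:: (1, b)].
Proof. by rewrite /delta; case: cid. Qed.

Lemma freemP (u : freem) : exists s, u = leval delta s.
Proof.
have [s hs] := sincP u; exists s; apply: sinc_inj; rewrite hs.
elim: s {hs} => [|[a b] s IHs].
  by rewrite /leval big_nil; apply/funext => b; rewrite /coef big_nil.
rewrite /leval big_cons linearD linearZ_LR; rewrite -/(leval _ _) -IHs sinc_delta.
apply/funext => c; rewrite -[_ :: _]/([:: (a, b)] ++ s) coef_cat; congr (_ + _).
by rewrite -[RHS]/(a * coef [:: (1, b)] c) -coef_scale /lscale /= mulr1.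
Qed.

Lemma freem_ext M (f g : {linear freem -> M}) :
  (forall b, f (delta b) = g (delta b)) -> f =1 g.
Proof.
move=> h u; have [s ->] := freemP u.
rewrite /leval !linear_sum /=; apply: eq_bigr => p _.
by rewrite !linearZ /= h.
Qed.

Lemma freem_lift M (g : B -> M) :
  exists f : {linear freem -> M}, forall b, f (delta b) = g b.
Proof.
have /choice[r hr] (u : freem) : exists s, sinc _ u = coef s := sincP u.
have rE (u : freem) s : sinc freem_subm u = coef s -> leval g (r u) = leval g s.
  move=> e; apply/eqP; rewrite -subr_eq0 -scaleN1r -leval_scale -leval_cat.
  rewrite leval_coef0 // => b.
  by rewrite coef_cat coef_scale -hr e mulN1r subrr.
have hl : linear (fun u => leval g (r u)).
  move=> a u v; rewrite -leval_scale -leval_cat; apply: rE.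
  rewrite linearP !hr; apply/funext => b.
  by rewrite coef_cat coef_scale.
exists (lin_of hl) => b /=; rewrite (rE _ [:: (1, b)]) ?sinc_delta //.
by rewrite /leval big_cons big_nil addr0 scale1r.
Qed.

Lemma freem_reg (x : S) : GRing.lreg x -> injective (fun u : freem => x *: u).
Proof.
move=> hx u v /(congr1 (sinc _)); rewrite !linearZ /= => e; apply: sinc_inj.
by apply/funext => b; apply: hx; move: e => /(congr1 (fun f => f b)).
Qed.

Lemma freem_projective : projective_module freem.
Proof.
move=> M N u f hu.
have /choice[g hg] : forall b, exists a, u a = f (delta b) by move=> b; apply: hu.
have [h hh] := freem_lift g; exists h.
by apply: (@freem_ext _ (u \o h) f) => b /=; rewrite hh hg.
Qed.

End Free.
Arguments delta {S B}.

(** * Enough injectives *)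

(** Baer's argument with Zorn's lemma, applied to the graphs in [N * D] of partial extensions of [f]
    along [u]. *)
Lemma divisible_injective (D : lmodType int) :
  (forall (n : int) (d : D), n != 0 -> exists e, n *: e = d) ->
  injective_module D.
Proof.
move=> div M N u f u_inj.
pose good (G : set (N * D)) := [/\ forall m, G (u m, f m),
  forall a b d e, G (a, d) -> G (b, e) -> G (a + b, d + e),
  forall n a d, G (a, d) -> G (n *: a, n *: d) &
  forall d, G (0, d) -> d = 0].
have [|A [PA maxA]] := @Zorn_bigcup _ [set G | G = set0 \/ good G].
  move=> F FP Ftot; have [[X FX gX]|noX] := pselect (exists2 X, F X & good X).
    right; split.
    - by move=> m; exists X => //; case: gX.
    - move=> a b d e [Y FY Yad] [Z FZ Zbe].
      have [YZ|ZY] := Ftot _ _ FY FZ.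
        have [Z0|[_ hD _ _]] := FP _ FZ; first by move: Zbe; rewrite Z0.
        by exists Z => //; apply: hD => //; apply: YZ.
      have [Y0|[_ hD _ _]] := FP _ FY; first by move: Yad; rewrite Y0.
      by exists Y => //; apply: hD => //; apply: ZY.
    - move=> n a d [Y FY Yad]; exists Y => //.
      by have [Y0|[_ _ hZ _]] := FP _ FY; [move: Yad; rewrite Y0|apply: hZ].
    - move=> d [Y FY Yd].
      by have [Y0|[_ _ _ h0]] := FP _ FY; [move: Yd; rewrite Y0|apply: h0].
  left; apply/seteqP; split=> // p [Y FY Yp].
  have [Y0|gY] := FP _ FY; first by move: Yp; rewrite Y0.
  by exfalso; apply: noX; exists Y.
have gG0 : good [set (u m, f m) | m in setT].
  split=> [m|_ _ _ _ [a _ [<- <-]] [b _ [<- <-]]|n _ _ [a _ [<- <-]]|d [a _ [ua <-]]].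
  - by exists m.
  - by exists (a + b) => //; rewrite !linearD.
  - by exists (n *: a) => //; rewrite !linearZ.
  - by rewrite (u_inj a 0) ?linear0.
have gA : good A.
  case: PA => // A0; exfalso; apply: (maxA _ _ (or_intror gG0)).
  rewrite A0; split=> // h; have /h : [set (u m, f m) | m in setT] (u 0, f 0) by exists 0.
  by [].
have [Au AD AZ Afun] := gA.
have AN a d : A (a, d) -> A (- a, - d) by move=> /(AZ (-1)); rewrite !scaleN1r.
have Auniq a d e : A (a, d) -> A (a, e) -> d = e.
  move=> ad /AN ae; apply/eqP; rewrite -subr_eq0; apply/eqP/Afun.
  by rewrite -(subrr a); apply: AD.
suff /choice[g gA'] : forall n, exists d, A (n, d).
  have gl : linear g.
    by move=> n a b; apply: (Auniq (n *: a + b)) => //; apply: AD => //; apply: AZ.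
  by exists (lin_of gl) => a /=; apply: (Auniq (u a)).
move=> n0; apply: contrapT => hn0.
(* The value [d0] to be given to [n0] must agree with [A] on the multiples of [n0] in its domain.
   They are the multiples of a least positive [k], and divisibility provides [d0] with [k *: d0]
   prescribed; if there is no such [k], zero will do. *)
have [d0 hd0] : exists d0, forall (k : int) e, A (k *: n0, e) -> e = k *: d0.
  have [[k [k0 [e Ake]]]|nok] :=
      pselect (exists k : nat, k != 0%N /\ exists e, A (k%:Z *: n0, e)); last first.
    exists 0 => k e Ake; rewrite scaler0; have [k0|k0] := eqVneq k 0.
      by apply: Afun; rewrite -(scale0r n0) -k0.
    exfalso; apply: nok; exists `|k|%N; split; first by rewrite absz_eq0.
    have [kp|kn] := leP 0 k; first by exists e; rewrite gez0_abs.
    by exists (- e); rewrite ltz0_abs // scaleNr; apply: AN.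
  have exk : exists k, (k != 0%N) && `[< exists e, A (k%:Z *: n0, e) >].
    by exists k; rewrite k0; apply/asboolP; exists e.
  case: (ex_minnP exk) => {e Ake k0} {}k /andP[k0 /asboolP[e Ake]] kmin.
  have [d0 kd0] := div k%:Z e k0; exists d0 => l e' Ale'.
  have Ar : A ((l %% k%:Z)%Z *: n0, e' - (l %/ k%:Z)%Z *: e).
    have -> : (l %% k%:Z)%Z *: n0 = l *: n0 + - ((l %/ k%:Z)%Z *: (k%:Z *: n0)).
      by rewrite scalerA -scalerBl.
    by apply: AD => //; apply: AN; apply: AZ.
  have r0 : (l %% k%:Z)%Z = 0.
    apply/eqP/negPn/negP => rn0.
    have := kmin `|(l %% k%:Z)%Z|%N; rewrite absz_eq0 rn0 /= gez0_abs ?modz_ge0 //.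
    have -> : `[< exists e, A ((l %% k%:Z)%Z *: n0, e) >].
      by apply/asboolP; eexists; exact: Ar.
    move=> /(_ isT); rewrite leqNgt => /negP; apply.
    by rewrite -ltz_nat gez0_abs ?modz_ge0 // ltz_mod.
  move: Ar; rewrite r0 scale0r => /Afun/eqP; rewrite subr_eq0 => /eqP ->.
  by rewrite -kd0 scalerA {2}(divz_eq l k) r0 addr0.
pose B := [set p : N * D | exists k a e, A (a, e) /\ p = (a + k *: n0, e + k *: d0)].
have AB : A `<=` B by move=> [a e] ?; exists 0, a, e; rewrite !scale0r !addr0.
apply: (maxA B).
  split=> // BA; apply: hn0; exists d0; apply: BA; exists 1, 0, 0.
  by rewrite !scale1r !add0r; split=> //; rewrite -(linear0 u) -(linear0 f).
right; split.
- by move=> m; apply: AB.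
- move=> _ _ _ _ [k [a [d [ad [-> ->]]]]] [l [b [e [be [-> ->]]]]].
  by exists (k + l), (a + b), (d + e); rewrite !scalerDl; split; [apply: AD|congr pair; zmod].
- move=> n _ _ [k [a [d [ad [-> ->]]]]]; exists (n * k), (n *: a), (n *: d).
  by split; [apply: AZ|rewrite !scalerDr !scalerA].
- move=> _ [k [a [d [ad [/esym e0 ->]]]]].
  have ka : k *: n0 = - a by apply/eqP; rewrite -addr_eq0 addrC e0.
  by rewrite -(hd0 k (- d)) ?subrr // ka; apply: AN.
Qed.

Lemma zmodule_scaleE (V : zmodType) (n : int) (v : zmodule V) : n *: v = v *~ n.
Proof. by []. Qed.

Lemma scaler_intz (V : lmodType int) (n : int) (v : V) : n *: v = v *~ n.
Proof. by rewrite -scaler_int intz. Qed.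

(** [V] is the quotient of the free group on [V] by the kernel of evaluation [ev]. Dividing the
    rational vector space on [V] by the same kernel [K0] gives a divisible group that contains
    [V]. *)
Lemma enough_injectives_int (V : lmodType int) :
  exists (D : lmodType int) (u : {linear V -> D}), injective_module D /\ injective u.
Proof.
pose W : lmodType int := GRing.Lmodule.clone int (zmodule (freem rat V)) _.
have [ev evE] := freem_lift (fun v : V => v).
pose K0 (f : W) := exists2 g : freem int V,
  forall b, sinc _ (f : freem rat V) b = (sinc _ g b)%:~R :> rat & ev g = 0.
have K : {K : subm W | K0 = K :> (W -> Prop)}.
  unshelve eexists; first exists K0; last by [].
  - by exists 0 => [b|]; rewrite !linear0.
  - move=> f f' [g hg g0] [h hh h0]; exists (g + h); last by rewrite linearD g0 h0 addr0.
    move=> b; rewrite (linearD (sinc (freem_subm rat V)) f f') linearD.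
    by rewrite -[LHS]/(sinc _ f b + sinc _ f' b) hg hh -intrD.
  - move=> n f [g hg g0]; exists (n *: g); last by rewrite linearZ /= g0 scaler0.
    move=> b; rewrite zmodule_scaleE -(@scaler_int rat (freem rat V)) (linearZ_LR (sinc (freem_subm rat V))) linearZ_LR.
    by rewrite -[LHS]/(n%:~R * sinc _ f b) hg -intrM.
case: K => K KE.
have deltaE (v : V) b : sinc _ (delta v : freem rat V) b = (sinc _ (delta v : freem int V) b)%:~R.
  by rewrite !sinc_delta /coef !big_mkcond !big_cons !big_nil /=; case: eqP.
have hl : linear (fun v : V => qproj K (delta v : freem rat V)).
  move=> n v w; rewrite -linearP; apply/quotp_eq; rewrite -KE.
  exists (delta (n *: v + w) - (n *: delta v + delta w)).
    move=> b; rewrite zmodule_scaleE -(@scaler_int rat (freem rat V)).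
    rewrite (linearB (sinc (freem_subm rat V))) (linearD (sinc (freem_subm rat V))).
    rewrite (linearZ_LR (sinc (freem_subm rat V))).
    rewrite (linearB (sinc (freem_subm int V))) (linearD (sinc (freem_subm int V))).
    rewrite (linearZ_LR (sinc (freem_subm int V))).
    rewrite -[LHS]/(sinc _ (delta (n *: v + w) : freem rat V) b -
      (n%:~R * sinc _ (delta v : freem rat V) b + sinc _ (delta w : freem rat V) b)).
    by rewrite !deltaE -intrM -intrD -intrB.
  by rewrite linearB linearP !evE subrr.
exists (qmod K), (lin_of hl); split.
  apply: divisible_injective => n d n0; have [f <-] := qproj_surj d.
  exists (qproj K (n%:~R^-1 *: (f : freem rat V) : W)); rewrite -linearZ_LR.
  by rewrite zmodule_scaleE -(@scaler_int rat (freem rat V)) scalerA divff ?scale1r // intr_eq0.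
apply: lin_inj => v /= /qproj_eq0; rewrite -KE => -[g hg g0].
rewrite -(evE v) -g0; congr (ev _); apply: sinc_inj; apply/funext => b.
by apply: (@intr_inj rat); rewrite -hg deltaE.
Qed.

Lemma zmodule_linear (A : zmodType) (D : lmodType int) (h : A -> D) :
  zmod_morphism h -> linear (h : zmodule A -> D).
Proof.
move=> hm n a b.
pose hh : {additive A -> D} := HB.pack h (GRing.isZmodMorphism.Build A D h hm).
by rewrite -[LHS]/(hh (a *~ n + b)) raddfD raddfMz scaler_intz.
Qed.

(** * Coinduced modules: additive maps from S to a Z-module D *)

Section Coinduced.
Variables (S : comPzRingType) (D : lmodType int).

Definition coind_subm : subm (funm S D).
Proof.
exists (fun f => zmod_morphism f) => [a b|f g hf hg a b|n f hf a b].
- by rewrite subrr.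
- by rewrite -[LHS]/(f (a - b) + g (a - b)) hf hg -[RHS]/(f a + g a - (f b + g b)); zmod.
- by rewrite -[LHS]/(n *: f (a - b)) hf scalerBr.
Defined.

(** A separate type, because [smod coind_subm] already carries a Z-module structure and an S-module
    structure is wanted here. *)
Definition coindt : Type := smod coind_subm.
HB.instance Definition _ := GRing.Zmodule.on coindt.
Definition coinde (f : coindt) : S -> D := sinc coind_subm f.

Lemma coinde_inj f g : coinde f =1 coinde g -> f = g.
Proof. by move=> h; apply: sinc_inj; apply/funext. Qed.
Lemma coindeB f a b : coinde f (a - b) = coinde f a - coinde f b.
Proof. exact: (sincP f). Qed.
Lemma coindeD f a b : coinde f (a + b) = coinde f a + coinde f b.
Proof.
have e0 : coinde f 0 = 0 by rewrite -(subrr 0) coindeB subrr.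
by rewrite -{1}[b]opprK -[- b]sub0r !coindeB e0 sub0r opprK.
Qed.
Lemma coindDe f g a : coinde (f + g) a = coinde f a + coinde g a.
Proof. by []. Qed.

Lemma coind_mk (f : S -> D) : zmod_morphism f -> exists g, coinde g =1 f.
Proof. by move=> /(@sinc_mem _ _ coind_subm)[g hg]; exists g => a; rewrite /coinde hg. Qed.

Lemma coind_scale_subproof s f : exists g, coinde g =1 (fun a => coinde f (a * s)).
Proof. by apply: coind_mk => a b; rewrite mulrBl coindeB. Qed.
Definition coind_scale s f := sval (cid (coind_scale_subproof s f)).
Lemma coind_scaleE s f a : coinde (coind_scale s f) a = coinde f (a * s).
Proof. by rewrite /coind_scale; case: cid. Qed.
Lemma coind_scaleA s t q : coind_scale s (coind_scale t q) = coind_scale (s * t) q.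
Proof. by apply: coinde_inj => a; rewrite !coind_scaleE mulrA. Qed.
Lemma coind_scale1 : left_id 1 coind_scale.
Proof. by move=> q; apply: coinde_inj => a; rewrite coind_scaleE mulr1. Qed.
Lemma coind_scaleDr : right_distributive coind_scale +%R.
Proof.
by move=> s p q; apply: coinde_inj => a; rewrite coindDe !coind_scaleE coindDe.
Qed.
Lemma coind_scaleDl q : {morph coind_scale^~ q : s t / s + t}.
Proof.
by move=> s t; apply: coinde_inj => a; rewrite coindDe !coind_scaleE mulrDr coindeD.
Qed.
HB.instance Definition _ := GRing.Zmodule_isLmodule.Build S coindt
  coind_scaleA coind_scale1 coind_scaleDr coind_scaleDl.
Definition coind : lmodType S := GRing.Lmodule.clone S coindt _.

Lemma coind_lift (M : lmodType S) (f : M -> D) : zmod_morphism f ->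
  exists g : {linear M -> coind}, forall u a, coinde (g u) a = f (a *: u).
Proof.
move=> hf; have /choice[g hg] (u : M) : exists g, coinde g =1 (fun a => f (a *: u)).
  by apply: coind_mk => a b; rewrite scalerBl hf.
have f0 : f 0 = 0 by rewrite -(subrr 0) hf subrr.
have fD u v : f (u + v) = f u + f v.
  by rewrite -{1}[v]opprK -[- v]sub0r !hf f0 sub0r opprK.
have hl : linear (g : M -> coind).
  move=> s u v; apply: coinde_inj => a.
  rewrite coindDe [coinde (s *: g u) a]coind_scaleE !hg.
  by rewrite -fD scalerDr scalerA.
by exists (lin_of hl).
Qed.

(** Linear maps into [coind] correspond to additive maps into [D] by evaluation at 1, so an
    extension over [N] is found in [D] and transported back by [coind_lift]. *)
Lemma coind_injective : injective_module D -> injective_module coind.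
Proof.
move=> Dinj M N u f u_inj.
have um : zmod_morphism (u : M -> zmodule N) by move=> a b; exact: (linearB u).
have fm : zmod_morphism (fun a => coinde (f a) 1).
  by move=> a b; rewrite linearB; apply/eqP; rewrite eq_sym subr_eq -coindDe subrK.
have [g hg] := Dinj _ _ (lin_of (zmodule_linear um)) (lin_of (zmodule_linear fm)) u_inj.
have [h hh] : exists h : {linear N -> coind}, forall u a, coinde (h u) a = g (a *: u).
  by apply: (@coind_lift N g) => a b; rewrite -(linearB g).
exists h => a; apply: coinde_inj => r; rewrite hh -linearZ_LR.
rewrite -[LHS]/(g (lin_of (zmodule_linear um) (r *: a))) hg /=.
by rewrite linearZ_LR -[coinde _ 1]/(coinde (coind_scale _ _) 1) coind_scaleE mul1r.
Qed.

End Coinduced.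

Theorem enough_injectives (S : comPzRingType) (M : lmodType S) :
  exists (E : lmodType S) (u : {linear M -> E}), injective_module E /\ injective u.
Proof.
have [D [u [Dinj u_inj]]] := enough_injectives_int (GRing.Lmodule.clone int (zmodule M) _).
have [v hv] : exists v : {linear M -> coind S D}, forall m a, coinde (v m) a = u (a *: m).
  by apply: (@coind_lift S D M u) => a b; rewrite -(linearB u).
exists (coind S D), v; split; first exact: coind_injective.
by move=> a b e; apply: u_inj; rewrite -[a]scale1r -[b in RHS]scale1r -!hv e.
Qed.

(** * Complexes, homotopies and cones *)

Lemma addNr_eq0 (V : zmodType) (a b : V) : 0 = - a + b -> a = b.
Proof. by move=> e; apply/eqP; rewrite eq_sym -subr_eq0 addrC -e. Qed.

Section Complexes.
Variable S : comPzRingType.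
Implicit Types (M N L : lmodType S) (X Y A B P I : complex S).

Definition prodm M N : lmodType S := GRing.Lmodule.clone S (M * N)%type _.
Definition lfst M N : {linear prodm M N -> M} := (fst : M * N -> M).
Definition lsnd M N : {linear prodm M N -> N} := (snd : M * N -> N).

Lemma lpair_linear M N L (f : {linear L -> M}) (g : {linear L -> N}) :
  linear (fun u => (f u, g u) : prodm M N).
Proof. by move=> s u v; apply: (congr2 pair); apply: linearP. Qed.
Definition lpair M N L (f : {linear L -> M}) (g : {linear L -> N}) := lin_of (lpair_linear f g).

Lemma lcopair_linear M N L (f : {linear M -> L}) (g : {linear N -> L}) :
  linear (fun u : prodm M N => f u.1 + g u.2).
Proof.
move=> s [u u'] [v v']; rewrite -[LHS]/(f (s *: u + v) + g (s *: u' + v')).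
by rewrite !linearP scalerDr /=; zmod.
Qed.
Definition lcopair M N L (f : {linear M -> L}) (g : {linear N -> L}) := lin_of (lcopair_linear f g).

Lemma prodm_eq0 M N (u : M) (v : N) : (u, v) = 0 :> prodm M N <-> u = 0 /\ v = 0.
Proof. by split=> [[-> ->]|[-> ->]]. Qed.

Lemma homology_zeroP X (l k m : int) : l = k + 1 -> m = k - 1 ->
  homology_zero X k <->
  forall u : X k, diff X k m u = 0 -> exists v : X l, diff X l k v = u.
Proof.
move=> -> ->; split=> h u.
  by move=> /h[v _ <-]; exists v.
by move=> /h[v <-]; exists v.
Qed.

Lemma quasi_isoP X Y (f : chain_map X Y) : quasi_iso f <->
  forall l k m : int, l = k + 1 -> m = k - 1 ->
    (forall u : X k, diff X k m u = 0 -> (exists w, f k u = diff Y l k w) ->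
       exists v : X l, diff X l k v = u)
    /\ (forall v : Y k, diff Y k m v = 0 ->
       exists u : X k, diff X k m u = 0 /\ exists w, f k u - v = diff Y l k w).
Proof.
split=> h.
  move=> l k m -> ->; have [h1 h2] := h k; split=> [u u0 [w hw]|v v0].
    by have [|v _ <-] := h1 u u0; [exists w|exists v].
  by have [u u0 [w _ hw]] := h2 v v0; exists u; split=> //; exists w.
move=> k; have [h1 h2] := h _ k _ erefl erefl; split=> [u u0 [w _ hw]|v v0].
  by have [|v <-] := h1 u u0; [exists w|exists v].
by have [u [u0 [w hw]]] := h2 v v0; exists u => //; exists w.
Qed.

Definition mk_chain_map X Y (f : forall i, {linear X i -> Y i})
  (hf : forall i j u, j = i - 1 -> f j (diff X i j u) = diff Y i j (f i u)) :
  chain_map X Y.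
Proof.
exists f => i j u; have [/hf//|ji] := eqVneq j (i - 1).
by rewrite !diff_shape // linear0.
Defined.

Lemma sgn_pred (i : int) : (-1) ^+ `|i - 1|%N = - (-1) ^+ `|i|%N :> S.
Proof.
rewrite -signr_odd -[in RHS]signr_odd -signrN; congr (_ ^+ nat_of_bool _); lia.
Qed.

Lemma sgn_sgn (i : int) : (-1) ^+ `|i|%N * (-1) ^+ `|i|%N = 1 :> S.
Proof. by rewrite -expr2 sqrr_sign. Qed.

Definition cycle_deg A X (e : int) (phi : forall i j, {linear A i -> X j}) : Prop :=
  forall i j k l, j = i + e -> k = i - 1 -> l = j - 1 ->
    forall u, diff X j l (phi i j u) = phi k l (diff A i k u).

Definition boundary_deg A X (e : int) (phi : forall i j, {linear A i -> X j}) : Prop :=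
  exists h : forall i j, {linear A i -> X j},
  forall i j k l, j = i + e -> k = i - 1 -> l = j + 1 ->
    forall u, phi i j u = diff X l j (h i l u) + h k j (diff A i k u).

(* H_e(Hom(A, X)) = 0, for families of maps A_i -> X_j of which only those with j = i + e
   matter (and j = i + e + 1 for homotopies). *)
Definition hom_zero A X (e : int) : Prop :=
  forall phi : forall i j, {linear A i -> X j}, cycle_deg e phi -> boundary_deg e phi.

(** Multiplying the component on [A i] by (-1)^i exchanges families that commute with the
    differentials and families that anticommute. This is why [cycle_deg] and [boundary_deg] can do
    without the sign (-1)^e of the Hom complex. *)
Lemma hom_zero_anti A X e : hom_zero A X e ->
  forall phi : forall i j, {linear A i -> X j},
  (forall i j k l, j = i + e -> k = i - 1 -> l = j - 1 ->
    forall u, diff X j l (phi i j u) = - phi k l (diff A i k u)) ->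
  exists h : forall i j, {linear A i -> X j},
  forall i j k l, j = i + e -> k = i - 1 -> l = j + 1 ->
    forall u, phi i j u = diff X l j (h i l u) - h k j (diff A i k u).
Proof.
move=> AX phi hphi; pose s i : S := (-1) ^+ `|i : int|%N.
have [h hh] : boundary_deg e (fun i j => s i \*: phi i j : {linear A i -> X j}).
  apply: AX => i j k l hj hk hl u /=.
  by rewrite linearZ /= (hphi _ _ k) // hk /s sgn_pred scalerN scaleNr.
exists (fun i j => s i \*: h i j : {linear A i -> X j}) => i j k l hj hk hl u /=.
rewrite -[LHS]scale1r -(sgn_sgn i) -scalerA.
have /= -> := hh i j k l hj hk hl u.
by rewrite scalerDr linearZ /= hk /s sgn_pred scaleNr opprK.
Qed.

(** Since [j + 1 - 1] is not convertible to [j], a family with targets [X (l - 1)] has to be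
    reindexed through [castm]; the equation in the conclusion hides the casts. The next lemma and
    [fam_shiftn] serve the same purpose. *)
Lemma fam_shift_tgt X (M : int -> lmodType S) (H : forall i l, {linear M i -> X (l - 1)}) :
  exists H' : forall i j, {linear M i -> X j}, forall (i l : int) u, H' i (l - 1) u = H i l u.
Proof.
exists (fun i j => castm X (j + 1 - 1) j \o H i (j + 1)) => i l u /=.
have : forall l', l' = l -> castm X (l' - 1) (l - 1) (H i l' u) = H i l u.
  by move=> _ ->; rewrite castm_id.
by apply; rewrite subrK.
Qed.

Lemma fam_shift_src A (M : int -> lmodType S) (H : forall i l, {linear A (i - 1) -> M l}) :
  exists H' : forall i j, {linear A i -> M j}, forall (i l : int) u, H' (i - 1) l u = H i l u.
Proof.
exists (fun i j => H (i + 1) j \o castm A i (i + 1 - 1)) => i l u /=.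
have : forall i', i' = i -> H i' l (castm A (i - 1) (i' - 1) u) = H i l u.
  by move=> _ ->; rewrite castm_id.
by apply; rewrite subrK.
Qed.

(** The differential keeps its sign, so that a family satisfying [cycle_deg e] is a chain map into
    [shift e X]. *)
Definition shift (e : int) X : complex S :=
  @Complex S (fun i => X (i + e)) (fun i j => diff X (i + e) (j + e))
    (fun i j (h : j != i - 1) u => @diff_shape S X (i + e) (j + e)
       ltac:(by apply: contra h => /eqP h; apply/eqP; lia) u)
    (fun i j k u => @diff_sq S X (i + e) (j + e) (k + e) u).

Lemma shift_acyclic e X : acyclic X -> acyclic (shift e X).
Proof.
move=> X0 i; apply/(homology_zeroP _ (erefl (i + 1)) (erefl (i - 1))) => /= u.
by apply: (iffLR (@homology_zeroP X (i + 1 + e) (i + e) (i - 1 + e) _ _)) => //; lia.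
Qed.

Lemma fam_shiftn X e (M : int -> lmodType S) (H : forall i l, {linear M i -> X (l + e)}) :
  exists H' : forall i j, {linear M i -> X j}, forall (i l : int) u, H' i (l + e) u = H i l u.
Proof.
exists (fun i j => castm X (j - e + e) j \o H i (j - e)) => i l u /=.
have : forall l', l' = l -> castm X (l' + e) (l + e) (H i l' u) = H i l u.
  by move=> _ ->; rewrite castm_id.
by apply; rewrite addrK.
Qed.

Lemma K_projective_hom P A e : K_projective P -> acyclic A -> hom_zero P A e.
Proof.
move=> hP /(@shift_acyclic e) A0 phi hphi.
have hc (i j : int) u : j = i - 1 -> phi j (j + e) (diff P i j u) =
    diff (shift e A) i j (phi i (i + e) u).
  by move=> hj; rewrite /= (hphi i _ j) //; lia.
have [h hh] := hP _ (mk_chain_map (Y := shift e A) hc) A0.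
have [H HE] := fam_shiftn h.
exists H => i j k l hj hk hl u; have {}hl : l = i + 1 + e by lia.
by subst j k l; rewrite !HE; apply: hh.
Qed.

Lemma K_injective_hom I A e : K_injective I -> acyclic A -> hom_zero A I e.
Proof.
move=> hI /(@shift_acyclic (- e)) A0 phi hphi.
have hc (i j : int) u : j = i - 1 -> phi (j - e) j (diff (shift (- e) A) i j u) =
    diff I i j (phi (i - e) i u).
  by move=> hj; rewrite /= -(hphi (i - e) i (j - e)) //; lia.
have [h hh] := hI _ (mk_chain_map (X := shift (- e) A) (f := fun i => phi (i - e) i) hc) A0.
pose H i j : {linear A i -> I j} := h (i + e) j \o castm A i (i + e - e).
have HE i j u : H (i - e) j u = h i j u.
  have : forall i', i' = i -> h i' j (castm A (i - e) (i' - e) u) = h i j u.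
    by move=> _ ->; rewrite castm_id.
  by apply; rewrite subrK.
exists H => i j k l hj hk hl u.
have ei : i = j - e by lia.
have {hj hk} hk : k = j - 1 - e by lia.
by subst i k l; rewrite !HE; apply: hh.
Qed.

Lemma K_projective_hom_zero P :
  (forall A, acyclic A -> hom_zero P A 0) -> K_projective P.
Proof.
move=> hP A f A0.
have [|h hh] := hP A A0 (fun i j => castm A i j \o f i).
  move=> i j k l; rewrite addr0 => -> -> -> u /=.
  by rewrite !castm_id cmap_comm.
exists h => i u; have /= := hh i i _ _ (esym (addr0 i)) erefl erefl u.
by rewrite castm_id.
Qed.

Lemma K_injective_hom_zero I :
  (forall A, acyclic A -> hom_zero A I 0) -> K_injective I.
Proof.
move=> hI A f A0.
have [|h hh] := hI A A0 (fun i j => castm I i j \o f i).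
  move=> i j k l; rewrite addr0 => -> -> -> u /=.
  by rewrite !castm_id cmap_comm.
exists h => i u; have /= := hh i i _ _ (esym (addr0 i)) erefl erefl u.
by rewrite castm_id.
Qed.

(** * Mapping cones *)

Section Cone.
Variables (A B : complex S) (f : chain_map A B).

Definition conem (i : int) : lmodType S := prodm (B i) (A (i - 1)).
Definition coned i j : {linear conem i -> conem j} :=
  lpair (lcopair (diff B i j) (castm B (i - 1) j \o f (i - 1)))
        (lcopair \0 (\- diff A (i - 1) (j - 1))).

Lemma coned_shape i j : j != i - 1 -> forall u, coned i j u = 0.
Proof.
move=> ji [b a] /=; have ji' : j - 1 != i - 1 - 1.
  by apply: contra ji => /eqP ?; apply/eqP; lia.
rewrite (diff_shape ji) (diff_shape ji') castm_neq ?oppr0 ?addr0 //.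
by move=> /eqP; rewrite eq_sym (negPf ji).
Qed.

Lemma coned_sq i j k u : coned j k (coned i j u) = 0.
Proof.
have [hj|/coned_shape->] := eqVneq j (i - 1); last by rewrite linear0.
have [hk|/coned_shape-> //] := eqVneq k (j - 1).
subst k j; case: u => b a /=; rewrite !add0r !castm_id !linearD !linearN /=.
rewrite !diff_sq cmap_comm; apply/prodm_eq0; split; last by rewrite oppr0 oppr0.
by zmod.
Qed.

Definition cone : complex S := @Complex S conem coned coned_shape coned_sq.

Lemma coneE i (b : B i) (a : A (i - 1)) : diff cone i (i - 1) (b, a) =
  (diff B i (i - 1) b + f (i - 1) a, - diff A (i - 1) (i - 1 - 1) a).
Proof. by rewrite /= castm_id add0r. Qed.

Lemma cone_acyclic : quasi_iso f <-> acyclic cone.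
Proof.
split=> [/quasi_isoP h k|h].
  apply/(homology_zeroP _ (erefl (k + 1)) (erefl (k - 1))).
  (* With [k + 1] generalized to [l] and [k] replaced by [l - 1], every differential runs from some
     [i] to [i - 1] literally, as [coneE] requires. This reindexing recurs below. *)
  move: (k + 1) (addrK 1 k) => l kl; move: (esym kl) => {kl} kl; subst k => -[b a].
  rewrite coneE => /prodm_eq0[b0 /eqP]; rewrite oppr_eq0 => /eqP a0.
  have [hi _] := h (l - 1) (l - 1 - 1) (l - 1 - 1 - 1) (esym (subrK _ _)) erefl.
  have [|a1 ha1] := hi a a0.
    by exists (- b); rewrite linearN /=; apply/eqP; rewrite -addr_eq0 [X in X == 0]addrC b0.
  have [_ hs] := h l (l - 1) (l - 1 - 1) (esym (subrK _ _)) erefl.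
  have [|a2 [a20 [b2 hb2]]] := hs (b + f (l - 1) a1).
    by rewrite linearD /= -cmap_comm ha1.
  exists (- b2, a2 - a1); rewrite coneE !linearB linearN /= -hb2 a20 ha1.
  by congr pair; zmod.
apply/quasi_isoP => l k m hl hm; split.
  have kl : k = l - 1 by lia.
  subst k m => {hl} u u0 [w hw].
  have [] := (homology_zeroP cone (erefl (l + 1)) (erefl (l - 1))).1 (h l) (- w, u).
    by rewrite coneE; apply/prodm_eq0; rewrite u0 oppr0 hw linearN addNr.
  move: (l + 1) (addrK 1 l) => l2 el; move: (esym el) => {}el; subst l => -[b' a'].
  by rewrite coneE => -[_ <-]; exists (- a'); rewrite linearN.
subst m => v v0; have {hl}kl : k = l - 1 by lia.
subst k; have [] := (homology_zeroP cone (esym (subrK 1 l)) (erefl (l - 1 - 1))).1 (h _) (v, 0).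
  by rewrite coneE !linear0 v0 addr0.
move=> [b' a']; rewrite coneE => -[<- /eqP]; rewrite oppr_eq0 => /eqP a0.
by exists a'; split=> //; exists (- b'); rewrite linearN /=; zmod.
Qed.

End Cone.

(** * Consequences of the long exact Hom sequences of a cone *)

Section Transfer.
Variables (X Y : complex S) (f : chain_map X Y).

(** Composed with the inclusion of [Y] into the cone, [phi] bounds. The second component [psi] of
    that homotopy is a cycle into [X], and the first component shows [phi] homotopic to [f psi];
    finally [psi] bounds. *)
Lemma hom_zero_tgt P e : hom_zero P (cone f) e ->
  hom_zero P X e -> hom_zero P Y e.
Proof.
move=> hP PX phi hphi.
have [h hh] : boundary_deg e (fun i j => lpair (phi i j) \0 : {linear P i -> cone f j}).
  apply: hP => i j k l -> -> -> u; rewrite [LHS]coneE /=.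
  by rewrite !linear0 addr0 (hphi i _ (i - 1)).
have [psi psiE] := fam_shift_tgt (fun i l => lsnd _ _ \o h i l).
have hE i j k l : j = i + e -> k = i - 1 -> l = j + 1 -> forall u,
    phi i j u = diff Y l j (lfst _ _ (h i l u)) + f j (psi i j u) + lfst _ _ (h k j (diff P i k u)) /\
    diff X j (j - 1) (psi i j u) = psi k (j - 1) (diff P i k u).
  move=> hj hk hl u; have := hh i j k l hj hk hl u.
  have {hj}ej : j = l - 1 by lia.
  clear hl; subst j; rewrite !psiE.
  rewrite (surjective_pairing (h i l u)) [diff (cone f) _ _ _]coneE.
  by rewrite [h k _ _]surjective_pairing => -[-> /addNr_eq0 ->].
have [g hg] : boundary_deg e psi.
  by apply: PX => i j k l hj hk -> u; have [] := hE i j k _ hj hk erefl u.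
exists (fun i l => (lfst _ _ \o h i l) \+ (f l \o g i l)) => i j k l hj hk hl u /=.
have [-> _] := hE i j k l hj hk hl u.
rewrite (hg i j k l) // !linearD /= cmap_comm; zmod.
Qed.

(** If [k] bounds [f psi], then (- k, psi) anticommutes with the differentials into the cone. A
    homotopy for it has, up to sign, a homotopy for [psi] as second component. *)
Lemma hom_zero_src_tgt P e : hom_zero P (cone f) (e + 1) ->
  hom_zero P Y e -> hom_zero P X e.
Proof.
move=> hP PY psi hpsi.
have [|k hk] := PY (fun i j => f j \o psi i j).
  by move=> i j k l hj hk hl u /=; rewrite -cmap_comm (hpsi i j k l).
have [|H hH] := @hom_zero_anti _ _ _ hP
  (fun i l => lpair (\- k i l) (psi i (l - 1)) : {linear P i -> cone f l}).
  move=> i l k' j hl hk' hj u; subst j; rewrite [LHS]coneE /=.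
  rewrite (hpsi i (l - 1) k' (l - 1 - 1)) //; last by lia.
  have /= -> := hk i (l - 1) k' l _ hk' _ u; try lia.
  by rewrite linearN; apply: (congr2 pair) => /=; zmod.
have [g gE] := fam_shift_tgt (fun i l => lsnd _ _ \o H i l).
exists (fun i l => \- g i l) => i j k' l hj hk' hl u.
have ej : j = l - 1 by lia.
have el : l = i + (e + 1) by lia.
clear hj hl; subst j; have := hH i l k' (l + 1) el hk' erefl u.
move: (l + 1) (addrK 1 l) => l2 el2; move: (esym el2) => {el2 el}el2.
subst l => /(congr1 snd) /= e1; rewrite !gE /= e1.
by rewrite linearN sub0r.
Qed.

Lemma hom_zero_src I e : hom_zero (cone f) I e ->
  hom_zero X I e -> hom_zero Y I e.
Proof.
move=> hI XI phi hphi.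
have [|k hk] := XI (fun i j => phi i j \o f i).
  by move=> i j k l hj hk hl u /=; rewrite (hphi i j k l) // cmap_comm.
have [|H hH] := hI (fun i j => lcopair (phi i j) (k (i - 1) j) : {linear cone f i -> I j}).
  move=> i j k' l hj hk' hl [b a]; subst k'; rewrite coneE /= !linearD linearN /=.
  rewrite (hphi i j (i - 1) l) //.
  have /= -> := hk (i - 1) l (i - 1 - 1) j _ erefl _ a; try lia.
  by zmod.
exists (fun i j => H i j \o lpair idfun \0) => i j k' l hj hk' hl u /=.
have := hH i j k' l hj hk' hl (u, 0); subst k'.
by rewrite coneE /= !linear0 !addr0.
Qed.

Lemma hom_zero_tgt_src I e : hom_zero (cone f) I (e - 1) ->
  hom_zero Y I e -> hom_zero X I e.
Proof.
move=> hI YI psi hpsi.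
have [|H hH] := @hom_zero_anti _ _ _ hI
  (fun i j => lcopair \0 (psi (i - 1) j) : {linear cone f i -> I j}).
  move=> i j k l hj hk hl [b a]; subst k; rewrite coneE /= !add0r linearN opprK /=.
  by apply: hpsi => //; lia.
have [|m hm] := YI (fun i j => H i j \o lpair idfun \0).
  move=> i j k l hj hk hl u; subst k => /=.
  have := hH i l (i - 1) j _ erefl _ (u, 0); rewrite coneE /= !linear0 !addr0.
  move=> /(_ _ _)/esym/eqP; rewrite subr_eq0 => h; apply/eqP/h; lia.
have [g gE] := fam_shift_src (fun i j => H i j \o lpair \0 idfun).
exists (fun i j => g i j \- (m i j \o f i)) => i j k l hj hk hl u.
have := hH (i + 1) j i l _ _ hl.
move: (i + 1) (addrK 1 i) => i2 ei2; move: (esym ei2) => {}ei2.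
subst i k => /(_ _ _ (0, u)); rewrite coneE /= !linear0 !add0r => -> //; last by lia.
rewrite !gE /= cmap_comm linearB /=.
have /= hm1 := hm (i2 - 1) j _ l _ erefl hl (f (i2 - 1) u).
have -> : H (i2 - 1) j (f (i2 - 1) u, - diff X (i2 - 1) (i2 - 1 - 1) u) =
   H (i2 - 1) j (f (i2 - 1) u, 0) - H (i2 - 1) j (0, diff X (i2 - 1) (i2 - 1 - 1) u).
  by rewrite -linearB; congr (H _ _ (_, _)); rewrite ?subr0 ?sub0r.
by rewrite hm1 //; zmod.
Qed.

End Transfer.

Lemma K_projective_qiso P X Y (f : chain_map X Y) e : K_projective P -> quasi_iso f ->
  hom_zero P X e <-> hom_zero P Y e.
Proof.
move=> hP /cone_acyclic hf; split.
  by apply: hom_zero_tgt; apply: K_projective_hom hP hf.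
by apply: hom_zero_src_tgt; apply: K_projective_hom hP hf.
Qed.

Lemma K_injective_qiso I X Y (f : chain_map X Y) e : K_injective I -> quasi_iso f ->
  hom_zero X I e <-> hom_zero Y I e.
Proof.
move=> hI /cone_acyclic hf; split.
  by apply: hom_zero_src; apply: K_injective_hom hI hf.
by apply: hom_zero_tgt_src; apply: K_injective_hom hI hf.
Qed.

Section Comp.
Variables (X Y Z : complex S) (g : chain_map Y Z) (f : chain_map X Y).

Lemma comp_map_comm i j u :
  (g j \o f j) (diff X i j u) = diff Z i j ((g i \o f i) u).
Proof. by rewrite /= !cmap_comm. Qed.
Definition comp_map : chain_map X Z := ChainMap comp_map_comm.

Lemma comp_qiso : quasi_iso f -> quasi_iso g -> quasi_iso comp_map.
Proof.
move=> /quasi_isoP hf /quasi_isoP hg; apply/quasi_isoP => l k m hl hm.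
have [f1 f2] := hf l k m hl hm; have [g1 g2] := hg l k m hl hm; split.
  move=> u u0 hu; apply: f1 => //.
  by have [|w <-] := g1 (f k u) _ hu; [rewrite -cmap_comm u0 linear0|exists w].
move=> v /g2[u [u0 [w hw]]]; have [t [t0 [z hz]]] := f2 u u0.
exists t; split=> //; exists (w + g l z); rewrite linearD -hw -cmap_comm -hz /= linearB.
by zmod.
Qed.

Lemma qiso_comp_r : quasi_iso g -> quasi_iso comp_map -> quasi_iso f.
Proof.
move=> /quasi_isoP hg /quasi_isoP hc; apply/quasi_isoP => l k m hl hm.
have [c1 c2] := hc l k m hl hm; have [g1 g2] := hg l k m hl hm; split.
  move=> u u0 [w hw]; apply: c1 => //; exists (g l w).
  by rewrite -cmap_comm -hw.
move=> v v0; have [|u [u0 [w hw]]] := c2 (g k v); first by rewrite -cmap_comm v0 linear0.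
exists u; split=> //; have [||z hz] := g1 (f k u - v).
- by rewrite linearB -cmap_comm u0 linear0 v0 subrr.
- by exists w; rewrite linearB.
by exists z.
Qed.

End Comp.

End Complexes.

(** * Bounded complexes and injective resolutions *)

Lemma dependent_choice_nat (T : nat -> Type) (G : forall n, T n -> Prop)
    (Q : forall n, T n -> T n.+1 -> Prop) :
  (exists t, G 0%N t) -> (forall n t, G n t -> exists2 t', G n.+1 t' & Q n t t') ->
  exists t : forall n, T n, forall n, G n (t n) /\ Q n (t n) (t n.+1).
Proof.
move=> /cid[t0 Gt0] step.
pose next n (t : {t : T n | G n t}) : {t' : T n.+1 | G n.+1 t' /\ Q n (sval t) t'} :=
  let: exist2 t' h1 h2 := cid2 (step n _ (svalP t)) in exist _ t' (conj h1 h2).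
pose r := fix r n : {t : T n | G n t} :=
  if n is n'.+1 then let t' := next n' (r n') in exist _ (sval t') (svalP t').1
  else exist _ t0 Gt0.
exists (fun n => sval (r n)) => n; split; first exact: svalP.
exact: (svalP (next n (r n))).2.
Qed.

Section Resolutions.
Variable S : comPzRingType.
Implicit Types (M N : lmodType S) (X Y A P I : complex S).

Lemma projective_lift (P : lmodType S) M N (d : {linear M -> N}) (f : {linear P -> N}) :
  projective_module P -> (forall u, exists v, d v = f u) ->
  exists g : {linear P -> M}, forall u, d (g u) = f u.
Proof.
move=> hP hf.
have [d' d'E] : exists d' : {linear M -> smod (range_subm d)}, forall v, sinc _ (d' v) = d v.
  by apply: smod_lift => v; exists v.
have [f' f'E] : exists f' : {linear P -> smod (range_subm d)}, forall u, sinc _ (f' u) = f u.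
  by apply: smod_lift => u; have [v <-] := hf u; exists v.
have [|g hg] := hP _ _ d' f'.
  by move=> b; have [v _ hv] := sincP b; exists v; apply: sinc_inj; rewrite d'E hv.
by exists g => u; rewrite -d'E hg f'E.
Qed.

Lemma injective_extend (E : lmodType S) M N (d : {linear M -> N}) (f : {linear M -> E}) :
  injective_module E -> (forall u, d u = 0 -> f u = 0) ->
  exists g : {linear N -> E}, forall u, g (d u) = f u.
Proof.
move=> hE hf; pose q := qproj (ker_subm d).
have [d' d'E] : exists d' : {linear _ -> N}, forall u, d' (q u) = d u.
  by apply: lin_factor => [v|u]; [apply: qproj_surj|rewrite qproj_eq0].
have [f' f'E] : exists f' : {linear _ -> E}, forall u, f' (q u) = f u.
  by apply: lin_factor => [v|u]; [apply: qproj_surj|rewrite qproj_eq0 => /hf].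
have [|g hg] := hE _ _ d' f'.
  apply: lin_inj => v; have [u <-] := qproj_surj v; rewrite d'E => u0.
  exact/qproj_eq0.
by exists g => u; rewrite -d'E hg f'E.
Qed.

(** The homotopy is built upwards, degree by degree, by lifting along the differential of [A]. *)
Lemma bounded_projective P A (a e : int) :
  (forall i, projective_module (P i)) -> (forall i (u : P i), i < a -> u = 0) ->
  (forall i, a <= i -> homology_zero A (i + e)) -> hom_zero P A e.
Proof.
move=> hP Pa hA phi hphi.
(* Stage [n] supplies the homotopy in degree [s n]. It starts one degree below [a], where [P]
   vanishes and zero will do. The invariant, that [h] bounds [phi] on boundaries, makes [phi - h d]
   take values in cycles one degree higher. *)
pose s (n : nat) : int := a - 1 + n%:Z.
pose fam := forall i j, {linear P i -> A j}.
have [||h hh] := @dependent_choice_nat (fun=> fam)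
  (fun n h => forall i j l k (u : P k), i = s n -> j = i + e -> l = j + 1 -> k = i + 1 ->
     phi i j (diff P k i u) = diff A l j (h i l (diff P k i u)))
  (fun n h h' => forall i j l k (u : P i), i = s n.+1 -> j = i + e -> l = j + 1 -> k = i - 1 ->
     phi i j u = diff A l j (h' i l u) + h k j (diff P i k u)).
- exists (fun _ _ => \0) => i j l k u hi _ _ _.
  by rewrite (Pa i (diff P k i u)) ?linear0 //; rewrite hi /s; lia.
- move=> n h Gh.
  pose i := s n.+1; pose j := i + e; pose l := j + 1; pose k := i - 1.
  have [g hg] : exists g : {linear P i -> A l},
      forall u, diff A l j (g u) = (phi i j \- (h k j \o diff P i k)) u.
    apply: projective_lift => // u /=.
    apply: ((homology_zeroP _ (erefl (j + 1)) (erefl (j - 1))).1 (hA i _)).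
      by rewrite /i /s; lia.
    rewrite linearB (hphi i j k) // (Gh k _ j) ?subrr // /k /j /i /s; lia.
  have hP' : forall u, phi i j u = diff A l j (g u) + h k j (diff P i k u).
    by move=> u; rewrite hg /= subrK.
  exists (fun i' l' => castm A l l' \o g \o castm P i' i).
    move=> i' j' l' k' u ei ej el ek; subst i' j' l'; rewrite /= !castm_id.
    by rewrite [LHS]hP' diff_sq linear0 addr0.
  by move=> i' j' l' k' u ei ej el ek; subst i' j' l' k'; rewrite /= !castm_id.
exists (fun (i l : int) => if a - 1 <= i then h (absz (i - (a - 1))%R) i l else \0) => i j k l hj hk hl u.
case: (leP a i) => ai; last first.
  by rewrite (Pa i u ai) !linear0 addr0.
rewrite !ifT; [|lia|lia].
have [_ hQ] := hh (absz (k - (a - 1))%R).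
have := hQ i j l k u _ hj hl hk.
have -> : (absz (k - (a - 1))%R).+1 = (absz (i - (a - 1))%R) by lia.
by apply; rewrite /s; lia.
Qed.

Lemma bounded_injective I A (b e : int) :
  (forall i, injective_module (I i)) -> (forall i (u : I i), b < i -> u = 0) ->
  acyclic A -> hom_zero A I e.
Proof.
move=> hI Ib hA phi hphi.
(* Dually, the recursion descends from the degree that [phi] maps to degree [b + 1], where [I] is
   zero; the invariant says that [h] bounds [phi] on cycles. *)
pose s (n : nat) : int := b + 1 - e - n%:Z.
pose fam := forall i j, {linear A i -> I j}.
have [||h hh] := @dependent_choice_nat (fun=> fam)
  (fun n h => forall i j l k (u : A i), i = s n -> j = i + e -> l = j + 1 -> k = i - 1 ->
     diff A i k u = 0 -> phi i j u = diff I l j (h i l u))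
  (fun n h h' => forall i j l k (u : A i), i = s n -> j = i + e -> l = j + 1 -> k = i - 1 ->
     phi i j u = diff I l j (h i l u) + h' k j (diff A i k u)).
- exists (fun _ _ => \0) => i j l k u hi hj _ _ _.
  by rewrite (Ib j (phi i j u)) ?linear0 //; rewrite hj hi /s; lia.
- move=> n h Gh.
  pose i := s n; pose j := i + e; pose l := j + 1; pose k := i - 1.
  have [g hg] : exists g : {linear A k -> I j},
      forall u, g (diff A i k u) = (phi i j \- (diff I l j \o h i l)) u.
    apply: injective_extend => // u u0 /=.
    by rewrite (Gh i j l k u) ?subrr.
  have hP' : forall u, phi i j u = diff I l j (h i l u) + g (diff A i k u).
    by move=> u; rewrite hg /=; zmod.
  have ek0 : k = s n.+1 by rewrite /k /i /s; lia.
  exists (fun k' j' => castm I j j' \o g \o castm A k' k).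
    move=> k' i' j' m u ek ei ej em u0.
    have {}ek : k' = k by rewrite ek ek0.
    have {}ei : i' = j - 1 by rewrite ei ek /k /j; lia.
    have {}ej : j' = j by rewrite ej ei subrK.
    subst k' i' j' m; rewrite /= !castm_id.
    have [v <-] : exists v, diff A i k v = u.
      by apply: ((homology_zeroP _ (esym (subrK 1 i)) (erefl (k - 1))).1 (hA k)).
    rewrite -(hphi i j k (j - 1)) // hP' linearD diff_sq.
    by rewrite add0r.
  by move=> i' j' l' k' u ei ej el ek; subst i' j' l' k'; rewrite /= !castm_id.
exists (fun (i l : int) => if i <= b + 1 - e then h (absz (b + 1 - e - i)%R) i l else \0) => i j k l hj hk hl u.
case: (leP i (b + 1 - e)) => ai; last first.
  by rewrite (Ib j (phi i j u)) ?linear0 ?add0r ?[X in _ = X]Ib //; lia.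
rewrite !ifT; [|lia].
have [_ hQ] := hh (absz (b + 1 - e - i)%R).
have := hQ i j l k u _ hj hl hk.
have -> : (absz (b + 1 - e - i)%R).+1 = (absz (b + 1 - e - k)%R) by lia.
by apply; rewrite /s; lia.
Qed.

(** Some injective module containing [M]; minimality is not claimed. *)
Definition ihull M : lmodType S := projT1 (cid (enough_injectives M)).
Definition ihull_map M : {linear M -> ihull M} := sval (cid (projT2 (cid (enough_injectives M)))).
Lemma ihull_injective M : injective_module (ihull M).
Proof. exact: (svalP (cid (projT2 (cid (enough_injectives M))))).1. Qed.
Lemma ihull_map_inj M : injective (ihull_map M).
Proof. exact: (svalP (cid (projT2 (cid (enough_injectives M))))).2. Qed.

Definition zerom : lmodType S := GRing.Lmodule.clone S 'rV[S]_0 _.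
Lemma zerom_eq0 (u : zerom) : u = 0. Proof. exact: thinmx0. Qed.

Lemma zerom_injective : injective_module zerom.
Proof. by move=> M N u f _; exists \0 => a; rewrite [RHS]zerom_eq0. Qed.

Definition ext0m (F : nat -> lmodType S) (z : int) : lmodType S :=
  if z is Posz n then F n else zerom.

(** * An injective resolution of a complex without homology in degrees at least c *)

Section InjectiveResolution.
Variables (X : complex S) (c : int).

Definition coh_mod (n : nat) : lmodType S := X (c - n%:Z).
Definition coh_d (n : nat) : {linear coh_mod n -> coh_mod n.+1} := diff X (c - n%:Z) (c - n.+1%:Z).

(* [st_subm] is the image of the previous differential. *)
Record stage (n : nat) := Stage {
  st_mod : lmodType S;
  st_map : {linear coh_mod n -> st_mod};
  st_subm : subm st_mod }.

Section Step.
Variables (n : nat) (s : stage n).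

(** The quotient by this submodule is the pushout, along the term of index [n] of [X], of the next
    term of [X] and of [st_mod s] modulo the image of the previous differential. Embedding the
    pushout into an injective module gives the next term, the differential and the chain map
    together. *)
Definition step_subm : subm (prodm (st_mod s) (coh_mod n.+1)).
Proof.
exists (fun p => exists b x, st_subm s b /\ p = (b + st_map s x, - coh_d n x)).
- exists 0, 0; split; first exact: subm0.
  by rewrite !linear0 addr0.
- move=> _ _ [b [x [hb ->]]] [b' [x' [hb' ->]]].
  exists (b + b'), (x + x'); split; first exact: submD.
  by rewrite !linearD; apply: (congr2 pair) => /=; zmod.
- move=> a _ [b [x [hb ->]]].
  exists (a *: b), (a *: x); split; first exact: submZ.
  by rewrite !linearZ_LR -scalerDr; apply: (congr2 pair) => /=; rewrite ?scalerN.
Defined.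

Definition step_mod := ihull (qmod step_subm).
Definition step_in : {linear prodm (st_mod s) (coh_mod n.+1) -> step_mod} :=
  ihull_map _ \o qproj step_subm.
Definition step_d : {linear st_mod s -> step_mod} := step_in \o lpair idfun \0.
Definition step_f : {linear coh_mod n.+1 -> step_mod} := step_in \o lpair \0 idfun.
Arguments step_d : simpl never.
Arguments step_f : simpl never.
Definition next_stage : stage n.+1 := Stage step_f (range_subm step_d).

Lemma step_in_eq0 p : step_in p = 0 <-> step_subm p.
Proof.
split=> [h|h].
  by apply/qproj_eq0; apply: (@ihull_map_inj (qmod step_subm)); rewrite linear0.
by rewrite -(linear0 (ihull_map _)); congr (ihull_map _ _); apply/qproj_eq0.
Qed.

Lemma step_dBf v y : step_d v - step_f y = step_in (v, - y).
Proof.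
rewrite -[LHS]/(step_in (v, 0) - step_in (0, y)) -linearB; congr (step_in _).
by apply: (congr2 pair) => /=; rewrite ?subr0 ?sub0r.
Qed.

Lemma step_d_f x : step_d (st_map s x) = step_f (coh_d n x).
Proof.
apply/eqP; rewrite -subr_eq0 step_dBf; apply/eqP/step_in_eq0.
by exists 0, x; split; [exact: subm0|rewrite add0r].
Qed.

(** This description of the kernel of the differential gives surjectivity on homology;
    [step_f_range] gives injectivity. *)
Lemma step_d_eq0 v : step_d v = 0 <-> exists b x, [/\ st_subm s b, coh_d n x = 0 & v = b + st_map s x].
Proof.
split=> [/step_in_eq0[b [x [hb [-> /eqP]]]]|[b [x [hb x0 ->]]]].
  by rewrite eq_sym oppr_eq0 => /eqP x0; exists b, x.
by apply/step_in_eq0; exists b, x; split=> //=; rewrite x0 oppr0.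
Qed.

Lemma step_f_range x v : step_f x = step_d v -> exists y, x = coh_d n y.
Proof.
move=> /esym/eqP; rewrite -subr_eq0 step_dBf => /eqP/step_in_eq0[b [y [_ [_ /=]]]].
by move=> /oppr_inj ->; exists y.
Qed.

End Step.

(** Index 0 sits in degree [c], where [ires_qiso] assumes that [X] has no homology, so the zero
    module can start the resolution. *)
Fixpoint stages (n : nat) : stage n :=
  if n is n'.+1 then next_stage (stages n') else Stage \0 (ker_subm (idfun : {linear zerom -> zerom})).

Definition stage_mod (n : nat) : lmodType S := st_mod (stages n).
Definition stage_d (n : nat) : {linear stage_mod n -> stage_mod n.+1} := step_d (stages n).

Arguments stage_d : simpl never.

Lemma stage_d_sq n u : stage_d n.+1 (stage_d n u) = 0.
Proof.
apply/step_d_eq0; exists (stage_d n u), 0; rewrite !linear0 addr0; split=> //.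
by exists u.
Qed.

Definition ires_mod (z : int) := ext0m stage_mod z.
Definition ires_d (z w : int) : {linear ires_mod z -> ires_mod w} :=
  match z, w with
  | Posz n, Posz n' => castm stage_mod n.+1 n' \o stage_d n
  | _, _ => \0
  end.
Definition ires_f (i z : int) : {linear X i -> ires_mod z} :=
  if z is Posz n then st_map (stages n) \o castm X i (c - n%:Z) else \0.

Lemma ires_shape i j : j != i - 1 -> forall u, ires_d (c - i) (c - j) u = 0.
Proof.
(* The degrees [c - i] and [c - j] have to become variables before a case analysis on their
   signs. *)
move=> ji; suff h z w : z = c - i -> w = c - j -> forall u, ires_d z w u = 0.
  exact: h.
case: z w => [n|n] [n'|n'] //= ez ew u; apply: castm_neq => e.
by move/eqP: ji; apply; lia.
Qed.

Lemma ires_sq i j k u : ires_d (c - j) (c - k) (ires_d (c - i) (c - j) u) = 0.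
Proof.
move: (c - i) (c - j) (c - k) u => [n|n] [n'|n'] [n''|n''] u; try exact: linear0.
all: try by [].
rewrite -[LHS]/(castm stage_mod n'.+1 n'' (stage_d n' (castm stage_mod n.+1 n' (stage_d n u)))).
have [e|/eqP e] := eqVneq n' n.+1.
  by subst n'; rewrite castm_id stage_d_sq linear0.
by rewrite [castm _ n.+1 n' _]castm_neq ?linear0 // => /esym.
Qed.

Definition ires : complex S :=
  @Complex S (fun i => ires_mod (c - i)) _ ires_shape ires_sq.

Lemma ires_bounded i (u : ires i) : c < i -> u = 0.
Proof.
move=> ci; rewrite /ires /= in u *.
have : c - i < 0 by lia.
by case: (c - i) u => // n u _; apply: zerom_eq0.
Qed.

Lemma ires_injective i : injective_module (ires i).
Proof.
rewrite /ires /=; case: (c - i) => [[|n]|n] /=; try exact: zerom_injective.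
exact: ihull_injective.
Qed.

Lemma ires_comm i j u : j = i - 1 ->
  ires_f j (c - j) (diff X i j u) = ires_d (c - i) (c - j) (ires_f i (c - i) u).
Proof.
move=> ej; suff h z w : z = c - i -> w = c - j ->
    ires_f j w (diff X i j u) = ires_d z w (ires_f i z u) by apply: h.
case: z w => [n|n] [n'|n'] ez ew.
- have [en ei ek] : [/\ n' = n.+1, i = c - n%:Z & j = c - n.+1%:Z] by split; lia.
  clear ez ew ej; subst n' i j.
  rewrite -[LHS]/(st_map (stages n.+1) (castm X _ _ _)).
  rewrite -[RHS]/(castm stage_mod _ _ (stage_d n (st_map (stages n) (castm X _ _ _)))).
  by rewrite !castm_id; exact/esym/step_d_f.
- by lia.
- have en : n' = 0%N by lia.
  by subst n'.
- by [].
Qed.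

Definition ires_map : chain_map X ires := mk_chain_map (Y := ires) ires_comm.

Lemma ires_qiso : (forall i, c <= i -> homology_zero X i) -> quasi_iso ires_map.
Proof.
move=> X0; apply/quasi_isoP => l k m hl hm /=.
have X0' : c <= k -> forall u : X k, diff X k m u = 0 -> exists v : X l, diff X l k v = u.
  by move=> /X0; rewrite (homology_zeroP _ hl hm).
suff h zl zk zm : zl = c - l -> zk = c - k -> zm = c - m ->
  (forall u : X k, diff X k m u = 0 -> (exists w, ires_f k zk u = ires_d zl zk w) ->
       exists v : X l, diff X l k v = u)
    /\ (forall v, ires_d zk zm v = 0 ->
       exists u : X k, diff X k m u = 0 /\ exists w, ires_f k zk u - v = ires_d zl zk w).
  exact: h.
case: zk zm => [n|n] [n'|n'] el ek em; first last; try lia.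
- by split=> [u u0 _|v _]; [apply: X0' => //; lia|exists 0; rewrite linear0; split=> //;
    exists 0; rewrite linear0; apply: zerom_eq0].
- by split=> [u u0 _|v _]; [apply: X0' => //; lia|exists 0; rewrite linear0; split=> //;
    exists 0; rewrite linear0; apply: zerom_eq0].
have [en ck cm] : [/\ n' = n.+1, k = c - n%:Z & m = c - n.+1%:Z] by split; lia.
clear em; subst n'; case: n => [|n] in ek ck cm *.
  split=> [u u0 _|v _]; first by apply: X0' => //; lia.
  exists 0; rewrite linear0; split=> //; exists 0; rewrite linear0; apply: zerom_eq0.
have cl : l = c - n%:Z by lia.
have {el}ezl : zl = Posz n by lia.
clear hl hm ek; subst zl k m l; split=> [u u0|v].
  move=> [w]; rewrite -[LHS]/(st_map (stages n.+1) (castm X _ _ _)).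
  rewrite -[RHS]/(castm stage_mod _ _ (stage_d n w)) !castm_id => /step_f_range[y ->].
  by exists y.
rewrite -[LHS]/(castm stage_mod _ _ (stage_d n.+1 v)) castm_id => /step_d_eq0[_ [x [[w _ <-] x0 ->]]].
exists x; split=> //; exists (- w).
rewrite -[X in X - _]/(st_map (stages n.+1) (castm X _ _ _)).
rewrite -[RHS]/(castm stage_mod _ _ (stage_d n (- w))) !castm_id linearN.
by rewrite -/(stage_d n); zmod.
Qed.

End InjectiveResolution.

Lemma injective_resolution_exists X : bounded_homology X ->
  exists I, injective_resolution X I.
Proof.
move=> [a [b X0]]; exists (ires X (b + 1)); split.
- apply: K_injective_hom_zero => A A0; apply: bounded_injective A0.
    exact: ires_injective.
  exact: ires_bounded.
- exact: ires_injective.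
- exists (ires_map X (b + 1)); apply: ires_qiso => i hi; apply: X0; lia.
Qed.

Definition stalk_mod M (i : int) : lmodType S := if i == 0 then M else zerom.
Definition stalk M : complex S :=
  @Complex S (stalk_mod M) (fun i j => \0) (fun _ _ _ _ => erefl) (fun _ _ _ _ => erefl).

Lemma stalk_eq0 M (i : int) (u : stalk M i) : i != 0 -> u = 0.
Proof.
by rewrite /= /stalk_mod in u *; move: u; case: (i == 0) => // u _; apply: zerom_eq0.
Qed.

Lemma stalk_hom_zero M I j :
  hom_zero (stalk M) I j <-> ~ hom_homology_nonzero M I j.
Proof.
split=> [MI [f f0 []]|MI phi hphi].
  pose phi i l : {linear stalk M i -> I l} :=
    castm I j l \o f \o castm (stalk_mod M) i 0.
  have [|h hh] := MI phi.
    move=> i l k m hl hk hm u; rewrite linear0 /=.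
    have [i0|i0] := eqVneq i 0; last by rewrite (stalk_eq0 u i0) !linear0.
    have el : l = j by lia.
    have {hm}em : m = j - 1 by lia.
    by clear hk hl; subst i l m; rewrite !castm_id; apply: f0.
  exists (h 0 (j + 1)) => a.
  have := hh 0 j (0 - 1) (j + 1) _ erefl erefl a; rewrite /= !castm_id linear0 addr0.
  by apply; lia.
have [g hg] : exists g : {linear M -> I (j + 1)},
    forall a, phi 0 j a = diff I (j + 1) j (g a).
  apply: contrapT => hg; apply: MI; exists (phi 0 j) => // a.
  by rewrite (hphi 0 j (0 - 1) (j - 1)) ?linear0 //; lia.
exists (fun i l => castm I (j + 1) l \o g \o castm (stalk_mod M) i 0).
move=> i l k m hl hk hm u; rewrite linear0 addr0.
have [i0|i0] := eqVneq i 0; last by rewrite (stalk_eq0 u i0) !linear0.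
have el : l = j by lia.
by clear hk hl; subst i l m; rewrite /= !castm_id.
Qed.

(** Balancing of Ext: Hom(G, X) and Hom(M, I) both have the homology of Hom(G, I). *)
Lemma ext_injective (G X I : complex S) M (eps : chain_map G (stalk M)) j :
  K_projective G -> quasi_iso eps -> injective_resolution X I ->
  hom_homology_nonzero M I j <-> ~ hom_zero G X j.
Proof.
move=> hG heps [hI _ [f hf]].
rewrite (K_projective_qiso j hG hf) (K_injective_qiso j hI heps) stalk_hom_zero.
by split=> [h /(_ h)//|/contrapT].
Qed.

End Resolutions.

(** * Depth *)

Lemma infimum_int (A : set int) (b : int) : (forall i, A i -> b <= i) ->
  (A = set0 /\ infimum +oo%E [set i%:E%E | i in A] = +oo%E) \/
  exists a, [/\ A a, forall i, A i -> a <= i & infimum +oo%E [set i%:E%E | i in A] = a%:E%E].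
Proof.
move=> Ab; have [A0|/set0P[i0 Ai0]] := eqVneq A set0.
  by left; split=> //; rewrite A0 image_set0 /infimum eqxx.
have exn : exists n : nat, `[< A (b + n%:Z) >].
  by exists (absz (i0 - b)%R); apply/asboolP; rewrite gez0_abs ?subr_ge0 ?Ab // addrC subrK.
case: (ex_minnP exn) => n /asboolP An nmin.
have le i : A i -> b + n%:Z <= i.
  move=> Ai; have bi := Ab i Ai.
  have := nmin (absz (i - b)%R).
  rewrite gez0_abs ?subr_ge0 // [b + _]addrC subrK => /(_ (asboolT Ai)).
  lia.
right; exists (b + n%:Z); split=> //.
have hinf : infimums [set i%:E%E | i in A] (b + n%:Z)%:E%E.
  split=> [_ [i Ai <-]|y hy]; first by rewrite lee_fin le.
  by apply: hy; exists (b + n%:Z).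
rewrite /infimum ifF; last first.
  apply/negbTE/set0P; exists (b + n%:Z)%:E%E; exists (b + n%:Z) => //.
apply: (@is_subset1_infimums _ _ [set i%:E%E | i in A]) => //.
by apply: xgetPex; exists (b + n%:Z)%:E%E.
Qed.

Lemma infimum_int_le (A B : set int) (a b c : int) :
  (forall i, A i -> a <= i) -> (forall i, B i -> b <= i) ->
  (forall i, B i -> exists2 i', A i' & i' <= i + c) ->
  (infimum +oo%E [set i%:E%E | i in A] <= infimum +oo%E [set i%:E%E | i in B] + c%:E)%E.
Proof.
move=> hA hB AB; have [[_ ->]|[j [Bj _ ->]]] := infimum_int hB.
  by rewrite addye ?leey.
have [i Ai ij] := AB j Bj.
have [[A0 _]|[m [_ Am ->]]] := infimum_int hA; first by move: Ai; rewrite A0.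
by rewrite -EFinD lee_fin (le_trans (Am i Ai)).
Qed.

Section Depth.
Variables (S : comPzRingType) (n : set S) (G : complex S).
Variable eps : chain_map G (stalk (quo n : lmodType S)).
Hypotheses (Gproj : K_projective G) (Gmod : forall i, projective_module (G i)).
Hypotheses (G0 : forall i (u : G i), i < 0 -> u = 0) (heps : quasi_iso eps).
Implicit Types X : complex S.

Definition depth_set X : set int := [set i | ~ hom_zero G X (- i)].

Lemma depthE X : bounded_homology X ->
  depth n X = infimum +oo%E [set i%:E%E | i in depth_set X].
Proof.
move=> Xb; congr (infimum _ (_ @` _)); apply/seteqP; split=> i.
  by move=> [I XI] /=; rewrite (ext_injective _ Gproj heps XI).
move=> /= hi; have [I XI] := injective_resolution_exists Xb; exists I => //.
by rewrite (ext_injective _ Gproj heps XI).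
Qed.

(** As [G] vanishes in negative degrees, a family of degree [e] on [G] only meets the terms of [X]
    in degrees at least [e]. *)
Lemma hom_zero_large X (b e : int) : (forall i, b < i -> homology_zero X i) -> b < e ->
  hom_zero G X e.
Proof. by move=> hX be; apply: (bounded_projective (a := 0)) => // i i0; apply: hX; lia. Qed.

Lemma depth_set_ge X : bounded_homology X ->
  exists b, forall i, depth_set X i -> b <= i.
Proof.
move=> [a [b hX]]; exists (- b) => i hi; rewrite leNgt; apply/negP => ib.
apply: hi; apply: (@hom_zero_large X b); last by lia.
by move=> j bj; apply: hX; rewrite bj orbT.
Qed.

Lemma depth_qiso X Y (f : chain_map X Y) : quasi_iso f ->
  bounded_homology X -> bounded_homology Y -> depth n X = depth n Y.
Proof.
move=> hf Xb Yb; rewrite !depthE //; congr (infimum _ (_ @` _)).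
by apply/seteqP; split=> i; rewrite /depth_set /= (K_projective_qiso _ Gproj hf).
Qed.

End Depth.

Lemma qiso_homology (S : comPzRingType) (X Y : complex S) (f : chain_map X Y) :
  quasi_iso f -> forall i, homology_zero X i <-> homology_zero Y i.
Proof.
move=> /quasi_isoP hf i.
have [f1 f2] := hf (i + 1) i (i - 1) erefl erefl.
rewrite !(homology_zeroP _ (erefl (i + 1)) (erefl (i - 1))); split=> h u u0.
  have [v [/h[w <-] [z hz]]] := f2 u u0.
  by exists (f _ w - z); rewrite linearB -hz -cmap_comm; zmod.
apply: f1 => //; have [|w hw] := h (f i u); first by rewrite -cmap_comm u0 linear0.
by exists w.
Qed.

Lemma bounded_homology_qiso (S : comPzRingType) (X Y : complex S) (f : chain_map X Y) :
  quasi_iso f -> bounded_homology X <-> bounded_homology Y.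
Proof.
by move=> /qiso_homology h; split=> -[a [b hab]]; exists a, b => i /hab/h.
Qed.

(** * Change of rings along [R -> R/x] *)

Section ChangeOfRings.
Variables (R : comPzRingType) (x : R).
Local Notation Rx := (quo [set x]).
Local Notation pi := (@quo_pi R [set x]).
Implicit Types (M N : lmodType R) (U V : lmodType Rx).

Lemma quo_pi_eq0 r : pi r = 0 <-> exists s, r = s * x.
Proof.
rewrite -(rmorph0 pi) quo_pi_eq subr0; split=> [h|[s ->] I [[_ _ IM] xI]]; last exact/IM/xI.
apply: (h [set r | exists s, r = s * x]); split=> [|_ ->]; last by exists 1; rewrite mul1r.
split=> [|_ _ [s ->] [t ->]|t _ [s ->]]; first by exists 0; rewrite mul0r.
  by exists (s + t); rewrite mulrDl.
by exists (t * s); rewrite mulrA.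
Qed.

Definition rest U : Type := U.
HB.instance Definition _ U := GRing.Zmodule.on (rest U).
Section Rest.
Variable U : lmodType Rx.
Definition res_scale (r : R) (u : rest U) : rest U := pi r *: (u : U).
Lemma res_scaleA r s u : res_scale r (res_scale s u) = res_scale (r * s) u.
Proof. by rewrite /res_scale scalerA rmorphM. Qed.
Lemma res_scale1 : left_id 1 res_scale.
Proof. by move=> u; rewrite /res_scale rmorph1 scale1r. Qed.
Lemma res_scaleDr : right_distributive res_scale +%R.
Proof. by move=> r u v; rewrite /res_scale scalerDr. Qed.
Lemma res_scaleDl u : {morph res_scale^~ u : r s / r + s}.
Proof. by move=> r s; rewrite /res_scale rmorphD scalerDl. Qed.
HB.instance Definition _ := GRing.Zmodule_isLmodule.Build R (rest U)
  res_scaleA res_scale1 res_scaleDr res_scaleDl.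
Definition resm : lmodType R := GRing.Lmodule.clone R (rest U) _.
End Rest.

Lemma resm_scaleE U (r : R) (u : resm U) : r *: u = pi r *: (u : U).
Proof. by []. Qed.

Lemma resm_x U (u : resm U) : x *: u = 0.
Proof.
rewrite resm_scaleE; have -> : pi x = 0 by apply/quo_pi_eq0; exists 1; rewrite mul1r.
exact: (scale0r (u : U)).
Qed.

Lemma res_linear U V (f : {linear U -> V}) : linear (f : resm U -> resm V).
Proof. by move=> r u v; rewrite !resm_scaleE; apply: linearP. Qed.
Definition resl U V (f : {linear U -> V}) : {linear resm U -> resm V} :=
  lin_of (res_linear f).

Lemma unres_linear U V (f : {linear resm U -> resm V}) : linear (f : U -> V).
Proof. by move=> r u v; rewrite -(quo_reprK r); apply: (linearP f). Qed.
Definition unresl U V (f : {linear resm U -> resm V}) : {linear U -> V} :=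
  lin_of (unres_linear f).

Section Descent.
Variables (N : lmodType R) (hN : forall u : N, x *: u = 0).
(** The proof that [x] kills [N] is an argument of the type, so that the R/x-module structure
    depending on it can be attached to that type. *)
Definition dest of (forall u : N, x *: u = 0) : Type := N.
Local Notation D := (dest hN).
HB.instance Definition _ := GRing.Zmodule.on D.
Definition des_scale (q : Rx) (u : D) : D := quo_repr q *: (u : N).
Lemma des_scaleE r (u : D) : des_scale (pi r) u = r *: (u : N).
Proof.
apply/eqP; rewrite -subr_eq0 -scalerBl.
have /quo_pi_eq0[s ->] : pi (quo_repr (pi r) - r) = 0.
  by rewrite quo_piB quo_reprK subrr.
by rewrite -scalerA hN scaler0.
Qed.
Lemma des_scaleA r s u : des_scale r (des_scale s u) = des_scale (r * s) u.
Proof. by rewrite -[r]quo_reprK -[s]quo_reprK [_ * _]quo_mulE !des_scaleE scalerA. Qed.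
Lemma des_scale1 : left_id 1 des_scale.
Proof. by move=> u; rewrite -(rmorph1 pi) des_scaleE scale1r. Qed.
Lemma des_scaleDr : right_distributive des_scale +%R.
Proof. by move=> r u v; rewrite /des_scale scalerDr. Qed.
Lemma des_scaleDl u : {morph des_scale^~ u : r s / r + s}.
Proof.
by move=> r s; rewrite -[r]quo_reprK -[s]quo_reprK -quo_piD !des_scaleE scalerDl.
Qed.
HB.instance Definition _ := GRing.Zmodule_isLmodule.Build Rx D
  des_scaleA des_scale1 des_scaleDr des_scaleDl.
Definition desm : lmodType Rx := GRing.Lmodule.clone Rx D _.
Lemma des_linear : linear (id : N -> resm desm).
Proof. by move=> r u v; congr (_ + _); rewrite [RHS]des_scaleE. Qed.
Definition desl : {linear N -> resm desm} := lin_of des_linear.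
Lemma undes_linear : linear (id : resm desm -> N).
Proof. by move=> r u v; congr (_ + _); rewrite [LHS]des_scaleE. Qed.
Definition undesl : {linear resm desm -> N} := lin_of undes_linear.
End Descent.

(** This identifies [U] with M/xM, as the kernel of [q] contains xM automatically. Stating a
    property rather than fixing the quotient lets a twist count as the reduction of a lift. *)
Definition is_red M U (q : {linear M -> resm U}) : Prop :=
  (forall v, exists u, q u = v) /\ forall u, q u = 0 -> exists w, u = x *: w.

Lemma red_x M U (q : {linear M -> resm U}) u : q (x *: u) = 0.
Proof. by rewrite linearZ_LR resm_x. Qed.

Lemma red_factor M U (q : {linear M -> resm U}) V (f : {linear M -> resm V}) :
  is_red q -> exists g : {linear U -> V}, forall u, g (q u) = f u.
Proof.
move=> [qs qk]; have [|g hg] := lin_factor (f := f) qs.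
  by move=> u /qk[w ->]; rewrite linearZ_LR resm_x.
by exists (unresl g).
Qed.

Lemma red_ext M U (q : {linear M -> resm U}) V (f g : {linear U -> V}) :
  is_red q -> (forall u, f (q u) = g (q u)) -> f =1 g.
Proof. by move=> [qs _] h v; have [u <-] := qs v. Qed.

Definition xmul_linear M : linear (fun u : M => x *: u).
Proof. by move=> r u v; rewrite scalerDr !scalerA mulrC. Qed.
Definition xmul M : {linear M -> M} := lin_of (@xmul_linear M).

Section QuoMod.
Variable M : lmodType R.
Lemma quox_x (u : qmod (range_subm (xmul M))) : x *: u = 0.
Proof.
have [v <-] := qproj_surj u; rewrite -linearZ_LR; apply/qproj_eq0.
by exists v.
Qed.
Definition quom : lmodType Rx := desm quox_x.

Lemma quom_proj_subproof : exists q : {linear M -> resm quom}, is_red q.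
Proof.
exists (desl quox_x \o qproj _); split=> [v|u /qproj_eq0[w _ <-]]; last by exists w.
by have [u hu] := qproj_surj (v : qmod (range_subm (xmul M))); exists u.
Qed.
Definition quom_proj := sval (cid quom_proj_subproof).
Lemma quom_red : is_red quom_proj.
Proof. exact: (svalP (cid quom_proj_subproof)). Qed.
End QuoMod.

Section TorsMod.
Variable M : lmodType R.
Lemma tors_x (u : smod (ker_subm (xmul M))) : x *: u = 0.
Proof. by apply: sinc_inj; rewrite linearZ_LR linear0; apply: (sincP u). Qed.
(** This is Hom_R(R/x, M), the right adjoint of restriction of scalars; [tors_lift] is the
    adjunction. *)
Definition torsm : lmodType Rx := desm tors_x.

Lemma tinc_subproof : exists f : {linear resm torsm -> M},
  [/\ injective f, forall u, x *: f u = 0 & forall u, x *: u = 0 -> exists v, f v = u].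
Proof.
exists (sinc _ \o undesl tors_x); split=> [u v /sinc_inj //|u|u].
  exact: (sincP (u : smod (ker_subm (xmul M)))).
by move=> /(@sinc_mem _ _ (ker_subm (xmul M)))[v <-]; exists v.
Qed.
Definition tinc : {linear resm torsm -> M} := sval (cid tinc_subproof).
Lemma tinc_inj : injective tinc.
Proof. by rewrite /tinc; case: cid => f []; move=> *; auto. Qed.
Lemma tinc_x u : x *: tinc u = 0.
Proof. by rewrite /tinc; case: cid => f []; move=> *; auto. Qed.
Lemma tors_mem u : x *: u = 0 -> exists v, tinc v = u.
Proof. by rewrite /tinc; case: cid => f []; move=> *; auto. Qed.
Lemma tors_lift V (f : {linear resm V -> M}) :
  exists g : {linear V -> torsm}, forall u, tinc (g u) = f u.
Proof.
have [u|g hg] := lin_corestrict (f := f) tinc_inj.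
  by apply: tors_mem; rewrite -linearZ_LR resm_x linear0.
by exists (unresl g) => u; apply: hg.
Qed.
End TorsMod.

Section ResComplex.
Variable X : complex Rx.
Definition resc : complex R :=
  @Complex R (fun i => resm (X i)) (fun i j => resl (diff X i j))
    (@diff_shape _ X) (@diff_sq _ X).
End ResComplex.

Lemma resc_map_comm X Y (f : chain_map X Y) i j (u : resc X i) :
  resl (f j) (diff (resc X) i j u) = diff (resc Y) i j (resl (f i) u).
Proof. exact: (cmap_comm f). Qed.
Definition resc_map X Y (f : chain_map X Y) : chain_map (resc X) (resc Y) :=
  @ChainMap R (resc X) (resc Y) (fun i => resl (f i)) (@resc_map_comm X Y f).

Lemma resc_qiso X Y (f : chain_map X Y) : quasi_iso f -> quasi_iso (resc_map f).
Proof. by []. Qed.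

Lemma resc_fg X : complex_fg X -> complex_fg (resc X).
Proof.
move=> h i; have [k [g hg]] := h i; exists k, g => u; have [c hc] := hg u.
exists (fun i => quo_repr (c i)); rewrite hc.
by apply: eq_bigr => j _; rewrite resm_scaleE quo_reprK.
Qed.

Definition is_redc (X : complex R) (X' : complex Rx) (q : forall i, {linear X i -> resm (X' i)}) :=
  (forall i, is_red (q i)) /\ forall i j u, q j (diff X i j u) = diff X' i j (q i u).

Section QuoComplex.
Variable X : complex R.
Definition quod i j : {linear quom (X i) -> quom (X j)} :=
  sval (cid (red_factor (quom_proj (X j) \o diff X i j) (quom_red (X i)))).
Lemma quodE i j u : quod i j (quom_proj _ u) = quom_proj _ (diff X i j u).
Proof. exact: (svalP (cid (red_factor (quom_proj (X j) \o diff X i j) (quom_red (X i))))). Qed.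
Lemma quod_shape i j : j != i - 1 -> forall u, quod i j u = 0.
Proof.
move=> ji u; have [v <-] := (quom_red (X i)).1 u.
by rewrite quodE diff_shape // linear0.
Qed.
Lemma quod_sq i j k u : quod j k (quod i j u) = 0.
Proof.
have [v <-] := (quom_red (X i)).1 u.
by rewrite !quodE diff_sq linear0.
Qed.
Definition quoc : complex Rx := @Complex Rx (fun i => quom (X i)) quod quod_shape quod_sq.
Lemma quoc_red : @is_redc X quoc (fun i => quom_proj (X i)).
Proof. by split=> [i|i j u]; [exact: quom_red|rewrite -quodE]. Qed.
End QuoComplex.

Lemma quoc_fg (X : complex R) : complex_fg X -> complex_fg (quoc X).
Proof.
move=> h i; have [k [g hg]] := h i; exists k, (fun j => quom_proj _ (g j)) => u.
have [v <-] := (quom_red (X i)).1 u; have [c ->] := hg v.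
exists (fun j => pi (c j)); rewrite linear_sum; apply: eq_bigr => j _.
by rewrite linearZ_LR.
Qed.

End ChangeOfRings.

(** * Reduction modulo [x] and the Rees lemma *)

Lemma subr_eqN (V : zmodType) (a b c : V) : a - b = - c -> a + c = b.
Proof. by move=> e; rewrite -[c]opprK -e; zmod. Qed.

Section ChainLinear.
Variable S : comPzRingType.
Section Diff.
Variables (X : complex S) (i j : int).
Lemma diffZ a u : diff X i j (a *: u) = a *: diff X i j u.
Proof. exact: linearZ_LR. Qed.
Lemma diffD u v : diff X i j (u + v) = diff X i j u + diff X i j v.
Proof. exact: linearD. Qed.
Lemma diffB u v : diff X i j (u - v) = diff X i j u - diff X i j v.
Proof. exact: linearB. Qed.
Lemma diffN u : diff X i j (- u) = - diff X i j u.
Proof. exact: linearN. Qed.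
Lemma diff0 : diff X i j 0 = 0.
Proof. exact: linear0. Qed.
End Diff.
Section Cmap.
Variables (X Y : complex S) (f : chain_map X Y) (i : int).
Lemma cmapZ a u : f i (a *: u) = a *: f i u.
Proof. exact: linearZ_LR. Qed.
Lemma cmapD u v : f i (u + v) = f i u + f i v.
Proof. exact: linearD. Qed.
Lemma cmapB u v : f i (u - v) = f i u - f i v.
Proof. exact: linearB. Qed.
Lemma cmapN u : f i (- u) = - f i u.
Proof. exact: linearN. Qed.
Lemma cmap0 : f i 0 = 0.
Proof. exact: linear0. Qed.
End Cmap.
Definition lZ := (diffZ, cmapZ).
Definition chainE := (diffZ, diffD, diffB, diffN, diff0, cmapZ, cmapD, cmapB, cmapN, cmap0).
End ChainLinear.

Section Reduction.
Variables (R : comPzRingType) (x : R).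
Hypothesis hx : GRing.lreg x.
Local Notation Rx := (quo [set x]).
Local Notation pi := (@quo_pi R [set x]).

Definition xfree (M : lmodType R) : Prop := forall u : M, x *: u = 0 -> u = 0.

(** Divisibility: the map from [R] sending 1 to [u] extends along multiplication by [x], which is
    injective on [R]. *)
Lemma xfree_injective (E : lmodType R) :
  injective_module E -> forall u : E, exists v, x *: v = u.
Proof.
move=> hE u; have ul : linear (fun r : R^o => r *: u).
  by move=> r s t; rewrite scalerDl scalerA.
have [|g hg] := hE _ _ (xmul x (R^o : lmodType R)) (lin_of ul); first by move=> a b /hx.
exists (g 1); rewrite -linearZ_LR.
by rewrite -[x *: _]/(xmul x (R^o : lmodType R) 1) hg /= scale1r.
Qed.

Lemma xfree_lift (M E : lmodType R) (f : {linear M -> E}) :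
  xfree M -> injective_module E -> exists g : {linear M -> E}, forall u, g (x *: u) = f u.
Proof. by move=> hM hE; apply: (hE _ _ (xmul x M) f); apply: lin_inj. Qed.

Section RedComplex.
Variables (X : complex R) (X' : complex Rx) (q : forall i, {linear X i -> resm (X' i)}).
Hypotheses (hq : is_redc q) (Xfree : forall i, xfree (X i)).

(** The cycle [w] represents the image of the class of [q u] under the connecting map of
    multiplication by [x] on [X]. *)
Lemma redc_cycle i j u : diff X' i j (q i u) = 0 ->
  exists2 w, diff X i j u = x *: w & forall k, diff X j k w = 0.
Proof.
move=> u0; have [|w hw] := (hq.1 j).2 (diff X i j u); first by rewrite hq.2.
exists w => // k; apply: Xfree; rewrite -linearZ_LR -hw.
exact: diff_sq.
Qed.

Lemma red_homology_zero k m : m = k - 1 ->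
  homology_zero X k -> homology_zero X m -> homology_zero X' k.
Proof.
move=> hm hk hm0; apply/(homology_zeroP _ (erefl (k + 1)) hm) => u'.
have [u <-] := (hq.1 k).1 u' => /redc_cycle[w hw w0].
have [|v hv] := (homology_zeroP X (esym (etrans (congr1 (+%R^~ 1) hm) (subrK 1 k))) (erefl (m - 1))).1 hm0 w.
  exact: w0.
have [|t ht] := (homology_zeroP X (erefl (k + 1)) hm).1 hk (u - x *: v).
  by rewrite linearB linearZ_LR hv hw subrr.
by exists (q _ t); rewrite -hq.2 ht linearB red_x subr0.
Qed.

Lemma red_bounded : bounded_homology X -> bounded_homology X'.
Proof.
move=> [a [b hX]]; exists a, (b + 1) => i hi.
apply: (red_homology_zero erefl); apply: hX; move: hi; lia.
Qed.

Lemma red_acyclic : acyclic X -> acyclic X'.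
Proof. by move=> hX i; apply: (red_homology_zero erefl). Qed.

End RedComplex.

(** The five lemma for the long exact sequences of multiplication by [x] on [A] and on [B], carried
    out as a chase. *)
Lemma red_qiso (A B : complex R) (C D : complex Rx)
    (p : forall i, {linear A i -> resm (C i)}) (q : forall i, {linear B i -> resm (D i)})
    (f : chain_map A B) (g : chain_map C D) :
  is_redc p -> is_redc q -> (forall i, xfree (A i)) -> (forall i, xfree (B i)) ->
  (forall i u, g i (p i u) = q i (f i u)) -> quasi_iso f -> quasi_iso g.
Proof.
move=> hp hq Af Bf hfg /quasi_isoP hf; apply/quasi_isoP => l k m hl hm.
have [f1 f2] := hf l k m hl hm.
have [|f3 f4] := hf k m (m - 1) _ erefl; first by rewrite hm subrK.
split=> [u'|v'].
  have [a <-] := (hp.1 k).1 u' => /(redc_cycle hp Af)[w hw w0].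
  move=> [y']; have [b <-] := (hq.1 l).1 y'; rewrite hfg -hq.2 => e.
  have [|b1 hb1] := (hq.1 k).2 (f k a - diff B l k b); first by rewrite linearB e subrr.
  have xfw : f m w = diff B k m b1.
    apply/eqP; rewrite -subr_eq0; apply/eqP/Bf.
    by rewrite scalerBr -!lZ -hw -hb1 linearB diff_sq subr0 cmap_comm subrr.
  have [|v hv] := f3 w (w0 _); first by exists b1.
  have [|c [c0 [e1 he1]]] := f2 (b1 - f k v).
    by rewrite linearB -cmap_comm hv xfw subrr.
  have [||t ht] := f1 (a - x *: v - x *: c).
  - by rewrite !linearB !lZ hv c0 hw scaler0 subr0 subrr.
  - exists (b - x *: e1); rewrite !linearB !lZ -he1.
    rewrite -(subrK (diff B l k b) (f k a)) hb1 !scalerBr; zmod.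
  by exists (p l t); rewrite -hp.2 ht !linearB !red_x !subr0.
have [b <-] := (hq.1 k).1 v' => /(redc_cycle hq Bf)[w hw w0].
have [w1 [w10 [e he]]] := f4 w (w0 _).
have [||a ha] := f3 (x *: w1); first by rewrite lZ w10 scaler0.
  exists (b + x *: e); rewrite lZ linearD lZ -he hw scalerBr; zmod.
have [|a2 [a20 [z hz]]] := f2 (f k a - (b + x *: e)).
  by rewrite linearB -cmap_comm ha lZ linearD lZ -he hw scalerBr; zmod.
exists (p k (a - a2)); split.
  by rewrite -hp.2 linearB a20 subr0 ha red_x.
exists (q l (- z)); rewrite hfg -hq.2 linearN -hz -linearB.
have -> : f k (a - a2) - b = - (f k a2 - (f k a - (b + x *: e))) + x *: e.
  by rewrite linearB; zmod.
by rewrite linearD red_x addr0.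
Qed.

Lemma torsm_injective (E : lmodType R) : injective_module E -> injective_module (torsm x E).
Proof.
move=> hE M N u f u_inj.
have [g hg] := hE _ _ (resl u) (tinc x E \o resl f) u_inj.
have [h hh] := tors_lift g; exists h => a.
by apply: tinc_inj; rewrite hh -[u a]/(resl u a) hg.
Qed.

(** * The torsion complex of an injective resolution *)

Section TorsComplex.
Variable I : complex R.

(** The torsion of [I] computes RHom_R(R/x, Z), which is Z/x with all degrees lowered by one. Hence
    [I (i - 1)] is placed in degree [i], with the sign of a shift on the differential. *)
Lemma torsd_subproof i j : exists d : {linear torsm x (I (i - 1)) -> torsm x (I (j - 1))},
  forall u, tinc x _ (d u) = - diff I (i - 1) (j - 1) (tinc x _ u).
Proof. exact: (tors_lift (\- (diff I (i - 1) (j - 1) \o tinc x _))). Qed.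
Definition torsd i j := sval (cid (torsd_subproof i j)).
Lemma torsdE i j u : tinc x _ (torsd i j u) = - diff I (i - 1) (j - 1) (tinc x _ u).
Proof. exact: (svalP (cid (torsd_subproof i j))). Qed.
Lemma torsd_shape i j : j != i - 1 -> forall u, torsd i j u = 0.
Proof.
move=> ji u; apply: tinc_inj; rewrite torsdE diff_shape ?oppr0 ?linear0 //.
by apply: contra ji => /eqP ?; apply/eqP; lia.
Qed.
Lemma torsd_sq i j k u : torsd j k (torsd i j u) = 0.
Proof. by apply: tinc_inj; rewrite !torsdE linearN diff_sq !linear0. Qed.
Definition torsc : complex Rx :=
  @Complex Rx (fun i => torsm x (I (i - 1))) torsd torsd_shape torsd_sq.

Lemma torscE i j (u : torsc i) :
  tinc x (I (j - 1)) (diff torsc i j u) = - diff I (i - 1) (j - 1) (tinc x (I (i - 1)) u).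
Proof. exact: torsdE. Qed.

(** By adjunction, families from [A] to the torsion complex are families of degree one less from
    [resc A] to [I], and [resc A] is still acyclic. *)
Lemma torsc_K_injective : K_injective I -> K_injective torsc.
Proof.
move=> hI; apply: K_injective_hom_zero => A A0 phi hphi.
have [psi psiE] := @fam_shift_tgt R I (fun i => resm (A i))
  (fun i l => tinc x (I (l - 1)) \o resl (phi i l)).
have [|h hh] := hom_zero_anti (@K_injective_hom _ I (resc A) (- 1) hI A0) (phi := psi).
  move=> i j k l hj hk hl u.
  have ej : j = i - 1 by lia.
  have el : l = k - 1 by lia.
  clear hj hl; subst j l; rewrite !psiE /= -(hphi i i k k) ?addr0 // torscE opprK.
  by subst k.
have /dchoice2[g hg] i j : exists g : {linear A i -> torsm x (I (j - 1))},
    forall u, tinc x _ (g u) = - h i (j - 1) u.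
  exact: (@tors_lift _ x (I (j - 1)) (A i) (\- h i (j - 1))).
exists g => i j k l hj hk hl u.
have {}hj : j = i by lia.
subst j l; apply: tinc_inj; rewrite linearD torscE !hg linearN opprK /=.
rewrite -[LHS]/((tinc x (I (i - 1)) \o resl (phi i i)) u) -psiE.
by rewrite (hh i (i - 1) k (i + 1 - 1)) //; lia.
Qed.

End TorsComplex.

Section Rees.
Variables (Z : complex R) (C : complex Rx) (q : forall i, {linear Z i -> resm (C i)}).
Hypotheses (hq : is_redc q) (Zfree : forall i, xfree (Z i)).
Variable I : complex R.
Hypothesis ZI : injective_resolution Z I.

(** As [Z] is torsion-free and [I] injective, [f = x g] for a family [g] that need not commute with
    the differentials. Its defect [d g - g d] is killed by [x]; it therefore lands in the torsion of
    [I] and factors through [C]. The factorization is the resolution map. *)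
Lemma rees_resolution : injective_resolution C (torsc I).
Proof.
have [hI Ii [f /quasi_isoP hf]] := ZI.
split; [exact: torsc_K_injective|by move=> i; apply: torsm_injective|].
have /dchoice[g hg] i : exists g : {linear Z i -> I i}, forall u, g (x *: u) = f i u.
  exact: xfree_lift.
have xg i u : x *: g i u = f i u by rewrite -linearZ_LR hg.
have /dchoice[d hd] i : exists d : {linear C i -> torsm x (I (i - 1))}, forall u,
    tinc x _ (d (q i u)) = diff I i (i - 1) (g i u) - g (i - 1) (diff Z i (i - 1) u).
  have [|d0 hd0] := lin_corestrict (@tinc_inj _ x (I (i - 1)))
    (f := (diff I i (i - 1) \o g i) \- (g (i - 1) \o diff Z i (i - 1))).
    move=> u; apply: tors_mem.
    by rewrite /= scalerBr -lZ !xg cmap_comm subrr.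
  have [d' hd'] := red_factor d0 (hq.1 i).
  by exists d' => u; rewrite hd' hd0.
have dc i j u : j = i - 1 -> d j (diff C i j u) = diff (torsc I) i j (d i u).
  move=> hj; subst j; have [z <-] := (hq.1 i).1 u; apply: tinc_inj.
  by rewrite -hq.2 hd [RHS]torscE hd linearB !diff_sq linear0; zmod.
exists (mk_chain_map (Y := torsc I) dc); apply/quasi_isoP => l k m hl hm.
have {hl}hk : k = l - 1 by lia.
subst k m; have [f1 f2] := hf l (l - 1) (l - 1 - 1) (esym (subrK _ _)) erefl.
have [f3 f4] := hf (l - 1) (l - 1 - 1) (l - 1 - 1 - 1) (esym (subrK _ _)) erefl.
split=> [u'|y].
  have [z <-] := (hq.1 _).1 u' => /(redc_cycle hq Zfree)[w hw w0] [y].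
  move=> /(congr1 (tinc x _)); rewrite hd [RHS]torscE hw hg => e0.
  have e1 : diff I (l - 1) (l - 1 - 1) (g _ z) +
      diff I (l - 1) (l - 1 - 1) (tinc x (I (l - 1)) y) = f _ w.
    exact: subr_eqN e0.
  have [|v hv] := f3 w (w0 _).
    by exists (g _ z + tinc x _ y); rewrite linearD.
  have [|c [c0 [e he]]] := f2 (g _ z + tinc x _ y - f _ v).
    by rewrite linearB linearD e1 -cmap_comm hv subrr.
  have [||t ht] := f1 (z - x *: v - x *: c).
  - by rewrite !linearB !lZ hv c0 hw scaler0 subr0 subrr.
  - exists (- (x *: e)); rewrite !chainE -he.
    by rewrite !(scalerBr, scalerDr) xg tinc_x; zmod.
  by exists (q _ t); rewrite -hq.2 ht !linearB !red_x !subr0.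
move=> /(congr1 (tinc x _)); rewrite [LHS]torscE linear0 => /eqP; rewrite oppr_eq0 => /eqP y0.
have [w [w0 [c hc]]] := f4 (tinc x _ y) y0.
(* Because [x] kills [y], the cycle [x w] becomes a boundary, of some [z]. Corrected by the cycle
   [w2], this [z] reduces modulo [x] to a cycle whose image is [- y] up to a boundary; injectivity
   of [I] is used to divide [e] by [x]. *)
have xc : diff I (l - 1) (l - 1 - 1) (x *: c) = f _ (x *: w).
  by rewrite lZ -hc scalerBr tinc_x subr0 lZ.
have [||z hz] := f3 (x *: w); first by rewrite lZ w0 scaler0.
  by exists (x *: c).
have [|w2 [w20 [e he]]] := f2 (f _ z - x *: c).
  by rewrite linearB -cmap_comm hz xc subrr.
have [e' ee'] := xfree_injective (Ii l) e.
have [|t ht] := @tors_mem _ x (I (l - 1)) (g _ (z - w2) - c + diff I l (l - 1) e').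
  rewrite scalerDr scalerBr xg -lZ ee' -he linearB; zmod.
exists (- q _ (z - w2)); split.
  by rewrite linearN -hq.2 linearB hz w20 subr0 red_x linear0.
exists t; apply: tinc_inj; rewrite [RHS]torscE ht.
rewrite [LHS]linearB /= linearN linearN hd !chainE diff_sq hz w20 subr0 hg -hc.
by zmod.
Qed.

Lemma hom_homologyP (S : comPzRingType) (M : lmodType S) (J : complex S) (j l m : int) :
  l = j + 1 -> m = j - 1 ->
  hom_homology_nonzero M J j <-> exists2 f : {linear M -> J j},
    forall a, diff J j m (f a) = 0 &
    ~ exists g : {linear M -> J l}, forall a, f a = diff J l j (g a).
Proof. by move=> -> ->. Qed.

(** The adjunction between restriction and torsion. The isomorphism [k] is a parameter because the
    residue fields of [R] and R/x are different types. *)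
Lemma rees_ext (M : lmodType R) (N : lmodType Rx)
    (k : {linear M -> resm N}) (k' : {linear resm N -> M}) l :
  cancel k k' -> cancel k' k ->
  hom_homology_nonzero N (torsc I) l <-> hom_homology_nonzero M I (l - 1).
Proof.
move=> kK kK'.
rewrite (hom_homologyP N (torsc I) (erefl (l + 1)) (erefl (l - 1))).
move: (l + 1) (addrK 1 l) => l2 el; move: (esym el) => {}el; subst l.
rewrite (hom_homologyP M I (esym (subrK 1 (l2 - 1))) (erefl (l2 - 1 - 1 - 1))).
split=> [[f f0 hf]|[f f0 hf]].
  exists (tinc x _ \o resl f \o k) => [a|[g hg]].
    have := @torscE I _ (l2 - 1 - 1) (f (k a)); rewrite f0 linear0 => /esym/eqP.
    by rewrite oppr_eq0 => /eqP.
  apply: hf; have [h hh] := tors_lift (\- (g \o k')).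
  exists h => a; apply: tinc_inj; rewrite [RHS]torscE hh /= linearN opprK -hg /= kK'.
  by [].
have [h hh] := tors_lift (f \o k').
exists h => [a|[g hg]]; first by apply: tinc_inj; rewrite [LHS]torscE hh /= f0 !linear0.
apply: hf; exists (\- (tinc x _ \o resl g \o k)) => a.
by rewrite /= linearN -torscE -hg hh /= kK.
Qed.

End Rees.

End Reduction.

(** * Covers *)

(* [D] is a lift of the differential of X along p : F -> X, so D^2 need not vanish; adding the
   shifted kernel of p corrects this: d (a, k) = (D a + k, - D^2 a - D k). *)
Section Cover.
Variables (S : comPzRingType) (X : complex S) (F : int -> lmodType S).
Variable p : forall i, {linear F i -> X i}.
Hypothesis p_surj : forall i v, exists u, p i u = v.
Variable D : forall i j, {linear F i -> F j}.
Hypothesis D_shape : forall i j, j != i - 1 -> forall u, D i j u = 0.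
Hypothesis pD : forall i j u, p j (D i j u) = diff X i j (p i u).

Definition cover_ker i : lmodType S := smod (ker_subm (p i)).

Lemma cover_inc_subproof i : exists f : {linear cover_ker i -> F i},
  [/\ injective f, forall u, p i (f u) = 0 & forall u, p i u = 0 -> exists k, f k = u].
Proof.
exists (sinc (ker_subm (p i))); split=> [|u|u]; [exact: sinc_inj|exact: (sincP u)|].
exact: (@sinc_mem _ _ (ker_subm (p i))).
Qed.
Definition cover_inc i : {linear cover_ker i -> F i} := sval (cid (cover_inc_subproof i)).
Lemma cover_inc_inj i : injective (cover_inc i).
Proof. by rewrite /cover_inc; case: cid => f []. Qed.
Lemma p_cover_inc i u : p i (cover_inc i u) = 0.
Proof. by rewrite /cover_inc; case: cid => f []. Qed.
Lemma cover_ker_mem i u : p i u = 0 -> exists k, cover_inc i k = u.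
Proof. by rewrite /cover_inc; case: cid => f /= [_ _]; apply. Qed.

Definition cover_mod i : lmodType S := prodm (F i) (cover_ker (i - 1)).

Definition cover_d1 i j : {linear cover_mod i -> F j} :=
  lcopair (D i j) (castm F (i - 1) j \o cover_inc (i - 1)).

Lemma cover_d2_subproof i j : exists d : {linear cover_mod i -> cover_ker (j - 1)},
  forall u, cover_inc (j - 1) (d u) =
    - D j (j - 1) (D i j u.1) - D (i - 1) (j - 1) (cover_inc (i - 1) u.2).
Proof.
have [|d hd] := lin_corestrict (@cover_inc_inj (j - 1)) (f := lcopair
    (\- (D j (j - 1) \o D i j)) (\- (D (i - 1) (j - 1) \o cover_inc (i - 1)))).
  by move=> u; apply: cover_ker_mem; rewrite linearD !linearN !pD diff_sq p_cover_inc diff0 !oppr0 addr0.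
by exists d => u; rewrite hd.
Qed.
Definition cover_d2 i j := sval (cid (cover_d2_subproof i j)).
Lemma cover_d2E i j u : cover_inc (j - 1) (cover_d2 i j u) =
    - D j (j - 1) (D i j u.1) - D (i - 1) (j - 1) (cover_inc (i - 1) u.2).
Proof. exact: (svalP (cid (cover_d2_subproof i j))). Qed.

Definition cover_d i j : {linear cover_mod i -> cover_mod j} :=
  lpair (cover_d1 i j) (cover_d2 i j).

Lemma cover_shape i j : j != i - 1 -> forall u, cover_d i j u = 0.
Proof.
move=> ji u; have ji' : j - 1 != i - 1 - 1.
  by apply: contra ji => /eqP ?; apply/eqP; lia.
apply/prodm_eq0; split.
  rewrite /= D_shape // castm_neq ?addr0 //.
  by move=> /eqP; rewrite eq_sym (negPf ji).
by apply: cover_inc_inj; rewrite cover_d2E (D_shape ji) (D_shape ji') !linear0 addr0.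
Qed.

Lemma cover_dE i a k : cover_d i (i - 1) (a, k) =
  (D i (i - 1) a + cover_inc (i - 1) k, cover_d2 i (i - 1) (a, k)).
Proof. by rewrite /= castm_id. Qed.

Lemma cover_sq i j k u : cover_d j k (cover_d i j u) = 0.
Proof.
have [hj|/cover_shape->] := eqVneq j (i - 1); last by rewrite linear0.
have [hk|/cover_shape-> //] := eqVneq k (j - 1).
subst k j; case: u => a b; rewrite !cover_dE; apply/prodm_eq0; split.
  by rewrite cover_d2E linearD /=; zmod.
apply: cover_inc_inj; rewrite !cover_d2E /= !(linearD, linearN) [RHS]linear0 /=; zmod.
Qed.

Definition cover_cx : complex S := @Complex S cover_mod cover_d cover_shape cover_sq.

Lemma cover_cxE i a k : diff cover_cx i (i - 1) (a, k) =
  (D i (i - 1) a + cover_inc (i - 1) k, cover_d2 i (i - 1) (a, k)).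
Proof. exact: cover_dE. Qed.

Lemma cover_map_comm i j u : j = i - 1 ->
  (p j \o lfst _ _) (diff cover_cx i j u) = diff X i j ((p i \o lfst _ _) u).
Proof.
move=> hj; subst j; case: u => a k; rewrite cover_cxE /= linearD pD p_cover_inc.
by rewrite addr0.
Qed.
Definition cover_map : chain_map cover_cx X := mk_chain_map cover_map_comm.

Lemma cover_mapE i u : cover_map i u = p i u.1. Proof. by []. Qed.

(** The map is surjective and its kernel is contractible, by the homotopy sending (a, k) to (0,
    a). *)
Lemma cover_qiso : quasi_iso cover_map.
Proof.
apply/quasi_isoP => l k m hl hm; have {hl}hk : k = l - 1 by lia.
subst k m; split=> [[a k]|v v0].
  rewrite cover_cxE => /prodm_eq0[e0 _] [w]; have [b <-] := p_surj w.
  rewrite cover_mapE /= -pD => e1.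
  have [|k' hk'] := @cover_ker_mem (l - 1) (a - D l (l - 1) b); first by rewrite linearB e1 subrr.
  exists (b, k'); rewrite [LHS]cover_cxE hk'; apply: (congr2 pair); first by zmod.
  apply: cover_inc_inj; rewrite cover_d2E /= hk' linearB.
  by rewrite -[LHS]addr0 -e0; zmod.
have [a hv] := p_surj v.
have [|k hk] := @cover_ker_mem (l - 1 - 1) (- D (l - 1) (l - 1 - 1) a).
  by rewrite linearN pD hv v0 oppr0.
exists (a, k); split; last by exists 0; rewrite cover_mapE /= hv subrr diff0.
rewrite [LHS]cover_cxE hk; apply/prodm_eq0; split; first by zmod.
by apply: cover_inc_inj; rewrite cover_d2E /= hk linearN linear0; zmod.
Qed.

(** Degreewise lifts [g] of [f] need not commute with [D], but the defect lies in the kernel of [p]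
    and becomes the second component. The resulting lift is strict, not merely up to homotopy. *)
Lemma cover_lift (P : complex S) (f : chain_map P X) :
  (forall i, projective_module (P i)) ->
  exists g : chain_map P cover_cx, forall i u, cover_map i (g i u) = f i u.
Proof.
move=> hP.
have /dchoice[g hg] i : exists g : {linear P i -> F i}, forall u, p i (g u) = f i u.
  by apply: hP => v; apply: p_surj.
have /dchoice[e he] i : exists e : {linear P i -> cover_ker (i - 1)}, forall u,
    cover_inc _ (e u) = g (i - 1) (diff P i (i - 1) u) - D i (i - 1) (g i u).
  have [|e he] := lin_corestrict (@cover_inc_inj (i - 1))
    (f := (g (i - 1) \o diff P i (i - 1)) \- (D i (i - 1) \o g i)).
    by move=> u; apply: cover_ker_mem; rewrite linearB pD !hg cmap_comm subrr.
  by exists e => u; rewrite he.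
have hc i j u : j = i - 1 -> lpair (g j) (e j) (diff P i j u) = diff cover_cx i j (lpair (g i) (e i) u).
  move=> hj; subst j; rewrite [RHS]cover_cxE; apply: (congr2 pair); first by rewrite he; zmod.
  by apply: cover_inc_inj; rewrite he cover_d2E /= he diff_sq linear0 linearB; zmod.
by exists (mk_chain_map (Y := cover_cx) hc) => i u; rewrite cover_mapE /= hg.
Qed.

End Cover.

Section FreeCover.
Variables (S : comPzRingType) (X : complex S).
Variables (F : int -> lmodType S) (p : forall i, {linear F i -> X i}).
Hypotheses (F_proj : forall i, projective_module (F i)) (p_surj : forall i v, exists u, p i u = v).

Lemma cover_diff_exists : exists D : forall i j, {linear F i -> F j},
  (forall i j, j != i - 1 -> forall u, D i j u = 0) /\
  (forall i j u, p j (D i j u) = diff X i j (p i u)).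
Proof.
have /dchoice2[D hD] i j : exists D : {linear F i -> F j},
    (j != i - 1 -> forall u, D u = 0) /\ (forall u, p j (D u) = diff X i j (p i u)).
  have [->|ji] := eqVneq j (i - 1).
    have [D hD] := F_proj (diff X i (i - 1) \o p i) (@p_surj (i - 1)).
    by exists D; split=> //; rewrite eqxx.
  by exists \0; split=> // u; rewrite linear0 diff_shape.
by exists D; split=> i j; [have [] := hD i j|have [] := hD i j].
Qed.

End FreeCover.

Lemma prodm_projective (S : comPzRingType) (M N : lmodType S) :
  projective_module M -> projective_module N -> projective_module (prodm M N).
Proof.
move=> hM hN A B u f hu.
have [g hg] := hM _ _ u (f \o lpair idfun \0) hu.
have [h hh] := hN _ _ u (f \o lpair \0 idfun) hu.
exists (lcopair g h) => -[a b]; rewrite /= linearD hg hh /= -linearD; congr (f _).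
by apply: (congr2 pair); rewrite ?addr0 ?add0r.
Qed.

Lemma regular_projective (S : comPzRingType) : projective_module (S^o : lmodType S).
Proof.
move=> M N u f hu; have [m hm] := hu (f 1).
have hl : linear (fun s : S^o => s *: m).
  by move=> r s t; rewrite scalerDl scalerA.
exists (lin_of hl) => s /=; rewrite linearZ_LR hm -linearZ_LR; congr (f _).
exact: mulr1.
Qed.

(** * Finitely generated modules over Noetherian rings *)

Section Noetherian.
Variable S : comPzRingType.

Definition fg_subm (M : lmodType S) (A : subm M) : Prop :=
  exists (k : nat) (g : 'I_k -> M), (forall i, A (g i)) /\
    forall u, A u -> exists c : 'I_k -> S, u = \sum_(i < k) c i *: g i.

Definition noeth_module (M : lmodType S) : Prop := forall A : subm M, fg_subm A.

Lemma fg_subm_smod (M : lmodType S) (A : subm M) : fg_subm A -> finitely_generated (smod A).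
Proof.
move=> [k [g [gA hg]]].
have /choice[h hh] i : exists h, sinc A h = g i := sinc_mem (gA i).
exists k, h => u; have [c hc] := hg _ (sincP u); exists c.
by apply: sinc_inj; rewrite hc linear_sum; apply: eq_bigr => i _; rewrite linearZ_LR hh.
Qed.

Lemma regular_noeth : noetherian S -> noeth_module (S^o : lmodType S).
Proof.
move=> hS A; have [|s hs] := hS (A : set S).
  by split; [exact: (subm0 A)|exact: (@submD _ _ A)|exact: (@submZ _ _ A)].
exists (size s), (fun i => nth 0 s i); split=> [i|u].
  have /= -> := congr1 (fun I : set S => I (nth 0 s i)) hs.
  by move=> I [_]; apply=> /=; apply: mem_nth.
have /= -> := congr1 (fun I : set S => I u) hs.
move=> hu; apply: (hu [set v : S | exists c : 'I_(size s) -> S,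
  v = \sum_(i < size s) c i *: (nth 0 s i : S^o)]).
split=> [|a /= /(nthP 0)[i hi <-]].
  split=> [|_ _ [c ->] [d ->]|r _ [c ->]].
  - by exists (fun=> 0); rewrite big1 // => i _; rewrite scale0r.
  - exists (fun i => c i + d i); rewrite -big_split; apply: eq_bigr => i _.
    by rewrite scalerDl.
  - exists (fun i => r * c i); rewrite mulr_sumr; apply: eq_bigr => i _.
    by rewrite -scalerA.
exists (fun j => (j == Ordinal hi)%:R); rewrite (bigD1 (Ordinal hi)) //= eqxx scale1r.
by rewrite big1 ?addr0 // => j /negPf ->; rewrite scale0r.
Qed.

Lemma prodm_sum (M N : lmodType S) (I : finType) (f : I -> M) (g : I -> N) :
  \sum_i ((f i, g i) : prodm M N) = (\sum_i f i, \sum_i g i).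
Proof.
rewrite [LHS]surjective_pairing; apply: (congr2 pair).
  exact: (linear_sum (lfst M N)).
exact: (linear_sum (lsnd M N)).
Qed.

(** [A1] is the intersection of [A] with [M] and [A2] its projection to [N]; generators of [A1]
    together with lifts of generators of [A2] generate [A]. *)
Lemma prodm_noeth (M N : lmodType S) :
  noeth_module M -> noeth_module N -> noeth_module (prodm M N).
Proof.
move=> hM hN A.
have [A1 hA1] : exists A1 : subm M, forall u, A1 u <-> A (u, 0).
  unshelve eexists; first exists (fun u => A (u, 0)); last by [].
  - exact: subm0.
  - by move=> u v hu hv; have := submD hu hv; congr (A (_, _)); rewrite addr0.
  - by move=> s u hu; have := submZ s hu; congr (A (_, _)); rewrite scaler0.
have [A2 hA2] : exists A2 : subm N, forall v, A2 v <-> exists u, A (u, v).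
  unshelve eexists; first exists (fun v => exists u, A (u, v)); last by [].
  - by exists 0; apply: subm0.
  - by move=> u v [a ha] [b hb]; exists (a + b); apply: (submD ha hb).
  - by move=> s u [a ha]; exists (s *: a); apply: (submZ s ha).
have [k1 [g1 [g1A hg1]]] := hM A1; have [k2 [g2 [g2A hg2]]] := hN A2.
have /choice[h hh] i : exists h, A (h, g2 i) by apply/hA2.
pose g (i : 'I_(k1 + k2)) : prodm M N :=
  match fintype.split i with inl j => (g1 j, 0) | inr j => (h j, g2 j) end.
exists (k1 + k2)%N, g; split=> [i|[u v] huv].
  by rewrite /g; case: (fintype.split i) => j; [apply/hA1|].
have [|c2 hc2] := hg2 v; first by apply/hA2; exists u.
have Asum (k : nat) (f : 'I_k -> prodm M N) (c : 'I_k -> S) :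
    (forall i, A (f i)) -> A (\sum_(i < k) c i *: f i).
  by move=> hf; elim/big_ind: _ => [|a b|i _]; [exact: subm0|exact: submD|exact: submZ].
have [|c1 hc1] := hg1 (u - \sum_i c2 i *: h i).
  apply/hA1; have := submD huv (submZ (- 1) (Asum _ (fun i => (h i, g2 i)) c2 hh)).
  congr (A _); rewrite scaleN1r.
  by rewrite (prodm_sum (fun i => c2 i *: h i)) -hc2; apply: (congr2 pair); rewrite ?subrr.
exists (fun i => match fintype.split i with inl j => c1 j | inr j => c2 j end).
rewrite big_split_ord /=.
under eq_bigr => i _ do rewrite /g (unsplitK (inl i)).
under [X in _ + X]eq_bigr => i _ do rewrite /g (unsplitK (inr i)).
rewrite (prodm_sum (fun i => c1 i *: g1 i)) (prodm_sum (fun i => c2 i *: h i)) -hc1 -hc2.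
apply: (congr2 pair) => /=; first by rewrite subrK.
by rewrite big1 ?add0r // => i _; rewrite scaler0.
Qed.

Fixpoint powm (k : nat) : lmodType S :=
  if k is k'.+1 then prodm (S^o : lmodType S) (powm k') else zerom S.

Lemma powm_projective k : projective_module (powm k).
Proof.
elim: k => [|k IHk]; last exact: prodm_projective (@regular_projective S) IHk.
move=> M N u f hu; exists \0 => a.
by rewrite linear0 (zerom_eq0 a) linear0.
Qed.

(** This keeps the kernels in the cover of a complex of finitely generated modules finitely
    generated. *)
Lemma powm_noeth k : noetherian S -> noeth_module (powm k).
Proof.
move=> hS; elim: k => [|k IHk]; last exact: prodm_noeth (regular_noeth hS) IHk.
move=> A; exists 0%N, (fun=> 0); split=> [i|u _]; first exact: subm0.
by exists (fun=> 0); rewrite big_ord0; apply: zerom_eq0.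
Qed.

Lemma powm_surj (M : lmodType S) : finitely_generated M ->
  exists k (f : {linear powm k -> M}), forall v, exists u, f u = v.
Proof.
move=> [k [g hg]]; exists k.
suff [f hf] : exists f : {linear powm k -> M}, forall c, exists u, f u = \sum_(i < k) c i *: g i.
  by exists f => v; have [c ->] := hg v; apply: hf.
elim: k g {hg} => [|k IHk] g.
  by exists \0 => c; exists 0; rewrite big_ord0.
have [f hf] := IHk (fun i => g (lift ord0 i)).
have hl : linear (fun s : S^o => s *: g ord0).
  by move=> r s t; rewrite scalerDl scalerA.
exists (lcopair (lin_of hl) f) => c; have [u hu] := hf (fun i => c (lift ord0 i)).
by exists (c ord0, u); rewrite /= hu big_ord_recl.
Qed.

Lemma fg_prodm (M N : lmodType S) :
  finitely_generated M -> finitely_generated N -> finitely_generated (prodm M N).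
Proof.
move=> [k1 [g1 h1]] [k2 [g2 h2]].
pose g (i : 'I_(k1 + k2)) : prodm M N :=
  match fintype.split i with inl j => (g1 j, 0) | inr j => (0, g2 j) end.
exists (k1 + k2)%N, g => -[u v]; have [c1 hc1] := h1 u; have [c2 hc2] := h2 v.
exists (fun i => match fintype.split i with inl j => c1 j | inr j => c2 j end).
rewrite big_split_ord /=.
under eq_bigr => i _ do rewrite /g (unsplitK (inl i)).
under [X in _ + X]eq_bigr => i _ do rewrite /g (unsplitK (inr i)).
rewrite (prodm_sum (fun i => c1 i *: g1 i)) (prodm_sum (fun i => c2 i *: 0)) -hc1 -hc2.
by apply: (congr2 pair) => /=; rewrite big1 ?addr0 ?add0r // => i _; rewrite scaler0.
Qed.

Lemma powm_fg k : finitely_generated (powm k).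
Proof.
elim: k => [|k IHk].
  by exists 0%N, (fun=> 0) => u; exists (fun=> 0); rewrite big_ord0; apply: zerom_eq0.
apply: fg_prodm => //; exists 1%N, (fun=> 1) => u; exists (fun=> u).
by rewrite big_ord1; apply/esym/mulr1.
Qed.

End Noetherian.

(** * Total tensor products *)

Section Hom.
Variable S : comPzRingType.
Implicit Types (M N L : lmodType S).

Definition hom_subm M N : subm (funm M N).
Proof.
exists (fun f => linear f) => [a u v|f g hf hg a u v|s f hf a u v].
- by rewrite scaler0 addr0.
- rewrite -[LHS]/(f (a *: u + v) + g (a *: u + v)) hf hg.
  by rewrite -[RHS]/(a *: (f u + g u) + (f v + g v)) scalerDr; zmod.
- rewrite -[LHS]/(s *: f (a *: u + v)) hf.
  by rewrite -[RHS]/(a *: (s *: f u) + s *: f v) scalerDr !scalerA mulrC.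
Defined.

Definition homm M N : lmodType S := smod (hom_subm M N).

Lemma hom_app_subproof M N : exists app : homm M N -> M -> N,
  [/\ bilinear_map app, forall f g, app f =1 app g -> f = g &
      forall f : {linear M -> N}, exists h, app h =1 f].
Proof.
exists (fun h => sinc (hom_subm M N) h); split.
- split=> [v s f g|f]; last exact: (sincP f).
  by rewrite linearP.
- by move=> f g fg; apply: sinc_inj; apply/funext.
- by move=> f; have [h hh] := @sinc_mem _ _ (hom_subm M N) f (linearP f); exists h; rewrite hh.
Qed.
Definition hom_app M N : homm M N -> M -> N := sval (cid (hom_app_subproof M N)).
Lemma hom_app_bilinear M N : bilinear_map (@hom_app M N).
Proof. by rewrite /hom_app; case: cid => f []. Qed.
Lemma hom_app_ext M N (f g : homm M N) : hom_app f =1 hom_app g -> f = g.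
Proof. by move: f g; rewrite /hom_app; case: cid => f []. Qed.
Lemma hom_app_mk M N (f : {linear M -> N}) : exists h : homm M N, hom_app h =1 f.
Proof. by have [_ _ hm] := svalP (cid (hom_app_subproof M N)); apply: hm. Qed.
Definition hom_appl M N (v : M) : {linear homm M N -> N} := lin_of ((hom_app_bilinear M N).1 v).
Definition hom_appr M N (f : homm M N) : {linear M -> N} := lin_of ((hom_app_bilinear M N).2 f).

Lemma hom_curry M N L (b : L -> M -> N) : bilinear_map b ->
  exists f : {linear L -> homm M N}, forall l m, hom_app (f l) m = b l m.
Proof.
move=> [b1 b2]; have /choice[f hf] l := hom_app_mk (lin_of (b2 l)).
have hl : linear f.
  move=> s u v; apply: hom_app_ext => m; rewrite hf /= b1.
  by rewrite -[RHS]/(hom_appl N m (s *: f u + f v)) linearP /= !hf.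
by exists (lin_of hl) => l m; rewrite hf.
Qed.

End Hom.

Section TotalTensor.
Variable S : comPzRingType.

(** * Existence of the total tensor product *)

Section Existence.
Variables X Y : complex S.

(** One set of symbols serves all total degrees: those with [i + j <> n] are killed in degree [n],
    because [tfam] asks families to vanish there. *)
Definition tgen : choiceType := Choice.clone {i : int & {j : int & (X i * Y j)%type}} _.
Definition tmk i j (u : X i) (v : Y j) : tgen := existT _ i (existT _ j (u, v)).

Definition tfam (n : int) (L : lmodType S) (b : forall i j : int, X i -> Y j -> L) : Prop :=
  (forall i j : int, i + j = n -> bilinear_map (b i j)) /\
  (forall i j u v, i + j <> n -> b i j u v = 0).

(* The relations are those satisfied by every family of bilinear maps. *)
Definition trel (n : int) : subm (freem S tgen).
Proof.
exists (fun w => forall (L : lmodType S) (b : forall i j : int, X i -> Y j -> L)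
  (f : {linear freem S tgen -> L}), tfam n b ->
  (forall i j u v, f (delta (@tmk i j u v)) = b i j u v) -> f w = 0).
- by move=> L b f _ _; apply: linear0.
- by move=> u v hu hv L b f hb hf; rewrite linearD (hu _ b) // (hv _ b) // addr0.
- by move=> s u hu L b f hb hf; rewrite linearZ_LR (hu _ b) // scaler0.
Defined.

Definition tmod n : lmodType S := qmod (trel n).

Lemma tmod_proj_subproof n : exists q : {linear freem S tgen -> tmod n},
  (forall v, exists u, q u = v) /\ (forall u, q u = 0 <-> trel n u).
Proof. by exists (qproj _); split=> [v|u]; [apply: qproj_surj|apply: qproj_eq0]. Qed.
Definition tproj n := sval (cid (tmod_proj_subproof n)).
Lemma tproj_surj n v : exists u, tproj n u = v.
Proof. exact: (svalP (cid (tmod_proj_subproof n))).1. Qed.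
Lemma tproj_eq0 n u : tproj n u = 0 <-> trel n u.
Proof. exact: (svalP (cid (tmod_proj_subproof n))).2. Qed.

Definition tens i j n (u : X i) (v : Y j) : tmod n := tproj n (delta (tmk u v)).

Lemma tens_bilinear (i j n : int) : i + j = n -> bilinear_map (@tens i j n).
Proof.
move=> hn; split=> [v s u u'|u s v v']; apply/eqP; rewrite -subr_eq0 /tens -linearP -linearB;
  apply/eqP/tproj_eq0 => L b f [hb _] hf; rewrite linearB linearP !hf.
  by rewrite /= (hb _ _ hn).1 subrr.
by rewrite /= (hb _ _ hn).2 subrr.
Qed.

Lemma tens_lift (n : int) (L : lmodType S) (b : forall i j : int, X i -> Y j -> L) :
  (forall i j : int, i + j = n -> bilinear_map (b i j)) ->
  exists f : {linear tmod n -> L},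
    forall (i j : int) u v, i + j = n -> f (@tens i j n u v) = b i j u v.
Proof.
move=> hb; pose b0 (i j : int) (u : X i) (v : Y j) := if i + j == n then b i j u v else 0.
have [f hf] := freem_lift (fun g : tgen =>
  let: existT i (existT j (u, v)) := g in b0 i j u v).
have [|g hg] := lin_factor (f := f) (@tproj_surj n).
  move=> w /tproj_eq0; apply=> [|i j u v]; last by rewrite hf.
  split=> [i j hij|i j u v /eqP/negPf hij]; last by rewrite /b0 hij.
  by rewrite /b0 hij eqxx; apply: hb.
by exists g => i j u v /eqP hij; rewrite /tens hg hf /= /b0 hij.
Qed.

Lemma tens_ext (n : int) (L : lmodType S) (f g : {linear tmod n -> L}) :
  (forall (i j : int) u v, i + j = n -> f (@tens i j n u v) = g (@tens i j n u v)) -> f =1 g.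
Proof.
move=> h w; have [z <-] := tproj_surj w; move: z.
apply: (@freem_ext _ _ _ (f \o tproj n) (g \o tproj n)) => -[i [j [u v]]] /=.
have [hij|/eqP hij] := eqVneq (i + j) n; first exact: (h i j u v hij).
have -> : tproj n (delta (tmk u v)) = 0; last by rewrite !linear0.
by apply/tproj_eq0 => M b k [_ hb] hk; rewrite hk; exact: (hb i j u v hij).
Qed.

Definition tdiff_val i j n (u : X i) (v : Y j) : tmod n :=
  tens n (diff X i (i - 1) u) v + (-1) ^+ `|i|%N *: tens n u (diff Y j (j - 1) v).

Lemma tdiff_exists : exists d : forall n n', {linear tmod n -> tmod n'},
  (forall n n', n' != n - 1 -> forall u, d n n' u = 0) /\
  forall (i j n : int) u v, i + j = n -> d n (n - 1) (@tens i j n u v) = tdiff_val (n - 1) u v.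
Proof.
have /dchoice2[d hd] n n' : exists d : {linear tmod n -> tmod n'},
    (n' != n - 1 -> forall u, d u = 0) /\
    (n' = n - 1 -> forall i j u v, i + j = n -> d (@tens i j n u v) = tdiff_val n' u v).
  have [->|hn] := eqVneq n' (n - 1); last by exists \0; split=> // e; rewrite e eqxx in hn.
  have [|d hd] := @tens_lift n _ (fun i j u v => @tdiff_val i j (n - 1) u v).
    move=> i j hij; have h1 : i - 1 + j = n - 1 by lia.
    have h2 : i + (j - 1) = n - 1 by lia.
    split=> [v s u u'|u s v v']; rewrite /tdiff_val linearP.
      rewrite (tens_bilinear h1).1 (tens_bilinear h2).1 /= !scalerDr !scalerA mulrC.
      by rewrite -!scalerA; zmod.
    rewrite (tens_bilinear h1).2 (tens_bilinear h2).2 /= !scalerDr !scalerA mulrC.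
    by rewrite -!scalerA; zmod.
  by exists d; split.
by exists d; split=> [n n'|i j n u v]; [exact: (hd n n').1|exact: ((hd n (n - 1)).2 erefl)].
Qed.

Theorem total_tensor_exists : exists (T : complex S) (t : forall i j n : int, X i -> Y j -> T n),
  is_total_tensor t.
Proof.
have [d [d0 hd]] := tdiff_exists.
have dsq i j k u : d j k (d i j u) = 0.
  have [hj|/d0->] := eqVneq j (i - 1); last by rewrite linear0.
  have [hk|/d0-> //] := eqVneq k (j - 1); subst k j; move: u.
  apply: (@tens_ext _ _ (d _ _ \o d _ _) \0) => a b u v hab /=.
  have h1 : a - 1 + b = i - 1 by lia.
  have h2 : a + (b - 1) = i - 1 by lia.
  have h3 : a - 1 - 1 + b = i - 1 - 1 by lia.
  have h4 : a + (b - 1 - 1) = i - 1 - 1 by lia.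
  rewrite hd // /tdiff_val linearD linearZ_LR !hd // /tdiff_val !diff_sq sgn_pred.
  have -> : tens (i - 1 - 1) (0 : X (a - 1 - 1)) v = 0.
    exact: (linear0 (lin_of ((tens_bilinear h3).1 v))).
  have -> : tens (i - 1 - 1) u (0 : Y (b - 1 - 1)) = 0.
    exact: (linear0 (lin_of ((tens_bilinear h4).2 u))).
  by rewrite scaler0 addr0 add0r scaleNr addNr.
exists (@Complex S tmod d d0 dsq), (fun i j n u v => @tens i j n u v); split.
- by move=> i j n; apply: tens_bilinear.
- exact: tens_lift.
- exact: tens_ext.
- by move=> i j n u v hij; rewrite /= hd.
Qed.

End Existence.

Section Maps.
Variables (X Y T X2 Y2 T2 : complex S).
Variables (t : forall i j n : int, X i -> Y j -> T n) (t2 : forall i j n : int, X2 i -> Y2 j -> T2 n).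
Arguments t : clear implicits.
Arguments t2 : clear implicits.
Hypotheses (ht : is_total_tensor t) (ht2 : is_total_tensor t2).

Lemma tensor_map (e : int) (f : forall i i', {linear X i -> X2 i'})
    (g : forall j, {linear Y j -> Y2 j}) (n n2 : int) : n2 = n + e ->
  exists F : {linear T n -> T2 n2}, forall i i2 j u v, i + j = n -> i2 = i + e ->
    F (t i j n u v) = t2 i2 j n2 (f i i2 u) (g j v).
Proof.
move=> hn; have [_ lift _ _] := ht; have [bil _ _ _] := ht2.
have [|F hF] := lift n (T2 n2) (fun i j u v => t2 (i + e) j n2 (f i (i + e) u) (g j v)).
  move=> i j hij; have hb := bil (i + e) j n2 ltac:(lia).
  split=> [v s u u'|u s v v']; rewrite linearP; first exact: hb.1.
  exact: hb.2.
by exists F => i i2 j u v hij ->; apply: hF.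
Qed.

End Maps.

Lemma tensor_diff (X Y T : complex S) (t : forall i j n : int, X i -> Y j -> T n) :
  is_total_tensor t -> forall i i' j j' n n' u v,
  i + j = n -> i' = i - 1 -> j' = j - 1 -> n' = n - 1 ->
  diff T n n' (t i j n u v) =
    t i' j n' (diff X i i' u) v + (-1) ^+ `|i|%N *: t i j' n' u (diff Y j j' v).
Proof. by move=> [_ _ _ hd] i i' j j' n n' u v hij -> -> ->; apply: hd. Qed.

Lemma total_tensor0r (X Y T : complex S) (t : forall i j n : int, X i -> Y j -> T n) :
  is_total_tensor t -> forall i j n u, i + j = n -> t i j n u 0 = 0.
Proof. by move=> [h _ _ _] i j n u /h[_ h2]; apply: (linear0 (lin_of (h2 u))). Qed.

Section AcyclicTensor.
Variables (P A T : complex S) (t : forall i j n : int, P i -> A j -> T n).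
Arguments t : clear implicits.
Hypotheses (ht : is_total_tensor t) (hP : K_projective P) (hA : acyclic A).

Section HomComplex.
Variables (n : int) (E : lmodType S).

(** The sign is dictated by the differential of the total tensor product: with it, a map on T_n that
    kills boundaries becomes, after currying, a chain map from [P]. *)
Lemma homd_subproof i j : exists d : {linear homm (A (n - i)) E -> homm (A (n - j)) E},
  forall h v, hom_app (d h) v = (-1) ^+ `|i - 1|%N *: hom_app h (diff A (n - j) (n - i) v).
Proof.
apply: hom_curry; split=> [v s f g|f s u v].
  rewrite (hom_app_bilinear _ _).1 scalerDr !scalerA mulrC.
  by rewrite -scalerA.
rewrite linearP (hom_app_bilinear _ _).2 scalerDr !scalerA mulrC.
by rewrite -scalerA.
Qed.
Definition homd i j := sval (cid (homd_subproof i j)).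
Lemma homdE i j h v :
  hom_app (homd i j h) v = (-1) ^+ `|i - 1|%N *: hom_app h (diff A (n - j) (n - i) v).
Proof. exact: (svalP (cid (homd_subproof i j))). Qed.

Lemma hom_app0l (M N : lmodType S) (v : M) : hom_app (0 : homm M N) v = 0.
Proof. exact: (linear0 (hom_appl N v)). Qed.
Lemma hom_app0r (M N : lmodType S) (f : homm M N) : hom_app f 0 = 0.
Proof. exact: (linear0 (hom_appr f)). Qed.

Lemma homd_shape i j : j != i - 1 -> forall u, homd i j u = 0.
Proof.
move=> ji u; apply: hom_app_ext => v; rewrite homdE diff_shape ?hom_app0r ?scaler0 ?hom_app0l //.
by apply: contra ji => /eqP ?; apply/eqP; lia.
Qed.
Lemma homd_sq i j k u : homd j k (homd i j u) = 0.
Proof.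
by apply: hom_app_ext => v; rewrite !homdE diff_sq hom_app0r !scaler0 hom_app0l.
Qed.
Definition homc : complex S :=
  @Complex S (fun i => homm (A (n - i)) E) homd homd_shape homd_sq.

Lemma homc_acyclic : injective_module E -> acyclic homc.
Proof.
move=> hE k; apply/(homology_zeroP _ (erefl (k + 1)) (erefl (k - 1))) => f f0.
have [|g hg] := @injective_extend _ E _ _ (diff A (n - k) (n - (k + 1))) (hom_appr f) hE.
  have e1 : n - (k - 1) = n - k + 1 by lia.
  have e2 : n - (k + 1) = n - k - 1 by lia.
  move=> u u0; have [v <-] := (homology_zeroP A e1 e2).1 (@hA (n - k)) u u0.
  have := congr1 (fun h : homm _ E => hom_app h v) f0.
  rewrite [LHS]homdE hom_app0l => /(congr1 (fun e => (-1) ^+ `|k - 1|%N *: e)).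
  by rewrite scaler0 scalerA sgn_sgn scale1r.
have [h hh] := hom_app_mk ((-1) ^+ `|k|%N \*: g : {linear _ -> E}).
exists h; apply: hom_app_ext => v; rewrite homdE hh /= addrK scalerA sgn_sgn scale1r.
exact: hg.
Qed.

End HomComplex.

(* A map from T_n to an injective E killing boundaries is a chain map from P to the acyclic
   complex Hom(A, E), hence null-homotopic, hence factors through the differential. *)
Lemma acyclic_tensor : acyclic T.
Proof.
move=> n; apply/(homology_zeroP _ (erefl (n + 1)) (erefl (n - 1))) => z z0.
have [bil lift ext hd] := ht.
pose q := qproj (range_subm (diff T (n + 1) n)).
pose E := ihull (qmod (range_subm (diff T (n + 1) n))).
pose phi : {linear T n -> E} := ihull_map _ \o q.
suff [psi hpsi] : exists psi : {linear T (n - 1) -> E}, forall w, psi (diff T n (n - 1) w) = phi w.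
  have : q z = 0 by apply: (@ihull_map_inj _ _ _); rewrite linear0 -[LHS]/(phi z) -hpsi z0 linear0.
  by move=> /qproj_eq0[w _ <-]; exists w.
have phi0 w : phi (diff T (n + 1) n w) = 0.
  have hw : q (diff T (n + 1) n w) = 0 by apply/qproj_eq0; exists w.
  by rewrite -[LHS]/(ihull_map _ (q _)) hw linear0.
have /dchoice[F hF] i : exists F : {linear P i -> homm (A (n - i)) E},
    forall u v, hom_app (F u) v = phi (t i (n - i) n u v).
  apply: hom_curry; have [b1 b2] := bil i (n - i) n (subrKC _ _).
  by split=> [v s u u'|u s v v']; rewrite ?b1 ?b2 linearP.
have Fc i j u : j = i - 1 -> F j (diff P i j u) = diff (homc n E) i j (F i u).
  move=> hj; apply: hom_app_ext => v; rewrite hF [RHS]homdE hF.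
  have := phi0 (t i (n - j) (n + 1) u v).
  rewrite (@tensor_diff _ _ _ _ ht i j (n - j) (n - i) (n + 1) n); [|lia..].
  rewrite linearD linearZ_LR => /eqP; rewrite addr_eq0 => /eqP ->.
  by rewrite sgn_pred scaleNr.
have [h hh] := hP (mk_chain_map (Y := homc n E) Fc) (homc_acyclic (@ihull_injective _ _)).
(* The homotopy maps P_i to Hom(A_(n-i-1), E); uncurried, its components define one map on
   T_(n-1). *)
have [|psi hpsi] := lift (n - 1) E
    (fun i j u v => hom_app (h i (i + 1) u) (castm A j (n - (i + 1)) v)).
  move=> i j hij; split=> [v s u u'|u s v v']; rewrite linearP.
    exact: (hom_app_bilinear _ _).1.
  exact: (hom_app_bilinear _ _).2.
exists psi; apply: (ext _ _ (psi \o diff T n (n - 1)) phi) => i j u v hij.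
have {hij}ej : j = n - i by lia.
subst j; rewrite -[LHS]/(psi (diff T n (n - 1) _)).
rewrite (@tensor_diff _ _ _ _ ht i (i - 1) (n - i) (n - (i + 1)) n (n - 1)); [|lia..].
rewrite linearD linearZ_LR !hpsi; [|lia..].
rewrite castm_id -hF; have /= -> := hh i u.
rewrite -[RHS]/(hom_appl E v _) linearD -[X in _ = X + _]/(hom_app (homd _ _ _ _ _) v).
rewrite homdE [LHS]addrC; congr (_ + _); first by rewrite addrK.
have : forall i', i' = i -> hom_app (h (i - 1) i' (diff P i (i - 1) u)) (castm A (n - i) (n - i') v) =
  hom_app (h (i - 1) i (diff P i (i - 1) u)) v by move=> _ ->; rewrite castm_id.
by apply; rewrite subrK.
Qed.

End AcyclicTensor.

(** It is enough that an embedding [phi] of T_n into an injective [E] factors through multiplication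
    by [x]. On Hom(C_j, E) that multiplication is onto, because C_j is torsion-free and [E]
    injective, so the curried [phi] lifts along it from the projective P_i. *)
Lemma xfree_tensor (x : S) (P C T : complex S) (t : forall i j n : int, P i -> C j -> T n) :
  is_total_tensor t -> (forall i, projective_module (P i)) ->
  (forall i, xfree x (C i)) -> forall n, xfree x (T n).
Proof.
move=> [bil lift ext _] hP hC n z z0.
pose E := ihull (T n); pose phi : {linear T n -> E} := ihull_map _.
suff [psi hpsi] : exists psi : {linear T n -> E}, forall w, psi (x *: w) = phi w.
  by apply: (@ihull_map_inj _ (T n)); rewrite linear0 -[LHS]hpsi z0 linear0.
have hE : injective_module E := @ihull_injective _ _.
have /dchoice[psi hpsi] i : exists psi : {linear P i -> homm (C (n - i)) E},
    forall u v, hom_app (psi u) (x *: v) = phi (t i (n - i) n u v).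
  have [b1 b2] := bil i (n - i) n (subrKC _ _).
  have [F hF] : exists F : {linear P i -> homm (C (n - i)) E},
      forall u v, hom_app (F u) v = phi (t i (n - i) n u v).
    by apply: hom_curry; split=> [v s u u'|u s v v']; rewrite ?b1 ?b2 linearP.
  have [X hX] : exists X : {linear homm (C (n - i)) E -> homm (C (n - i)) E},
      forall f v, hom_app (X f) v = hom_app f (x *: v).
    apply: hom_curry; split=> [v s f g|f s v v'].
      exact: (hom_app_bilinear _ _).1.
    rewrite scalerDr scalerA mulrC -scalerA.
    exact: (hom_app_bilinear _ _).2.
  have [|psi hpsi] := projective_lift (d := X) (f := F) (hP i).
    move=> u; have [g hg] := xfree_lift (hom_appr (F u)) (hC _) hE.
    have [f hf] := hom_app_mk g; exists f; apply: hom_app_ext => v.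
    by rewrite hX hf hg.
  by exists psi => u v; rewrite -hX hpsi hF.
have [|f hf] := lift n E (fun i j u v => hom_app (psi i u) (castm C j (n - i) v)).
  move=> i j hij; split=> [v s u u'|u s v v']; rewrite linearP.
    exact: (hom_app_bilinear _ _).1.
  exact: (hom_app_bilinear _ _).2.
exists f; apply: (ext _ _ (f \o xmul x (T n)) phi) => i j u v hij.
have ej : j = n - i by lia.
subst j; rewrite /= linearZ_LR hf // castm_id -hpsi.
exact: (esym (linearZ_LR (hom_appr (psi i u)) x v)).
Qed.

(** * Tensoring on the right commutes with cones *)

Section ConeTensor.
Variables (P C Y T TC : complex S) (c : chain_map C Y).
Variables (t : forall i j n : int, P i -> Y j -> T n) (tc : forall i j n : int, P i -> C j -> TC n).
Arguments t : clear implicits.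
Arguments tc : clear implicits.
Hypotheses (ht : is_total_tensor t) (htc : is_total_tensor tc).

Lemma tensor_chain_map : exists F : chain_map TC T,
  forall i j n u v, i + j = n -> F n (tc i j n u v) = t i j n u (c j v).
Proof.
have /dchoice[F hF] n : exists F : {linear TC n -> T n},
    forall i j u v, i + j = n -> F (tc i j n u v) = t i j n u (c j v).
  have [|F hF] := @tensor_map _ _ _ _ _ _ _ _ htc ht 0 (fun i i' => castm P i i') c n n.
    by rewrite addr0.
  exists F => i j u v hij; rewrite (hF i i) ?addr0 //.
  by rewrite castm_id.
have Fc n n' w : n' = n - 1 -> F n' (diff TC n n' w) = diff T n n' (F n w).
  move=> hn; have [_ _ ext _] := htc; move: w.
  apply: (ext _ _ (F n' \o diff TC n n') (diff T n n' \o F n)) => i j u v hij /=.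
  rewrite (@tensor_diff _ _ _ _ htc i (i - 1) j (j - 1)) // linearD linearZ_LR !hF; [|lia..].
  by rewrite (@tensor_diff _ _ _ _ ht i (i - 1) j (j - 1)) // cmap_comm.
by exists (mk_chain_map Fc) => i j n u v; apply: hF.
Qed.

Variable F : chain_map TC T.
Hypothesis hF : forall i j n u v, i + j = n -> F n (tc i j n u v) = t i j n u (c j v).

(** The sign comes from moving the shift in the cone past [u]. *)
Definition cone_tens i j n (u : P i) (v : cone c j) : cone F n :=
  (t i j n u v.1, (-1) ^+ `|i|%N *: tc i (j - 1) (n - 1) u v.2).

Arguments cone_tens : clear implicits.

Lemma cone_total_tensor : is_total_tensor cone_tens.
Proof.
have [b1 l1 e1 _] := ht; have [b2 l2 e2 _] := htc.
have castE i j (L : lmodType S) (b : forall i j : int, P i -> cone c j -> L) u v :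
    b i (j - 1 + 1) u (0, castm C (j - 1) (j - 1 + 1 - 1) v) = b i j u (0, v).
  have : forall j', j' = j -> b i j' u (0, castm C (j - 1) (j' - 1) v) = b i j u (0, v).
    by move=> _ ->; rewrite castm_id.
  by apply; rewrite subrK.
split.
- move=> i j n hij; have hij' : i + (j - 1) = n - 1 by lia.
  split=> [v s u u'|u s v v']; apply: (congr2 pair) => /=.
  + exact: (b1 _ _ _ hij).1.
  + by rewrite (b2 _ _ _ hij').1 scalerDr !scalerA mulrC.
  + exact: (b1 _ _ _ hij).2.
  + by rewrite (b2 _ _ _ hij').2 scalerDr !scalerA mulrC.
- move=> n L b hb.
  have [|f hf] := l1 n L (fun i j u v => b i j u (v, 0)).
    move=> i j hij; split=> [v|u]; first exact: (hb i j hij).1.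
    move=> s v v'; rewrite -(hb i j hij).2; congr (b i j u _).
    exact: (linearP (lpair idfun \0) s v v').
  have [|g hg] := l2 (n - 1) L (fun i j u v => (-1) ^+ `|i|%N *:
      b i (j + 1) u (0, castm C j (j + 1 - 1) v)).
    move=> i j hij; have {}hij : i + (j + 1) = n by lia.
    split=> [v s u u'|u s v v'].
      by rewrite (hb _ _ hij).1 scalerDr !scalerA mulrC.
    rewrite linearP; set a := castm _ _ _ v; set a' := castm _ _ _ v'.
    have -> : (0, s *: a + a') = s *: (0, a) + (0, a') :> cone c (j + 1).
      exact: (linearP (lpair \0 idfun) s a a').
    by rewrite (hb _ _ hij).2 scalerDr !scalerA mulrC.
  exists (lcopair f g) => i j u [y a] hij; rewrite /= linearZ_LR hf // hg; last by lia.
  rewrite scalerA sgn_sgn scale1r castE.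
  rewrite -[LHS]/(b i j u (y, 0) + b i j u (0, a)).
  have := (hb i j hij).2 u 1 (y, 0) (0, a); rewrite !scale1r => <-; congr (b i j u _).
  by apply: (congr2 pair); rewrite ?addr0 ?add0r.
- move=> n L f g hfg w.
  have h1 : f \o lpair idfun \0 =1 g \o lpair idfun \0.
    apply: (e1 n L (f \o lpair idfun \0) (g \o lpair idfun \0)) => i j u v hij /=.
    have := hfg i j u (v, 0) hij; rewrite /cone_tens /= (total_tensor0r htc) ?scaler0 //.
    by lia.
  have h2 : f \o lpair \0 idfun =1 g \o lpair \0 idfun.
    apply: (e2 (n - 1) L (f \o lpair \0 idfun) (g \o lpair \0 idfun)) => i j u v.
    move: (j + 1) (addrK 1 j) => j2 ej; move: (esym ej) => {}ej; subst j => hij /=.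
    have hij' : i + j2 = n by lia.
    have := hfg i j2 u (0, (-1) ^+ `|i|%N *: v) hij'; rewrite /cone_tens /=.
    rewrite (total_tensor0r ht) //.
    have -> : tc i (j2 - 1) (n - 1) u ((-1) ^+ `|i|%N *: v) = (-1) ^+ `|i|%N *: tc i (j2 - 1) (n - 1) u v.
      exact: (linearZ_LR (lin_of ((b2 _ _ _ hij).2 u))).
    by rewrite scalerA sgn_sgn scale1r.
  have -> : w = lpair idfun \0 w.1 + lpair \0 idfun w.2 :> cone F n.
    by rewrite [LHS]surjective_pairing; apply: (congr2 pair); rewrite /= ?addr0 ?add0r.
  by rewrite !linearD; congr (_ + _); [exact: h1|exact: h2].
- move=> i j n u [y a] hij.
  have h1 : i - 1 + (j - 1) = n - 1 - 1 by lia.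
  rewrite [LHS]coneE coneE; apply: (congr2 pair) => /=.
    rewrite linearZ_LR hF; last by lia.
    rewrite (@tensor_diff _ _ _ _ ht i (i - 1) j (j - 1)) //.
    have hb := (b1 i (j - 1) (n - 1) ltac:(lia)).2 u 1; rewrite -[X in t _ _ _ u (X + _)]scale1r hb scale1r.
    by rewrite scalerDr; zmod.
  rewrite linearZ_LR (@tensor_diff _ _ _ _ htc i (i - 1) (j - 1) (j - 1 - 1) (n - 1) (n - 1 - 1)) //; last by lia.
  have -> : tc i (j - 1 - 1) (n - 1 - 1) u (- diff C (j - 1) (j - 1 - 1) a) =
      - tc i (j - 1 - 1) (n - 1 - 1) u (diff C (j - 1) (j - 1 - 1) a).
    exact: (linearN (lin_of ((b2 i (j - 1 - 1) (n - 1 - 1) ltac:(lia)).2 u))).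
  by rewrite sgn_pred !scalerN scaleNr scalerDr; zmod.
Qed.

End ConeTensor.

(** The cone of the induced map is the tensor product of [P] with the acyclic cone of [c]. *)
Theorem tensor_qiso (P C Y T TC : complex S) (c : chain_map C Y)
    (t : forall i j n : int, P i -> Y j -> T n) (tc : forall i j n : int, P i -> C j -> TC n) :
  is_total_tensor t -> is_total_tensor tc -> K_projective P -> quasi_iso c ->
  exists F : chain_map TC T, quasi_iso F.
Proof.
move=> ht htc hP hc; have [F hF] := tensor_chain_map c ht htc.
exists F; apply/cone_acyclic.
exact: acyclic_tensor (cone_total_tensor ht htc hF) hP ((cone_acyclic c).1 hc).
Qed.

End TotalTensor.

(** * Twists by a map of degree -2 *)

Section Twist.
Variable S : comPzRingType.

Section TwistComplex.
Variables (P : complex S) (tau : forall i, {linear P i -> P (i - 1 - 1)}).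
Hypothesis tauC : forall i u,
  diff P (i - 1 - 1) (i - 1 - 1 - 1) (tau i u) = tau (i - 1) (diff P i (i - 1) u).

(** Up to a shift, the twist is the mapping cone of [tau]: the second summand is a subcomplex, the
    first is the quotient, and [tau] is the connecting map. The three Hom lemmas below are exactness
    statements for this extension. *)
Definition twist_mod (i : int) : lmodType S := prodm (P i) (P (i - 1)).
Definition twist_d i j : {linear twist_mod i -> twist_mod j} :=
  lpair (lcopair (diff P i j) \0)
    (lcopair (castm P (i - 1 - 1) (j - 1) \o tau i) (\- diff P (i - 1) (j - 1))).

Lemma twist_dE i a b : twist_d i (i - 1) (a, b) =
  (diff P i (i - 1) a, tau i a - diff P (i - 1) (i - 1 - 1) b).
Proof. by rewrite /= castm_id addr0. Qed.

Lemma twist_shape i j : j != i - 1 -> forall u, twist_d i j u = 0.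
Proof.
move=> ji [a b]; have ji' : j - 1 != i - 1 - 1.
  by apply: contra ji => /eqP ?; apply/eqP; lia.
rewrite /= (diff_shape ji) (diff_shape ji') castm_neq ?oppr0 ?addr0 //.
by move=> /eqP; rewrite eq_sym (negPf ji').
Qed.

Lemma twist_sq i j k u : twist_d j k (twist_d i j u) = 0.
Proof.
have [hj|/twist_shape->] := eqVneq j (i - 1); last by rewrite linear0.
have [hk|/twist_shape-> //] := eqVneq k (j - 1).
subst k j; case: u => a b; rewrite !twist_dE diff_sq diffB diff_sq tauC subr0 subrr.
by [].
Qed.

Definition twist : complex S := @Complex S twist_mod twist_d twist_shape twist_sq.

Lemma twistE i a b : diff twist i (i - 1) (a, b) =
  (diff P i (i - 1) a, tau i a - diff P (i - 1) (i - 1 - 1) b).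
Proof. exact: twist_dE. Qed.

Definition twl i : {linear P i -> twist i} := lpair idfun \0.
Definition twr i : {linear P (i - 1) -> twist i} := lpair \0 idfun.

Lemma twist_splitE i (u : twist i) : u = twl i u.1 + twr i u.2.
Proof.
by rewrite [LHS]surjective_pairing; apply: (congr2 pair); rewrite /= ?addr0 ?add0r.
Qed.

Lemma twist_l i a : diff twist i (i - 1) (twl i a) =
  twl (i - 1) (diff P i (i - 1) a) + twr (i - 1) (tau i a).
Proof.
by rewrite [LHS]twistE; apply: (congr2 pair); rewrite /= ?diff0 ?addr0 ?add0r ?subr0.
Qed.

Lemma twist_r i b : diff twist i (i - 1) (twr i b) = - twr (i - 1) (diff P (i - 1) (i - 1 - 1) b).
Proof.
by rewrite [LHS]twistE; apply: (congr2 pair); rewrite /= ?diff0 ?linear0 ?sub0r ?oppr0.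
Qed.

Lemma twist_homology k : homology_zero P k -> homology_zero P (k - 1) -> homology_zero twist k.
Proof.
move=> h1 h2; apply/(homology_zeroP _ (erefl (k + 1)) (erefl (k - 1))).
have {h1} := (homology_zeroP _ (erefl (k + 1)) (erefl (k - 1))).1 h1.
have {h2} := (homology_zeroP _ (esym (subrK 1 k)) (erefl (k - 1 - 1))).1 h2.
move: (k + 1) (addrK 1 k) => l ek; move: (esym ek) => {}ek; subst k => h2 h1 [a b].
rewrite twistE => /prodm_eq0[a0 b0].
have [a1 ha1] := h1 a a0.
have [|b1 hb1] := h2 (tau l a1 - b).
  by rewrite diffB tauC ha1.
by exists (a1, b1); rewrite twistE ha1 hb1; apply: (congr2 pair); rewrite ?subKr.
Qed.

Lemma twist_bounded : bounded_homology P -> bounded_homology twist.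
Proof.
move=> [a [b h]]; exists a, (b + 1) => i hi.
apply: twist_homology; apply: h; move: hi; lia.
Qed.

(** Exactness in the middle of H_e(Hom(P, X)), H_e(Hom(twist, X)), H_(e+1)(Hom(P, X)). The last
    degree is [e + 1] because the subcomplex has P_(i-1) in degree [i]. *)
Lemma hom_zero_twist X e : hom_zero P X e -> hom_zero P X (e + 1) -> hom_zero twist X e.
Proof.
move=> h0 h1 phi hphi.
have [psi psiE] := fam_shift_src (fun i j => phi i j \o twr i).
have [|k hk] := hom_zero_anti h1 (phi := psi).
  move=> i j k l hj hk hl u; move: (i + 1) (addrK 1 i) => i2 ei; move: (esym ei) => {}ei.
  subst i k; rewrite !psiE -[LHS]/(diff X j l (phi i2 j (twr i2 u))).
  rewrite (hphi i2 j (i2 - 1) l) //; last by lia.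
  by rewrite twist_r linearN.
have [|h hh] := h0 (fun i j => (phi i j \o twl i) \- (k (i - 1 - 1) j \o tau i)).
  move=> i j m l hj hm hl u; subst m.
  rewrite -[LHS]/(diff X j l (phi i j (twl i u) - k (i - 1 - 1) j (tau i u))) diffB.
  rewrite (hphi i j (i - 1) l) // twist_l linearD.
  rewrite -[phi _ _ (twr _ _)]/((phi (i - 1) l \o twr (i - 1)) _).
  rewrite -psiE (hk (i - 1 - 1) l (i - 1 - 1 - 1) j) //; [|lia..].
  by rewrite tauC /=; zmod.
exists (fun i l => lcopair (h i l) (k (i - 1) l)) => i j m l hj hm hl u.
subst m; rewrite [in LHS](twist_splitE u) linearD.
rewrite -[phi _ _ (twr _ _)]/((phi i j \o twr i) u.2).
rewrite -psiE (hk (i - 1) j (i - 1 - 1) l) //; last by lia.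
have e1 : phi i j (twl i u.1) - k (i - 1 - 1) j (tau i u.1) = _ := hh i j (i - 1) l hj erefl hl u.1.
rewrite (canRL (subrK _) e1); clear e1.
case: u => a b; rewrite twistE /= [k (i - 1 - 1) j (_ - _)]linearB diffD.
by zmod.
Qed.

(** The classes on [P] that die on the twist come through [tau] from degree [e + 2]: restricting the
    homotopy to the second summand gives the preimage [H]. *)
Lemma hom_zero_twist_inv X e : hom_zero twist X e -> hom_zero P X (e + 1 + 1) -> hom_zero P X e.
Proof.
move=> hV hP phi hphi.
have [|h hh] := hV (fun i j => phi i j \o lfst _ _).
  move=> i j k l hj hk hl [a b]; subst k; rewrite twistE.
  exact: hphi.
have [H HE] := fam_shift_src (fun i j => h i j \o twr i).
have [|m hm] := hP H.
  move=> i j k l hj hk hl u; move: (i + 1) (addrK 1 i) => i2 ei; move: (esym ei) => {}ei.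
  subst i k; rewrite !HE -[LHS]/(diff X j l (h i2 j (twr i2 u))).
  rewrite -[RHS]/(h (i2 - 1) l (twr (i2 - 1) _)).
  have e1 : l = i2 + e by lia.
  have e2 : j = l + 1 by lia.
  have := hh i2 l (i2 - 1) j e1 erefl e2 (twr i2 u).
  rewrite twist_r linearN -[LHS]/(phi i2 l 0) linear0.
  by move=> /esym/eqP; rewrite subr_eq0 => /eqP.
exists (fun i l => (h i l \o twl i) \+ (m (i - 1 - 1) l \o tau i)) => i j k l hj hk hl u.
subst k; have := hh i j (i - 1) l hj erefl hl (twl i u).
rewrite -[LHS]/(phi i j u) => ->; rewrite twist_l linearD.
rewrite -[h _ _ (twr _ _)]/((h (i - 1) j \o twr (i - 1)) _) -HE.
rewrite (hm (i - 1 - 1) j (i - 1 - 1 - 1) l) //; last by lia.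
by rewrite tauC diffD /=; zmod.
Qed.

(** The classes of degree [e - 1] that die in the twist come through [tau] from degree [e + 1]; the
    preimage is the first component of the homotopy. *)
Lemma hom_zero_to_twist G e : hom_zero G twist e -> hom_zero G P (e + 1) -> hom_zero G P (e - 1).
Proof.
move=> hW hP phi hphi.
have [|h hh] := hom_zero_anti hW (phi := fun i j => twr j \o phi i (j - 1)).
  move=> i j k l hj hk hl u; subst l; rewrite [LHS]twist_r.
  by rewrite (hphi i (j - 1) k (j - 1 - 1)) //; lia.
have [|k hk] := hP (fun i l => lfst _ _ \o h i l).
  move=> i l k j hl hk hj u; subst j.
  have e1 : l - 1 = i + e by lia.
  have := hh i (l - 1) k l e1 hk (esym (subrK 1 l)) u; rewrite [h i l u]surjective_pairing twistE.
  by move=> /(congr1 fst) e0; apply/eqP; rewrite -subr_eq0; apply/eqP/esym/e0.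
have [h1 h1E] := fam_shift_tgt (fun i l => lsnd _ _ \o h i l).
have [tk tkE] : exists tk : forall i j, {linear G i -> P j},
    forall (i l : int) u, tk i (l - 1 - 1) u = tau l (k i l u).
  exists (fun i q => castm P (q + 1 + 1 - 1 - 1) q \o tau (q + 1 + 1) \o k i (q + 1 + 1)) => i l u.
  have : forall l', l' = l -> castm P (l' - 1 - 1) (l - 1 - 1) (tau l' (k i l' u)) = tau l (k i l u).
    by move=> _ ->; rewrite castm_id.
  by apply; lia.
exists (fun i q => tk i q \- h1 i q) => i j m l hj hm hl u.
have e1 : l = i + e by lia.
have e2 : j = l - 1 by lia.
clear hj hl; subst j; rewrite /= diffB.
have := hh i l m (l + 1) e1 hm erefl u.
have := hk i (l + 1) m (l + 1 + 1) ltac:(lia) hm erefl u.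
have {e1 hm} _ := hm.
move: (l + 1 + 1) (addrK 1 (l + 1)) => l2 el2.
move: (l + 1) el2 (addrK 1 l) => l1 el2 el1.
move: (esym el2) => {}el2; subst l1; move: (esym el1) => {}el1; subst l => e3.
rewrite (surjective_pairing (h i (l2 - 1) u)) twistE => /(congr1 snd).
rewrite -[LHS]/(phi i (l2 - 1 - 1 - 1) u) => ->.
rewrite !tkE !h1E -[(h i (l2 - 1) u).1]/((lfst _ _ \o h i (l2 - 1)) u) e3.
rewrite tauC /= linearD; zmod.
Qed.

End TwistComplex.

(** * The twist of a tensor factor is a twist of the tensor product *)

Section TwistTensor.
Variables (P Y T : complex S) (t : forall i j n : int, P i -> Y j -> T n).
Arguments t : clear implicits.
Hypothesis ht : is_total_tensor t.
Variable tau : forall i, {linear P i -> P (i - 1 - 1)}.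
Hypothesis tauC : forall i u,
  diff P (i - 1 - 1) (i - 1 - 1 - 1) (tau i u) = tau (i - 1) (diff P i (i - 1) u).

Lemma tensor_tau : exists tauT : forall n, {linear T n -> T (n - 1 - 1)},
  (forall i j n u v, i + j = n -> tauT n (t i j n u v) = t (i - 1 - 1) j (n - 1 - 1) (tau i u) v) /\
  (forall n u, diff T (n - 1 - 1) (n - 1 - 1 - 1) (tauT n u) = tauT (n - 1) (diff T n (n - 1) u)).
Proof.
have [bil lift ext _] := ht.
have /dchoice[tauT hT] n : exists F : {linear T n -> T (n - 1 - 1)}, forall i j u v,
    i + j = n -> F (t i j n u v) = t (i - 1 - 1) j (n - 1 - 1) (tau i u) v.
  apply: lift => i j hij; have hb := bil (i - 1 - 1) j (n - 1 - 1) ltac:(lia).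
  split=> [v s u u'|u s v v']; first by rewrite linearP hb.1.
  by rewrite hb.2.
exists tauT; split=> [i j n u v|n]; first exact: hT.
apply: (ext n _ (diff T _ _ \o tauT n) (tauT (n - 1) \o diff T _ _)) => i j u v hij.
rewrite -[LHS]/(diff T _ _ (tauT n _)) hT // -[RHS]/(tauT (n - 1) (diff T _ _ _)).
rewrite (@tensor_diff _ _ _ _ _ ht (i - 1 - 1) (i - 1 - 1 - 1) j (j - 1)) //; last by lia.
rewrite (@tensor_diff _ _ _ _ _ ht i (i - 1) j (j - 1)) // linearD linearZ_LR !hT; [|lia..].
by rewrite tauC !sgn_pred opprK.
Qed.

Variable tauT : forall n, {linear T n -> T (n - 1 - 1)}.
Hypothesis tauTE : forall i j n u v, i + j = n ->
  tauT n (t i j n u v) = t (i - 1 - 1) j (n - 1 - 1) (tau i u) v.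
Hypothesis tauTC : forall n u,
  diff T (n - 1 - 1) (n - 1 - 1 - 1) (tauT n u) = tauT (n - 1) (diff T n (n - 1) u).

Definition twist_tens i j n (u : twist tauC i) (v : Y j) : twist tauTC n :=
  (t i j n u.1 v, t (i - 1) j (n - 1) u.2 v).

Lemma twist_total_tensor : is_total_tensor twist_tens.
Proof.
have [bil lift ext _] := ht.
have castE i j (L : lmodType S) (b : forall i j : int, twist tauC i -> Y j -> L) u v :
    b (i - 1 + 1) j (twr tauC _ (castm P (i - 1) (i - 1 + 1 - 1) u)) v = b i j (twr tauC i u) v.
  have : forall i', i' = i -> b i' j (twr tauC _ (castm P (i - 1) (i' - 1) u)) v = b i j (twr tauC i u) v.
    by move=> _ ->; rewrite castm_id.
  by apply; rewrite subrK.
split.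
- move=> i j n hij; have hij' : i - 1 + j = n - 1 by lia.
  split=> [v s u u'|u s v v']; apply: (congr2 pair) => /=.
  + exact: (bil _ _ _ hij).1.
  + exact: (bil _ _ _ hij').1.
  + exact: (bil _ _ _ hij).2.
  + exact: (bil _ _ _ hij').2.
- move=> n L b hb.
  have [|f hf] := lift n L (fun i j u v => b i j (twl tauC i u) v).
    move=> i j hij; split=> [v s u u'|u]; last exact: (hb i j hij).2.
    by rewrite linearP (hb i j hij).1.
  have [|g hg] := lift (n - 1) L (fun i j u v =>
      b (i + 1) j (twr tauC (i + 1) (castm P i (i + 1 - 1) u)) v).
    move=> i j hij; have {}hij : i + 1 + j = n by lia.
    split=> [v s u u'|u]; last exact: (hb _ _ hij).2.
    by rewrite !linearP (hb _ _ hij).1.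
  exists (lcopair f g) => i j u v hij; rewrite -[LHS]/(f _ + g _) hf // hg; last by lia.
  rewrite castE [in RHS](twist_splitE u).
  by have := (hb i j hij).1 v 1 (twl tauC i u.1) (twr tauC i u.2); rewrite !scale1r.
- move=> n L f g hfg w.
  have tw0 i j m (v : Y j) : i + j = m -> t i j m 0 v = 0.
    by move=> /bil[b1 _]; exact: (linear0 (lin_of (b1 v))).
  have h1 : f \o twl tauTC n =1 g \o twl tauTC n.
    apply: (ext n L (f \o twl tauTC n) (g \o twl tauTC n)) => i j u v hij /=.
    have := hfg i j (twl tauC i u) v hij; rewrite /twist_tens /= tw0 //; lia.
  have h2 : f \o twr tauTC n =1 g \o twr tauTC n.
    apply: (ext (n - 1) L (f \o twr tauTC n) (g \o twr tauTC n)) => i j.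
    move: (i + 1) (addrK 1 i) => i2 ei; move: (esym ei) => {}ei; subst i => u v hij /=.
    have hij' : i2 + j = n by lia.
    by have := hfg i2 j (twr tauC i2 u) v hij'; rewrite /twist_tens /= tw0.
  by rewrite (twist_splitE w) !linearD; congr (_ + _); [exact: h1|exact: h2].
- move=> i j n [a b] v hij.
  rewrite [LHS]twistE twistE; apply: (congr2 pair) => /=.
    by rewrite (@tensor_diff _ _ _ _ _ ht i (i - 1) j (j - 1)).
  rewrite (@tensor_diff _ _ _ _ _ ht (i - 1) (i - 1 - 1) j (j - 1) (n - 1) (n - 1 - 1)) //; last by lia.
  rewrite tauTE // sgn_pred scaleNr.
  have -> : t (i - 1 - 1) j (n - 1 - 1) (tau i a - diff P (i - 1) (i - 1 - 1) b) v =
      t (i - 1 - 1) j (n - 1 - 1) (tau i a) v -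
      t (i - 1 - 1) j (n - 1 - 1) (diff P (i - 1) (i - 1 - 1) b) v.
    exact: (linearB (lin_of ((bil (i - 1 - 1) j (n - 1 - 1) ltac:(lia)).1 v))).
  by zmod.
Qed.

End TwistTensor.

End Twist.

(** * Tensor products and reduction modulo [x] *)

Section ReduceTensor.
Variables (R : comPzRingType) (x : R).
Local Notation Rx := (quo [set x]).
Local Notation pi := (@quo_pi R [set x]).

Lemma resm_sign (U : lmodType Rx) (n : nat) (u : resm U) :
  (-1) ^+ n *: u = (-1) ^+ n *: (u : U).
Proof. by rewrite resm_scaleE rmorphXn rmorphN1. Qed.

Lemma red_eq (M : lmodType R) (U : lmodType Rx) (q : {linear M -> resm U}) u v :
  is_red q -> q u = q v -> exists w, u = v + x *: w.
Proof.
move=> [_ qk] e; have [|w hw] := qk (u - v); first by rewrite linearB e subrr.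
by exists w; rewrite -hw addrC subrK.
Qed.

(** Tensoring [L] over [R] with a complex killed by [x] amounts to tensoring its reduction over R/x.
    A bilinear map into [M] takes values in the torsion of [M] because [x] kills [Y], hence it
    descends to an R/x-bilinear map into [torsm x M]. *)
Lemma tensor_red_src (V Y W : complex Rx) (t : forall i j n : int, V i -> Y j -> W n)
    (L : complex R) (r : forall i, {linear L i -> resm (V i)}) :
  is_total_tensor t -> is_redc r ->
  is_total_tensor (X := L) (Y := resc Y) (T := resc W) (fun i j n l y => t i j n (r i l) y).
Proof.
move=> ht hr; have [bil lift ext _] := ht; split.
- move=> i j n /bil[b1 b2]; split=> [v s u u'|u s v v'].
    by rewrite linearP; apply: b1.
  exact: b2.
- move=> n M b hb.
  have bx i j u v w : i + j = n -> b i j (u + x *: w) v = b i j u v.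
    move=> hij; have [b1 b2] := hb i j hij.
    rewrite [u + _]addrC b1.
    have := linearZ_LR (lin_of (b2 w)) x v; rewrite resm_x linear0 /= => <-.
    by rewrite add0r.
  have /dchoice2[b' hb'] i j : exists b' : V i -> Y j -> torsm x M, i + j = n ->
      forall l y, tinc x M (b' (r i l) y) = b i j l y.
    have [hij|nij] := pselect (i + j = n); last by exists (fun _ _ => 0) => /nij.
    have /choice[s hs] := (hr.1 i).1.
    have /choice[f hf] (p : V i * Y j) : exists z, tinc x M z = b i j (s p.1) p.2.
      apply: tors_mem; have := linearZ_LR (lin_of ((hb i j hij).2 (s p.1))) x p.2.
      by rewrite resm_x linear0.
    exists (fun v y => f (v, y)) => _ l y; rewrite hf /=.
    have [w ->] := red_eq (hr.1 i) (hs (r i l)).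
    exact: bx.
  have [|f hf] := lift n (torsm x M) b'.
    move=> i j hij; have hbij := hb' i j hij; split=> [v s u u'|u s v v'].
      have [l <-] := (hr.1 i).1 u; have [l' <-] := (hr.1 i).1 u'.
      rewrite -(quo_reprK s).
      have -> : pi (quo_repr s) *: r i l + r i l' = r i (quo_repr s *: l + l') by rewrite linearP.
      apply: tinc_inj; rewrite hbij.
      have := linearP (tinc x M) (quo_repr s) (b' i j (r i l) v) (b' i j (r i l') v).
      by rewrite !hbij (hb i j hij).1 => ->.
    have [l <-] := (hr.1 i).1 u.
    rewrite -(quo_reprK s); apply: tinc_inj; rewrite hbij.
    have := linearP (tinc x M) (quo_repr s) (b' i j (r i l) v) (b' i j (r i l) v').
    by rewrite !hbij => ->; apply: (hb i j hij).2.
  exists (tinc x M \o resl f) => i j u v hij /=.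
  by rewrite hf // hb'.
- move=> n M f g hfg w.
  have [f' hf'] := tors_lift f; have [g' hg'] := tors_lift g.
  rewrite -hf' -hg'; congr (tinc x M _); apply: (ext n _ f' g') => i j u v hij.
  by have [l <-] := (hr.1 i).1 u; apply: tinc_inj; rewrite hf' hg'; apply: hfg.
- move=> i j n l y hij.
  rewrite hr.2 resm_sign -[LHS]/(diff W n (n - 1) (t i j n (r i l) y)).
  by rewrite (@tensor_diff _ _ _ _ _ ht i (i - 1) j (j - 1)).
Qed.

Lemma tensor_red (P C T : complex R) (P' C' T' : complex Rx)
    (t : forall i j n : int, P i -> C j -> T n)
    (p : forall i, {linear P i -> resm (P' i)}) (c : forall i, {linear C i -> resm (C' i)})
    (q : forall i, {linear T i -> resm (T' i)}) :
  is_total_tensor t -> is_redc p -> is_redc c -> is_redc q ->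
  exists t' : forall i j n : int, P' i -> C' j -> T' n, is_total_tensor t'.
Proof.
move=> ht hp hc hq; have [bil lift ext _] := ht.
have tx i j n u v a b : i + j = n -> q n (t i j n (u + x *: a) (v + x *: b)) = q n (t i j n u v).
  move=> /bil[b1 b2]; rewrite [u + _]addrC b1 linearD linearZ_LR resm_x add0r.
  by rewrite [v + _]addrC b2 linearD linearZ_LR resm_x add0r.
have /dchoice2[t' ht'] i j : exists t' : forall n, P' i -> C' j -> T' n,
    forall n, i + j = n -> forall u v, t' n (p i u) (c j v) = q n (t i j n u v).
  apply: (@dchoice int (fun n => P' i -> C' j -> T' n) (fun n t' => i + j = n ->
    forall u v, t' (p i u) (c j v) = q n (t i j n u v))) => n.
  have [hij|nij] := pselect (i + j = n); last by exists (fun _ _ => 0) => /nij.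
  have /choice[s hs] := (hp.1 i).1; have /choice[r hr] := (hc.1 j).1.
  exists (fun u v => q n (t i j n (s u) (r v))) => _ u v.
  have [a ->] := red_eq (hp.1 i) (hs (p i u)).
  have [b ->] := red_eq (hc.1 j) (hr (c j v)).
  exact: tx.
exists (fun i j n => t' i j n); split.
- move=> i j n hij; have htq := ht' i j n hij; have [b1 b2] := bil i j n hij.
  split=> [v' s u' w'|u' s v' w'].
    have [v <-] := (hc.1 j).1 v'; have [u <-] := (hp.1 i).1 u'; have [w <-] := (hp.1 i).1 w'.
    rewrite -(quo_reprK s).
    have -> : pi (quo_repr s) *: p i u + p i w = p i (quo_repr s *: u + w) by rewrite linearP.
    by rewrite !htq b1 linearP.
  have [u <-] := (hp.1 i).1 u'; have [v <-] := (hc.1 j).1 v'; have [w <-] := (hc.1 j).1 w'.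
  rewrite -(quo_reprK s).
  have -> : pi (quo_repr s) *: c j v + c j w = c j (quo_repr s *: v + w) by rewrite linearP.
  by rewrite !htq b2 linearP.
- move=> n N b hb.
  have [|f hf] := lift n (resm N) (fun i j u v => b i j (p i u) (c j v)).
    move=> i j /hb[b1 b2]; split=> [v s u u'|u s v v']; rewrite linearP.
      exact: b1.
    exact: b2.
  have [g hg] := red_factor f (hq.1 n); exists g => i j u' v' hij.
  have [v <-] := (hc.1 j).1 v'; have [u <-] := (hp.1 i).1 u'.
  by rewrite ht' // hg hf.
- move=> n N f g hfg.
  apply: (red_ext (hq.1 n)).
  apply: (ext n _ (resl f \o q n) (resl g \o q n)) => i j u v hij.
  by rewrite -[LHS]/(f (q n _)) -[RHS]/(g (q n _)) -(ht' i j n hij); apply: hfg.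
- move=> i j n u' v' hij.
  have [v <-] := (hc.1 j).1 v'; have [u <-] := (hp.1 i).1 u'.
  rewrite ht' // -hq.2 -hp.2 -hc.2 !ht'; [|lia..].
  by rewrite (@tensor_diff _ _ _ _ _ ht i (i - 1) j (j - 1)) // linearD linearZ_LR resm_sign.
Qed.

End ReduceTensor.

(** * Lifting a complex along [R -> R/x] *)

Section LiftComplex.
Variables (R : comPzRingType) (x : R).
Hypothesis hx : GRing.lreg x.
Local Notation Rx := (quo [set x]).
Local Notation pi := (@quo_pi R [set x]).
Variables (P : complex Rx) (F : int -> lmodType R) (q : forall i, {linear F i -> resm (P i)}).
Hypotheses (F_proj : forall i, projective_module (F i)) (F_free : forall i, xfree x (F i)).
Hypothesis q_red : forall i, is_red (q i).
Variable D : forall i j, {linear F i -> F j}.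
Hypothesis D_shape : forall i j, j != i - 1 -> forall u, D i j u = 0.
Hypothesis qD : forall i j u, q j (D i j u) = diff (resc P) i j (q i u).

Local Notation L := (cover_cx (X := resc P) D_shape qD).
Local Notation K i := (cover_ker (X := resc P) q i).
Local Notation kinc i := (cover_inc (X := resc P) q i).

Lemma xmul_inj i : injective (xmul x (F i)).
Proof. by apply: lin_inj => u; apply: F_free. Qed.

(** The kernel of [q] is xF, so division by [x] identifies it with [F]. Hence the cover [L] is F_i +
    F_(i-1) in disguise, and its terms are projective. *)
Lemma lift_div_subproof i : exists d : {linear K i -> F i}, forall k, x *: d k = kinc i k.
Proof.
apply: (lin_corestrict (@xmul_inj i)) => k.
have [w ->] := (q_red i).2 _ (p_cover_inc (X := resc P) (p := q) k).
by exists w.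
Qed.
Definition lift_div i := sval (cid (lift_div_subproof i)).
Lemma lift_divE i k : x *: lift_div i k = kinc i k.
Proof. exact: (svalP (cid (lift_div_subproof i))). Qed.

Lemma lift_mul_subproof i : exists s : {linear F i -> K i}, forall a, kinc i (s a) = x *: a.
Proof.
apply: (lin_corestrict (@cover_inc_inj _ (resc P) F q i) (f := xmul x (F i))) => a.
by apply: cover_ker_mem; rewrite red_x.
Qed.
Definition lift_mul i := sval (cid (lift_mul_subproof i)).
Lemma lift_mulE i a : kinc i (lift_mul i a) = x *: a.
Proof. exact: (svalP (cid (lift_mul_subproof i))). Qed.

Lemma lift_ker_projective i : projective_module (K i).
Proof.
move=> M N u f hu; have [g hg] := F_proj (f \o lift_mul i) hu.
exists (g \o lift_div i) => k; rewrite /= hg /=; congr (f _).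
by apply: (@cover_inc_inj _ (resc P) F q i); rewrite lift_mulE lift_divE.
Qed.

Lemma lift_projective i : projective_module (L i).
Proof. by apply: prodm_projective; [apply: F_proj|apply: lift_ker_projective]. Qed.

Lemma lift_sq_subproof i : exists s : {linear F i -> F (i - 1 - 1)},
  forall a, x *: s a = D (i - 1) (i - 1 - 1) (D i (i - 1) a).
Proof.
apply: (lin_corestrict (@xmul_inj _) (f := D (i - 1) (i - 1 - 1) \o D i (i - 1))) => a.
have [|w hw] := (q_red (i - 1 - 1)).2 (D (i - 1) (i - 1 - 1) (D i (i - 1) a)).
  by rewrite !qD diff_sq.
by exists w; rewrite /= hw.
Qed.
Definition lift_sq i := sval (cid (lift_sq_subproof i)).
Lemma lift_sqE i a : x *: lift_sq i a = D (i - 1) (i - 1 - 1) (D i (i - 1) a).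
Proof. exact: (svalP (cid (lift_sq_subproof i))). Qed.

(* The Eisenbud operator: D^2 = x s on the lifts, and tau is -s modulo x. *)
Lemma lift_tau_subproof i : exists tau : {linear P i -> P (i - 1 - 1)},
  forall a, tau (q i a) = - q (i - 1 - 1) (lift_sq i a).
Proof.
pose f : {linear F i -> resm (P (i - 1 - 1))} := (\- q (i - 1 - 1)) \o lift_sq i.
have [tau htau] := red_factor f (q_red i).
by exists tau => a; rewrite htau.
Qed.
Definition lift_tau i := sval (cid (lift_tau_subproof i)).
Lemma lift_tauE i a : lift_tau i (q i a) = - q (i - 1 - 1) (lift_sq i a).
Proof. exact: (svalP (cid (lift_tau_subproof i))). Qed.

Lemma lift_tauC i u :
  diff P (i - 1 - 1) (i - 1 - 1 - 1) (lift_tau i u) = lift_tau (i - 1) (diff P i (i - 1) u).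
Proof.
have [a <-] := (q_red i).1 u.
rewrite lift_tauE diffN.
have e1 : diff P (i - 1 - 1) (i - 1 - 1 - 1) (q _ (lift_sq i a)) =
  q _ (D (i - 1 - 1) (i - 1 - 1 - 1) (lift_sq i a)) by rewrite qD.
have e2 : diff P i (i - 1) (q i a) = q _ (D i (i - 1) a) by rewrite qD.
rewrite e1 e2 lift_tauE; congr (- q _ _).
by apply: (@xmul_inj _); rewrite /= lift_sqE -linearZ_LR lift_sqE.
Qed.

Local Notation V := (twist lift_tauC).

Definition lift_red i : {linear L i -> resm (V i)} :=
  lin_of (lpair_linear (q i \o lfst _ _) (q (i - 1) \o lift_div (i - 1) \o lsnd _ _)).

Lemma lift_redE i a k : lift_red i (a, k) = (q i a, q (i - 1) (lift_div (i - 1) k)).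
Proof. by []. Qed.

(** Writing k = x b, the differential of [L] becomes (a, b) -> (D a + x b, - s a - D b), where D^2 =
    x s. Modulo [x] the term x b disappears and - s becomes [tau], which leaves the differential of
    the twist. *)
Lemma lift_redc : is_redc lift_red.
Proof.
split=> [i|i j u].
  split=> [[a b]|[a k]].
    have [a' ha'] := (q_red i).1 a; have [b' hb'] := (q_red (i - 1)).1 b.
    exists (a', lift_mul (i - 1) b'); rewrite lift_redE ha'; congr pair; rewrite -hb'.
    by congr (q _ _); apply: (@xmul_inj _); rewrite /= lift_divE lift_mulE.
  rewrite lift_redE => -[/(q_red i).2[a' ->] /(q_red (i - 1)).2[b' hb']].
  exists (a', lift_mul (i - 1) b'); apply: (congr2 pair) => //.
  apply: (@cover_inc_inj _ (resc P) F q (i - 1)).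
  by rewrite -lift_divE hb' linearZ_LR lift_mulE.
have [hj|hj] := eqVneq j (i - 1); last by rewrite !diff_shape // linear0.
subst j; case: u => a k; rewrite [diff L _ _ _]cover_cxE lift_redE lift_redE [RHS]twistE.
apply: (congr2 pair).
  by rewrite linearD (p_cover_inc (X := resc P) (p := q)) addr0 qD.
rewrite lift_tauE.
have -> : diff P (i - 1) (i - 1 - 1) (q (i - 1) (lift_div (i - 1) k)) =
  q _ (D (i - 1) (i - 1 - 1) (lift_div (i - 1) k)) by rewrite qD.
rewrite -[RHS]/(- q _ _ - q _ _ : resm (P _)) -linearN -linearB; congr (q _ _).
apply: (@xmul_inj _); rewrite /= lift_divE cover_d2E /= scalerBr scalerN lift_sqE.
by rewrite -linearZ_LR lift_divE.
Qed.

Lemma lift_qiso : quasi_iso (cover_map (X := resc P) D_shape qD).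
Proof. by apply: cover_qiso => i; apply: (q_red i).1. Qed.

(* The homotopy is s (a, k) = (0, x a). *)
Lemma lift_homotopy : exists s : forall i j, {linear L i -> L j},
  forall i j k l, j = i -> k = i - 1 -> l = i + 1 -> forall u : L i,
    x *: castm L i j u = diff L l j (s i l u) + s k j (diff L i k u).
Proof.
have [s hs] := fam_shift_src (A := L) (M := L)
  (fun i j => castm L i j \o (lpair \0 (lift_mul (i - 1) \o lfst _ _) : {linear L (i - 1) -> L i})).
have hs' i (u : L (i - 1)) : s (i - 1) i u = (0, lift_mul (i - 1) u.1).
  by rewrite hs /= castm_id.
exists s => i j k l hj hk hl u; subst j k.
have hi : i = l - 1 by lia.
clear hl; subst i; rewrite castm_id !hs'; case: u => a k.
rewrite [diff L l _ _]cover_cxE [diff L (l - 1) _ _]cover_cxE.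
apply: (congr2 pair); first by rewrite /= linear0 lift_mulE add0r addr0.
apply: (@cover_inc_inj _ (resc P) F q _).
rewrite -[RHS]/(kinc (l - 1 - 1) (_ + lift_mul (l - 1 - 1) _)).
rewrite linearD cover_d2E lift_mulE /= lift_mulE !linear0 linearZ_LR scalerDr linearZ_LR.
by zmod.
Qed.

(** The twist is K-projective over R/x, so a map to a torsion-free acyclic complex can be contracted
    after reduction. The two steps that remain are to lift the contraction and to absorb the
    multiple of [x] by which it fails. *)
Lemma lift_K_projective : K_projective P -> K_projective L.
Proof.
move=> hP.
have hV : K_projective V.
  apply: K_projective_hom_zero => A A0.
  by apply: hom_zero_twist; apply: K_projective_hom.
(* Torsion-free targets suffice: a general [A] is covered by free modules, and [f] lifts strictly to
   the cover. *)
suff hC (C : complex R) (f : chain_map L C) : (forall i, xfree x (C i)) -> acyclic C -> null_homotopic f.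
  move=> A f A0.
  pose B i : lmodType R := freem R (A i).
  have /dchoice[p hp] i : exists p : {linear B i -> A i}, forall b, p (delta b) = b :=
    freem_lift (fun a : A i => a).
  have p_surj i v : exists u, p i u = v by exists (delta v).
  have [E [E_shape pE]] := cover_diff_exists (fun i => @freem_projective R (A i)) p_surj.
  have qE := cover_qiso p_surj E_shape pE.
  have [g hg] := cover_lift p_surj E_shape pE f lift_projective.
  have [||h hh] := hC _ g.
  - move=> i [a k] /prodm_eq0[a0 k0]; apply/prodm_eq0; split.
      by apply: (freem_reg hx); rewrite a0 scaler0.
    apply: (@cover_inc_inj _ A B p _); apply: (freem_reg hx).
    by rewrite linear0 scaler0 -linearZ_LR k0 linear0.
  - by move=> i; apply: (qiso_homology qE i).2.
  exists (fun i j => cover_map E_shape pE j \o h i j) => i u.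
  by rewrite -hg hh linearD; congr (_ + _); exact: cmap_comm.
move=> Cfree C0.
have hq := quoc_red x C.
have C'0 : acyclic (quoc x C) := red_acyclic hq Cfree C0.
have /dchoice[f' hf'] i : exists f' : {linear V i -> quom x (C i)},
    forall u, f' (lift_red i u) = quom_proj x (C i) (f i u).
  exact: (red_factor (quom_proj x (C i) \o f i) (lift_redc.1 i)).
have f'C i j u : j = i - 1 -> f' j (diff V i j u) = diff (quoc x C) i j (f' i u).
  move=> hj; have [v <-] := (lift_redc.1 i).1 u.
  by rewrite -lift_redc.2 !hf' -hq.2 cmap_comm.
have [h' hh'] := hV _ (mk_chain_map (Y := quoc x C) f'C) C'0.
have /dchoice2[h hh] i j : exists h : {linear L i -> C j},
    forall u, quom_proj x (C j) (h u) = h' i j (lift_red i u).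
  apply: (projective_lift (d := quom_proj x (C j)) (f := resl (h' i j) \o lift_red i)).
    exact: lift_projective.
  by move=> u; apply: (hq.1 j).1.
have Cinj i : injective (xmul x (C i)) by apply: lin_inj => u; apply: Cfree.
(* The lifted contraction [h] is correct modulo [x], so [f] minus its boundary is [x g]; [g] is
   again a chain map because [C] has no torsion. *)
have /dchoice[g hg] i : exists g : {linear L i -> C i}, forall u,
    x *: g u = f i u - (diff C (i + 1) i (h i (i + 1) u) + h (i - 1) i (diff L i (i - 1) u)).
  have [|g hg] := lin_corestrict (@Cinj i) (f := f i \-
      ((diff C (i + 1) i \o h i (i + 1)) \+ (h (i - 1) i \o diff L i (i - 1)))).
    move=> u.
    have [|w hw] := (hq.1 i).2 (f i u - (diff C (i + 1) i (h i (i + 1) u) +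
        h (i - 1) i (diff L i (i - 1) u))); last by exists w.
    rewrite linearB linearD hq.2 !hh -hf' lift_redc.2.
    by have /= -> := hh' i (lift_red i u); rewrite subrr.
  by exists g => u; rewrite -[LHS]/(xmul x (C i) (g u)) hg.
have gC i j u : j = i - 1 -> g j (diff L i j u) = diff C i j (g i u).
  move=> hj; subst j; apply: (@Cinj _) => /=.
  rewrite -diffZ !hg diffB diffD !diff_sq linear0 cmap_comm.
  by rewrite subrK addr0 add0r.
(* As [s] contracts multiplication by [x] on [L], the family [g s] contracts [x g]. *)
have [s hs] := lift_homotopy.
exists (fun i j => h i j \+ (g j \o s i j)) => i u.
have xu : x *: u = diff L (i + 1) i (s i (i + 1) u) + s (i - 1) i (diff L i (i - 1) u).
  by rewrite -(hs i i (i - 1) (i + 1)) // castm_id.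
have -> : f i u = x *: g i u + (diff C (i + 1) i (h i (i + 1) u) + h (i - 1) i (diff L i (i - 1) u)).
  by rewrite hg subrK.
rewrite -linearZ_LR xu linearD gC ?addrK // -[RHS]/(diff C _ _ (_ + g _ _) + (_ + g _ _)) diffD.
by zmod.
Qed.

End LiftComplex.

(** * Free resolutions, homotopy retracts, liftable modules *)

Section FreeResolution.
Variables (S : comPzRingType) (F : lmodType S -> lmodType S) (e : forall M, {linear F M -> M}).
Hypotheses (e_surj : forall M v, exists u, e M u = v) (F_proj : forall M, projective_module (F M)).
Variable M : lmodType S.

Fixpoint syz (n : nat) : lmodType S :=
  if n is n'.+1 then smod (ker_subm (e (syz n'))) else M.
Definition fres_nat (n : nat) : lmodType S := F (syz n).

Lemma fres_step n : exists d : {linear fres_nat n.+1 -> fres_nat n},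
  (forall u, d u = 0 <-> e (syz n.+1) u = 0) /\
  (forall u, e (syz n) u = 0 <-> exists v, d v = u).
Proof.
exists (sinc (ker_subm (e (syz n))) \o e (syz n.+1)); split=> u.
  split=> [|u0]; last by rewrite -[LHS]/(sinc _ (e _ u)) u0 linear0.
  by rewrite -(linear0 (sinc (ker_subm (e (syz n))))) => /sinc_inj.
split=> [/(@sinc_mem _ _ (ker_subm (e (syz n))))[k hk]|[v <-]].
  by have [v hv] := e_surj k; exists v; rewrite -hk -hv.
exact: (sincP (e (syz n.+1) v)).
Qed.
Definition fres_dn n := sval (cid (fres_step n)).
Lemma fres_dn_eq0 n u : fres_dn n u = 0 <-> e (syz n.+1) u = 0.
Proof. exact: (svalP (cid (fres_step n))).1. Qed.
Lemma fres_dn_range n u : e (syz n) u = 0 <-> exists v, fres_dn n v = u.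
Proof. exact: (svalP (cid (fres_step n))).2. Qed.

Lemma fres_dn_exact n u : fres_dn n u = 0 <-> exists v, fres_dn n.+1 v = u.
Proof. by rewrite fres_dn_eq0 fres_dn_range. Qed.

Definition fres_mod (i : int) : lmodType S := ext0m fres_nat i.
Definition fres_d (i j : int) : {linear fres_mod i -> fres_mod j} :=
  match i, j with
  | Posz n.+1, Posz n' => castm fres_nat n n' \o fres_dn n
  | _, _ => \0
  end.

Lemma fres_shape i j : j != i - 1 -> forall u, fres_d i j u = 0.
Proof.
case: i j => [[|n]|n] [n'|n'] ji u //.
rewrite -[LHS]/(castm fres_nat n n' (fres_dn n u)) castm_neq // => en.
by move/eqP: ji; apply; lia.
Qed.

Lemma fres_sq i j k u : fres_d j k (fres_d i j u) = 0.
Proof.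
case: i j k u => [[|n]|n] [[|n']|n'] [n''|n''] u; try exact: linear0.
all: try by [].
rewrite -[LHS]/(castm fres_nat n' n'' (fres_dn n' (castm fres_nat n n'.+1 (fres_dn n u)))).
have [en|/eqP en] := eqVneq n n'.+1; last by rewrite [castm _ n _ _]castm_neq ?linear0.
have -> : fres_dn n' (castm fres_nat n n'.+1 (fres_dn n u)) = 0; last exact: linear0.
by subst n; rewrite castm_id; apply/fres_dn_exact; exists u.
Qed.

(** The choice [F] of projective covers is a parameter: over R/x it will be the reduction of a free
    R-module, so that the terms of the resolution lift to [R]. *)
Definition fres : complex S := @Complex S fres_mod fres_d fres_shape fres_sq.

Lemma fres_neg i (u : fres i) : i < 0 -> u = 0.
Proof. by case: i u => // n u _; apply: zerom_eq0. Qed.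

Lemma zerom_projective : projective_module (zerom S).
Proof.
by move=> A B u f _; exists \0 => a; rewrite linear0 (zerom_eq0 a) linear0.
Qed.

Lemma fres_projective i : projective_module (fres i).
Proof. by case: i => n; [exact: F_proj|exact: zerom_projective]. Qed.

Lemma fres_K_projective : K_projective fres.
Proof.
apply: K_projective_hom_zero => A A0; apply: (@bounded_projective _ _ _ 0).
- exact: fres_projective.
- by move=> i u; apply: fres_neg.
- by move=> i _; apply: A0.
Qed.

Definition fres_aug (i : int) : {linear fres i -> stalk M i} :=
  match i return {linear fres_mod i -> stalk_mod M i} with
  | Posz 0 => e M
  | _ => \0
  end.

Lemma fres_aug_comm i j u : j = i - 1 ->
  fres_aug j (diff fres i j u) = diff (stalk M) i j (fres_aug i u).
Proof.
case: i j u => [[|[|n]]|n] [[|n']|n'] u //= hj; try by rewrite ?linear0.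
by rewrite -[LHS]/(e M (castm fres_nat 0 0 (fres_dn 0 u))) castm_id; apply: (iffRL (@fres_dn_range 0 _)); exists u.
Qed.

Lemma fres_aug_qiso : quasi_iso (mk_chain_map fres_aug_comm).
Proof.
apply/quasi_isoP => l k m hl hm.
have [k0|k0] := ltP k 0.
  split=> [u _ _|v _]; first by exists 0; rewrite linear0 (fres_neg u).
  exists 0; rewrite linear0; split=> //; exists 0; rewrite linear0.
  have kn : k != 0 by apply/eqP; lia.
  by rewrite (stalk_eq0 v kn) cmap0 subrr.
case: k k0 => // k _ in hl hm *.
have {hl}hl : l = k.+1 by lia.
subst l m; split=> [u|v _].
  case: k u => [|k] u.
    move=> _ [w hw]; have [|v hv] := (fres_dn_range (n := 0) u).1; first by rewrite -[LHS]/(fres_aug 0 u) [LHS]hw.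
    exists v; rewrite -hv -[LHS]/(castm fres_nat 0 0 (fres_dn 0 v)).
    by rewrite castm_id.
  have -> : k.+1%:Z - 1 = k%:Z by lia.
  rewrite -[X in X = _ -> _]/(castm fres_nat k k (fres_dn k u)) castm_id => /fres_dn_exact[v <-] _.
  by exists v; rewrite -[LHS]/(castm fres_nat k.+1 k.+1 (fres_dn k.+1 v)) castm_id.
case: k v => [|k] v.
  have [u hu] := @e_surj M v; exists u; split=> //.
  by exists 0; rewrite linear0 -[X in X - _]/(e M u) hu subrr.
exists 0; rewrite linear0; split=> //; exists 0.
have kn : k.+1%:Z != 0 by [].
by rewrite (stalk_eq0 v kn) linear0 cmap0 subrr.
Qed.

End FreeResolution.

(** * Homotopy retracts *)

Section Retract.
Variables (S : comPzRingType) (P Q : complex S) (f : chain_map P Q) (g : chain_map Q P).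
Variable k : forall i j, {linear Q i -> Q j}.
Hypothesis gf : forall i u, g i (f i u) = u.
Hypothesis hk : forall i j l (u : Q i), j = i - 1 -> l = i + 1 ->
  u - f i (g i u) = diff Q l i (k i l u) + k j i (diff Q i j u).

Lemma retract_qiso : quasi_iso g.
Proof.
apply/quasi_isoP => l i j hl hj; split=> [u u0 [w hw]|v v0].
  exists (k i l u + f l w).
  have := hk u hj hl; rewrite u0 linear0 addr0 => e.
  by rewrite diffD -e -cmap_comm -hw subrK.
exists (f i v); split; first by rewrite -cmap_comm v0 linear0.
by exists 0; rewrite gf subrr linear0.
Qed.

Lemma retract_K_projective : K_projective P -> K_projective Q.
Proof.
move=> hP A h A0; have [s hs] := hP A (comp_map h f) A0.
exists (fun i j => (s i j \o g i) \+ (h j \o k i j)) => i u /=.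
rewrite -{1}(subrK (f i (g i u)) u) linearD (hk u erefl erefl).
have /= -> := hs i (g i u).
by rewrite -cmap_comm linearD diffD !cmap_comm; zmod.
Qed.

End Retract.

Section TensorLeft.
Variables (S : comPzRingType) (P Q Y T U : complex S).
Variables (t : forall i j n : int, P i -> Y j -> T n) (t2 : forall i j n : int, Q i -> Y j -> U n).
Arguments t : clear implicits.
Arguments t2 : clear implicits.
Hypotheses (ht : is_total_tensor t) (ht2 : is_total_tensor t2).

Lemma tensor_chain_map_l (f : chain_map P Q) : exists F : chain_map T U,
  forall i j n u v, i + j = n -> F n (t i j n u v) = t2 i j n (f i u) v.
Proof.
have /dchoice[F hF] n : exists F : {linear T n -> U n},
    forall i j u v, i + j = n -> F (t i j n u v) = t2 i j n (f i u) v.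
  have [|F hF] := @tensor_map _ _ _ _ _ _ _ _ _ ht ht2 0
      (fun i i' => castm Q i i' \o f i) (fun j => idfun) n n; first by rewrite addr0.
  exists F => i j u v hij; rewrite (hF i i) ?addr0 //=.
  by rewrite castm_id.
have Fc n n' w : n' = n - 1 -> F n' (diff T n n' w) = diff U n n' (F n w).
  move=> hn; have [_ _ ext _] := ht; move: w.
  apply: (ext _ _ (F n' \o diff T n n') (diff U n n' \o F n)) => i j u v hij /=.
  rewrite (@tensor_diff _ _ _ _ _ ht i (i - 1) j (j - 1)) // linearD linearZ_LR !hF; [|lia..].
  by rewrite (@tensor_diff _ _ _ _ _ ht2 i (i - 1) j (j - 1)) // cmap_comm.
by exists (mk_chain_map Fc) => i j n u v; apply: hF.
Qed.
End TensorLeft.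

(** The maps and the homotopy are tensored with the identity of [Y]. The terms containing the
    differential of [Y] cancel in the homotopy formula, because [k] raises the left degree by
    one. *)
Lemma retract_tensor (S : comPzRingType) (P Q : complex S) (f : chain_map P Q) (g : chain_map Q P)
    (k : forall i j, {linear Q i -> Q j}) (Y T U : complex S)
    (t : forall i j n : int, P i -> Y j -> T n) (t2 : forall i j n : int, Q i -> Y j -> U n) :
  (forall i u, g i (f i u) = u) ->
  (forall i j l (u : Q i), j = i - 1 -> l = i + 1 ->
    u - f i (g i u) = diff Q l i (k i l u) + k j i (diff Q i j u)) ->
  is_total_tensor t -> is_total_tensor t2 -> exists F : chain_map U T, quasi_iso F.
Proof.
move=> gf hk ht ht2.
have [F hF] := tensor_chain_map_l ht ht2 f.
have [G hG] := tensor_chain_map_l ht2 ht g.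
have /dchoice2[K hK] n n' : exists K : {linear U n -> U n'}, n' = n + 1 -> forall i i' j u v,
    i + j = n -> i' = i + 1 -> K (t2 i j n u v) = t2 i' j n' (k i i' u) v.
  have [hn|hn] := pselect (n' = n + 1); last by exists \0 => /hn.
  have [K hK] := @tensor_map _ _ _ _ _ _ _ _ _ ht2 ht2 1 k (fun j => idfun) n n' hn.
  by exists K => _ i i' j u v; apply: hK.
exists G; apply: (retract_qiso (f := F) (k := K)) => [n|n m l w hm hl].
  have [_ _ ext _] := ht; apply: (ext _ _ (G n \o F n) idfun) => i j u v hij /=.
  by rewrite hF // hG // gf.
have [bil _ ext _] := ht2; move: w.
apply: (ext _ _ (idfun \- (F n \o G n)) ((diff U l n \o K n l) \+ (K m n \o diff U n m))) => i j u v hij /=.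
have [b1 _] := bil i j n hij.
rewrite hG // hF // (hK n l hl i (i + 1)) //.
rewrite (@tensor_diff _ _ _ _ _ ht2 (i + 1) i j (j - 1)) ?addrK //; [|lia..].
rewrite (@tensor_diff _ _ _ _ _ ht2 i (i - 1) j (j - 1)) // linearD linearZ_LR.
have hn : n = m + 1 by lia.
rewrite (hK m n hn (i - 1) i) ?subrK //; last by lia.
rewrite (hK m n hn i (i + 1)) //; last by lia.
have := sgn_pred S (i + 1); rewrite addrK => ->.
rewrite -[LHS]/(lin_of (b1 v) u - lin_of (b1 v) (f i (g i u))) -linearB (hk i (i - 1) (i + 1)) // linearD /=.
by rewrite scaleNr; zmod.
Qed.

(** * Modules over R/x that lift to projective R-modules *)

Section Liftable.
Variables (R : comPzRingType) (x : R).
Hypothesis hx : GRing.lreg x.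
Local Notation Rx := (quo [set x]).
Implicit Types U V : lmodType Rx.

Definition liftable U : Prop := exists (M : lmodType R) (q : {linear M -> resm U}),
  [/\ projective_module M, xfree x M & is_red q].

Lemma quom_projective (M : lmodType R) : projective_module M -> projective_module (quom x M).
Proof.
move=> hM A B u f hu.
have [g hg] := hM _ _ (resl u) (resl f \o quom_proj x M) hu.
have [h hh] := red_factor g (quom_red x M); exists h.
by apply: (@red_ext _ _ _ _ (quom_proj x M) _ (u \o h) f (quom_red x M)) => v /=; rewrite hh hg.
Qed.

Lemma xfree_freem (B : choiceType) : xfree x (freem R B).
Proof. by move=> u hu; apply: (freem_reg hx); rewrite hu scaler0. Qed.

Lemma liftable_freem (B : choiceType) : liftable (quom x (freem R B)).
Proof.
exists (freem R B), (quom_proj x _); split; [exact: freem_projective|exact: xfree_freem|exact: quom_red].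
Qed.

Lemma liftable_prodm U V : liftable U -> liftable V -> liftable (prodm U V).
Proof.
move=> [M [p [hM Mf [p1 p2]]]] [N [q [hN Nf [q1 q2]]]].
exists (prodm M N), (lin_of (lpair_linear (p \o lfst _ _) (q \o lsnd _ _)) : {linear prodm M N -> resm (prodm U V)}); split.
- exact: prodm_projective.
- by move=> [a b] /prodm_eq0[a0 b0]; apply/prodm_eq0; split; [exact: Mf|exact: Nf].
- split=> [[a b]|[a b]].
    have [a' <-] := p1 a; have [b' <-] := q1 b; by exists (a', b').
  by rewrite -[LHS]/(p a, q b) => -[/p2[a' ->] /q2[b' ->]]; exists (a', b').
Qed.

Lemma lift_exists (P : complex Rx) :
  (forall i, liftable (P i)) -> K_projective P ->
  exists (L : complex R) (tau : forall i, {linear P i -> P (i - 1 - 1)})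
    (tauC : forall i u, diff P (i - 1 - 1) (i - 1 - 1 - 1) (tau i u) = tau (i - 1) (diff P i (i - 1) u))
    (r : forall i, {linear L i -> resm (twist tauC i)}) (f : chain_map L (resc P)),
  [/\ is_redc r, quasi_iso f, forall i, projective_module (L i), K_projective L &
      (forall i (u : P i), i < 0 -> u = 0) -> forall i (u : L i), i < 0 -> u = 0].
Proof.
move=> hP KP.
have /dchoice[F hF] i : exists Fq : {F : lmodType R & {linear F -> resm (P i)}},
    [/\ projective_module (projT1 Fq), xfree x (projT1 Fq), is_red (projT2 Fq) &
     (forall u : P i, u = 0) -> forall u : projT1 Fq, u = 0].
  (* Where P_i is zero the zero lift is chosen, so that [L] vanishes in negative degrees whenever
     [P] does. *)
  have [P0|nP0] := pselect (forall u : P i, u = 0).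
    exists (existT _ (zerom R) (\0 : {linear zerom R -> resm (P i)})); split=> //=.
    - exact: zerom_projective.
    - by move=> u _; apply: zerom_eq0.
    - split=> [v|u _]; first by exists 0; rewrite linear0 (P0 v).
      by exists 0; rewrite scaler0; apply: zerom_eq0.
    - by move=> _ u; apply: zerom_eq0.
  by have [M [q [h1 h2 h3]]] := hP i; exists (existT _ M q); split.
pose Fm i := projT1 (F i); pose q i : {linear Fm i -> resm (P i)} := projT2 (F i).
have F_proj i : projective_module (Fm i) by have [] := hF i.
have F_free i : xfree x (Fm i) by have [] := hF i.
have q_red i : is_red (q i) by have [] := hF i.
have [D [D_shape qD]] := cover_diff_exists (X := resc P) F_proj (fun i => (q_red i).1).
exists (cover_cx (X := resc P) D_shape qD), (lift_tau F_free q_red qD), (lift_tauC F_free q_red qD).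
exists (lift_red F_free q_red D_shape qD), (cover_map (X := resc P) D_shape qD); split.
- exact: lift_redc.
- exact: lift_qiso.
- exact: lift_projective.
- exact: lift_K_projective.
- move=> P0 i [a k] i0.
  have F0 j : j < 0 -> forall u : Fm j, u = 0.
    by move=> j0; have [_ _ _] := hF j; apply => u; apply: P0.
  apply/prodm_eq0; split; first exact: F0.
  apply: (@cover_inc_inj _ (resc P) Fm q); rewrite linear0; apply: F0; lia.
Qed.

End Liftable.

(** * The Eilenberg swindle *)

Section Swindle.
Variables (R : comPzRingType) (x : R).
Hypothesis hx : GRing.lreg x.
Local Notation Rx := (quo [set x]).

Section QuoFree.
Variables (B : choiceType) (V : lmodType Rx).
Definition qdelta (b : B) : quom x (freem R B) := quom_proj x _ (delta b).

Lemma qfree_lift (g : B -> V) :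
  exists f : {linear quom x (freem R B) -> V}, forall b, f (qdelta b) = g b.
Proof.
have [f hf] := freem_lift (M := resm V) g.
have [h hh] := red_factor f (quom_red x (freem R B)).
by exists h => b; rewrite hh hf.
Qed.

Lemma qfree_ext (f g : {linear quom x (freem R B) -> V}) :
  (forall b, f (qdelta b) = g (qdelta b)) -> f =1 g.
Proof.
move=> h; apply: (red_ext (quom_red x (freem R B))).
exact: (freem_ext (f := resl f \o quom_proj x _) (g := resl g \o quom_proj x _)).
Qed.
End QuoFree.

(* With p : F -> P split by s, F^(oo) = P (+) ker p (+) P (+) ker p (+) ... absorbs a further
   copy of P on the left. *)
Lemma eilenberg_swindle (B : choiceType) (P : lmodType Rx) (p : {linear quom x (freem R B) -> P}) :
  (forall v, exists u, p u = v) -> projective_module P ->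
  liftable (prodm P (quom x (freem R (B * nat)%type))).
Proof.
move=> p_surj hP; set E := quom x (freem R B) in p p_surj *.
set H := quom x _; pose h (b : B) (n : nat) : H := qdelta (b, n).
have [s ps] := hP _ _ p idfun p_surj.
have [e eE] : exists e : {linear E -> E}, forall w, e w = s (p w) by exists (s \o p).
have ee w : e (w - e w) = 0 by rewrite linearB !eE ps subrr.
have pe w : p (w - e w) = 0 by rewrite linearB eE ps subrr.
have eew w : e (e w) = e w by rewrite !eE ps.
have es v : e (s v) = s v by rewrite eE ps.
have /dchoice[io hio] (n : nat) : exists f : {linear E -> H}, forall b, f (qdelta b) = h b n.
  exact: qfree_lift.
(* The idempotent [e] projects each copy of [E] onto [P]. The map [al] moves the [P]-part of every
   copy one place to the left, that of copy 0 going to the extra summand [P]; [be] moves everything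
   back to the right. *)
have [al hal] := @qfree_lift (B * nat)%type (prodm P H) (fun bn =>
  if bn.2 is n.+1 then (0, io n.+1 (qdelta bn.1 - e (qdelta bn.1)) + io n (e (qdelta bn.1)))
  else (p (qdelta bn.1), io 0%N (qdelta bn.1 - e (qdelta bn.1)))).
have al0 w : al (io 0%N w) = (p w, io 0%N (w - e w)).
  apply: (@qfree_ext B _ (al \o io 0%N)
    (lin_of (lpair_linear p (io 0%N \o (idfun \- e)))) _ w) => b.
  by rewrite /= hio hal.
have alS n w : al (io n.+1 w) = (0, io n.+1 (w - e w) + io n (e w)).
  apply: (@qfree_ext B _ (al \o io n.+1)
    (lin_of (lpair_linear \0 ((io n.+1 \o (idfun \- e)) \+ (io n \o e)))) _ w) => b.
  by rewrite /= hio hal.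
have [be0 hbe0] := @qfree_lift (B * nat)%type H (fun bn =>
  io bn.2 (qdelta bn.1 - e (qdelta bn.1)) + io bn.2.+1 (e (qdelta bn.1))).
have be0E n w : be0 (io n w) = io n (w - e w) + io n.+1 (e w).
  apply: (@qfree_ext B _ (be0 \o io n) ((io n \o (idfun \- e)) \+ (io n.+1 \o e)) _ w) => b.
  by rewrite /= hio hbe0.
pose be : {linear prodm P H -> H} := lcopair (io 0%N \o s) be0.
have beE u v : be (u, v) = io 0%N (s u) + be0 v by [].
clearbody be.
have Hext (V : lmodType Rx) (f g : {linear H -> V}) :
    (forall n w, f (io n w) = g (io n w)) -> f =1 g.
  by move=> hfg; apply: qfree_ext => -[b n]; rewrite -/(h b n) -hio.
have bal w : be (al w) = w.
  apply: (Hext H (be \o al) idfun) => n {}w.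
  change (be (al (io n w)) = io n w); case: n => [|n].
    by rewrite al0 beE be0E -eE ee subr0 !linear0 addr0 -linearD addrC subrK.
  rewrite alS beE [s 0]linear0 [io 0%N 0]linear0 add0r [be0 (_ + _)]linearD !be0E ee eew.
  by rewrite subrr subr0 !linear0 addr0 add0r -linearD subrK.
have alb0 v : al (be0 v) = (0, v).
  apply: (Hext (prodm P H) (al \o be0) (lin_of (lpair_linear \0 idfun))) => n w.
  change (al (be0 (io n w)) = (0, io n w)).
  rewrite be0E [al (_ + _)]linearD; case: n => [|n].
    rewrite al0 alS ee pe eew subrr subr0 linear0 add0r; apply: (congr2 pair); rewrite ?addr0 //.
    by rewrite /= -linearD subrK.
  rewrite !alS ee eew subrr subr0 !linear0 add0r addr0; apply: (congr2 pair); rewrite ?addr0 //.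
  by rewrite /= -linearD subrK.
(* Since [al] is bijective, the free module reducing to [H] is also a lift of [P] plus [H]. *)
exists (freem R (B * nat)%type), (resl al \o quom_proj x _).
split; [exact: freem_projective|exact: xfree_freem|split=> [[u v]|u]].
  have [w hw] := (quom_red x (freem R (B * nat)%type)).1 (be (u, v)).
  exists w; change (al (quom_proj x _ w) = (u, v)).
  rewrite hw beE [al (_ + _)]linearD alb0 al0 ps es subrr linear0.
  by apply: (congr2 pair); rewrite /= ?addr0 ?add0r.
move=> /(congr1 be); change (be (al (quom_proj x _ u)) = be 0 -> exists w, u = x *: w).
by rewrite bal [be 0]linear0 => /(quom_red x _).2.
Qed.

(** Two copies of [H] are added in each degree, and the differential sends the last copy in degree
    [i] identically to the middle copy in degree [i - 1]. The added part is contractible, and each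
    P_i has a copy of [H] at hand for the swindle. *)
Lemma liftable_retract (P : complex Rx) : (forall i, projective_module (P i)) ->
  exists (Q : complex Rx) (f : chain_map P Q) (g : chain_map Q P)
      (k : forall i j, {linear Q i -> Q j}),
    [/\ forall i, liftable (Q i), forall i u, g i (f i u) = u &
      forall i j l (u : Q i), j = i - 1 -> l = i + 1 ->
        u - f i (g i u) = diff Q l i (k i l u) + k j i (diff Q i j u)].
Proof.
move=> hP; pose B : choiceType := Choice.clone {i : int & P i} _.
pose E := quom x (freem R B); pose H := quom x (freem R (B * nat)%type).
(* [B] collects the elements of all degrees; those of a degree other than [i] are sent to zero, so a
   single free module covers every P_i. *)
have /dchoice[p hp] i : exists p : {linear E -> P i}, forall v, exists u, p u = v.
  have [p hp] := @qfree_lift B (P i) (fun b => castm P (projT1 b) i (projT2 b)).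
  by exists p => v; exists (qdelta (existT _ i v : B)); rewrite hp /= castm_id.
have HP i : liftable (prodm (P i) H) := eilenberg_swindle (hp i) (hP i).
pose Qm i := prodm (prodm (P i) H) H.
pose d i j : {linear Qm i -> Qm j} := lin_of (lpair_linear (lin_of (lpair_linear
  (diff P i j \o lfst _ _ \o lfst _ _) (castm (fun=> H) (i - 1) j \o lsnd _ _))) \0).
have dE i a b c : d i (i - 1) ((a, b), c) = ((diff P i (i - 1) a, c), 0).
  by rewrite /= castm_id.
have d_shape i j : j != i - 1 -> forall u, d i j u = 0.
  move=> ji u; rewrite /= diff_shape // castm_neq // => e.
  by rewrite e eqxx in ji.
have d_sq i j k u : d j k (d i j u) = 0.
  have [hj|/d_shape->] := eqVneq j (i - 1); last by rewrite linear0.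
  have [hk|/d_shape-> //] := eqVneq k (j - 1).
  by subst k j; case: u => [[a b] c]; rewrite !dE diff_sq.
pose Q := @Complex Rx Qm d d_shape d_sq.
pose f i : {linear P i -> Q i} := lin_of (lpair_linear (lin_of (lpair_linear idfun \0)) \0).
pose g i : {linear Q i -> P i} := lfst _ _ \o lfst _ _.
have fC i j u : j = i - 1 -> f j (diff P i j u) = diff Q i j (f i u).
  by move=> ->; rewrite [RHS]dE.
have gC i j u : j = i - 1 -> g j (diff Q i j u) = diff P i j (g i u).
  by move=> ->; case: u => [[a b] c]; rewrite [diff Q _ _ _]dE.
exists Q, (mk_chain_map (Y := Q) fC), (mk_chain_map (X := Q) gC).
pose k i j : {linear Q i -> Q j} := lin_of (lpair_linear \0 (lsnd _ _ \o lfst _ _)).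
exists k; split=> [i|i u|i j l u hj hl].
- by apply: liftable_prodm; [exact: HP|exact: liftable_freem].
- by [].
subst j; have {hl}hi : i = l - 1 by lia.
subst i; case: u => [[a b] c].
rewrite [diff Q l _ _]dE [diff Q _ _ _]dE [diff P l _ 0]linear0.
change ((a - a, b - 0, c - 0) = (0 + 0, b + 0, 0 + c) :> Q (l - 1)).
by rewrite subrr !subr0 !addr0 add0r.
Qed.

End Swindle.

(** * Comparison of depths *)

Lemma iso_qiso (S : comPzRingType) (X Y : complex S) (f : chain_map X Y) :
  (forall i, injective (f i)) -> (forall i v, exists u, f i u = v) -> quasi_iso f.
Proof.
move=> f_inj f_surj; apply/quasi_isoP => l k m hl hm; split=> [u _ [w hw]|v v0].
  have [w' hw'] := f_surj l w; exists w'.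
  by apply: (f_inj k); rewrite cmap_comm hw' hw.
have [u hu] := f_surj k v; exists u; split.
  by apply: (f_inj m); rewrite cmap_comm hu v0 linear0.
by exists 0; rewrite hu subrr linear0.
Qed.

Lemma quo_pi_ideal (S : comPzRingType) (I : set S) (r : S) :
  is_ideal I -> quo_pi I r = 0 <-> I r.
Proof.
move=> II; rewrite -(rmorph0 (@quo_pi S I)) quo_pi_eq subr0.
by split=> [h|Ir J [_ IJ]]; [apply: h; split=> // ?|exact: IJ].
Qed.

Section DepthChange.
Variables (R : comPzRingType) (x : R).
Hypothesis hx : GRing.lreg x.
Local Notation Rx := (quo [set x]).
Local Notation pi := (@quo_pi R [set x]).
Variable m : set R.
Hypotheses (m_ideal : is_ideal m) (xm : m x).
Local Notation n := (pi @` m).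

Lemma quo_ideal : is_ideal n.
Proof.
have [m0 mD mM] := m_ideal; split.
- by exists 0; rewrite ?rmorph0.
- by move=> _ _ [a ma <-] [b mb <-]; exists (a + b); [exact: mD|rewrite rmorphD].
- move=> s _ [a ma <-]; exists (quo_repr s * a); first exact: mM.
  by rewrite -[in RHS](quo_reprK s) -rmorphM.
Qed.

Lemma quo_ideal_mem r : n (pi r) <-> m r.
Proof.
split=> [[s ms /esym/quo_pi_eq h]|]; last by exists r.
have [_ mD mM] := m_ideal; rewrite -(subrK s r); apply: mD => //.
by apply: h; split=> // _ ->.
Qed.

Lemma residue_iso : exists k : {linear (quo m : lmodType R) -> resm (quo n : lmodType Rx)},
  exists2 k' : {linear resm (quo n : lmodType Rx) -> (quo m : lmodType R)}, cancel k k' & cancel k' k.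
Proof.
have pl : linear (fun r : R^o => quo_pi m r : (quo m : lmodType R)).
  by move=> s u v; rewrite rmorphD rmorphM -[s *: _]/(quo_scale s _) quo_scaleE -rmorphM.
have ql : linear (fun r : R^o => quo_pi n (pi r) : resm (quo n : lmodType Rx)).
  move=> s u v; rewrite resm_scaleE -[pi s *: _]/(quo_scale (pi s) _) quo_scaleE.
  by rewrite !rmorphD !rmorphM.
pose p := lin_of pl; pose q := lin_of ql.
have p0 r : p r = 0 <-> m r by apply: quo_pi_ideal.
have q0 r : q r = 0 <-> m r by rewrite -quo_ideal_mem; apply: quo_pi_ideal quo_ideal.
have p_surj v : exists r, p r = v by exists (quo_repr v); apply: quo_reprK.
have q_surj v : exists r, q r = v.
  by exists (quo_repr (quo_repr v)); rewrite /= !quo_reprK.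
have [|k hk] := lin_factor (f := q) p_surj; first by move=> u /p0/q0.
have [|k' hk'] := lin_factor (f := p) q_surj; first by move=> u /q0/p0.
exists k, k' => v; first by have [r <-] := p_surj v; rewrite hk hk'.
by have [r <-] := q_surj v; rewrite hk' hk.
Qed.

Lemma stalk_res : exists c : chain_map (resc (stalk (quo n : lmodType Rx))) (stalk (quo m : lmodType R)),
  quasi_iso c.
Proof.
have [k [k' kK kK']] := residue_iso.
have /dchoice[c hc] i : exists f : {linear resm (stalk (quo n : lmodType Rx) i) -> stalk (quo m : lmodType R) i},
    injective f /\ forall v, exists u, f u = v.
  rewrite /= /stalk_mod; case: (i == 0).
    by exists k'; split=> [|v]; [exact: can_inj kK'|exists (k v)].
  exists \0; split=> [u v _|v]; first exact: (etrans (zerom_eq0 u) (esym (zerom_eq0 v))).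
  by exists 0; rewrite [RHS]zerom_eq0.
have cC i j u : j = i - 1 -> c j (diff (resc (stalk _)) i j u) = diff (stalk _) i j (c i u).
  by move=> _; apply: linear0.
exists (mk_chain_map (X := resc (stalk _)) (Y := stalk _) cC).
by apply: iso_qiso => i; have [] := hc i.
Qed.

Definition qfree (M : lmodType Rx) : lmodType Rx := quom x (freem R M).
Lemma qaug_subproof (M : lmodType Rx) :
  exists e : {linear qfree M -> M}, forall v, exists u, e u = v.
Proof.
have [e he] := @qfree_lift R x M M id.
by exists e => v; exists (qdelta x v); rewrite he.
Qed.
Definition qaug (M : lmodType Rx) := sval (cid (qaug_subproof M)).
Lemma qaug_surj M v : exists u, qaug M u = v.
Proof. exact: (svalP (cid (qaug_subproof M))). Qed.
Lemma qfree_projective M : projective_module (qfree M).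
Proof. exact/quom_projective/freem_projective. Qed.

Local Notation G := (fres qaug_surj (quo n : lmodType Rx)).
Let Gproj : K_projective G. Proof. exact: (@fres_K_projective _ _ _ _ qfree_projective). Qed.
Let Gmod i : projective_module (G i). Proof. exact: (@fres_projective _ _ _ _ qfree_projective). Qed.
Let G0 i (u : G i) : i < 0 -> u = 0. Proof. exact: fres_neg. Qed.
Let Gqiso := fres_aug_qiso qaug_surj (quo n : lmodType Rx).

(* A nonzero Ext class of T in the lowest degree survives in the twist, as tau moves degrees
   by two. *)
Lemma depth_twist (T : complex Rx) (tau : forall i, {linear T i -> T (i - 1 - 1)})
    (tauC : forall i u, diff T (i - 1 - 1) (i - 1 - 1 - 1) (tau i u) = tau (i - 1) (diff T i (i - 1) u)) :
  bounded_homology T -> (depth n (twist tauC) <= depth n T + (- 1)%:E)%E.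
Proof.
move=> Tb; have Wb := twist_bounded tauC Tb.
rewrite !(depthE Gproj Gqiso) //.
have [b hb] := depth_set_ge Gmod G0 Tb; have [a ha] := depth_set_ge Gmod G0 Wb.
apply: (infimum_int_le ha hb) => i Bi.
have [[B0 _]|[b0 [Bb0 b0min _]]] := infimum_int hb; first by rewrite B0 in Bi.
exists (b0 - 1); last by rewrite lerD2r b0min.
move=> hW; apply: Bb0; have -> : - b0 = - (b0 - 1) - 1 by lia.
(* The group from which [tau] could hit the lowest class belongs to index [b0 - 2] and vanishes by
   minimality of [b0]. *)
apply: (hom_zero_to_twist hW); apply: contrapT.
have -> : - (b0 - 1) + 1 = - (b0 - 1 - 1) by lia.
by move=> h; have := b0min _ h; lia.
Qed.

(** The terms of [G] are reductions of free modules or zero, so [lift_exists] applies to [G]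
    directly, without a swindle. *)
Lemma residue_lift : exists (L : complex R) (eps : chain_map L (stalk (quo m : lmodType R)))
  (tau : forall i, {linear G i -> G (i - 1 - 1)})
  (tauC : forall i u, diff G (i - 1 - 1) (i - 1 - 1 - 1) (tau i u) = tau (i - 1) (diff G i (i - 1) u))
  (r : forall i, {linear L i -> resm (twist tauC i)}),
  [/\ K_projective L, forall i, projective_module (L i), forall i (u : L i), i < 0 -> u = 0,
      quasi_iso eps & is_redc r].
Proof.
have [|L [tau [tauC [r [f [hr hf Lmod Lproj L0]]]]]] := lift_exists hx _ Gproj.
  case=> k; first exact: liftable_freem.
  exists (zerom R), \0; split; [exact: zerom_projective|by move=> u _; apply: zerom_eq0|].
  split=> [v|u _]; first by exists 0; rewrite [RHS](zerom_eq0 (v : zerom Rx)).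
  by exists 0; rewrite scaler0; apply: zerom_eq0.
have [c hc] := stalk_res.
exists L, (comp_map c (comp_map (resc_map (mk_chain_map (@fres_aug_comm _ _ _ qaug_surj (quo n : lmodType Rx)))) f)), tau, tauC, r.
split=> //; last by apply: comp_qiso => //; apply: comp_qiso => //; exact: resc_qiso Gqiso.
by apply: L0 => i u; apply: G0.
Qed.

(** The adjunction between reduction modulo [x] and restriction of scalars. *)
Lemma hom_zero_red (L : complex R) (V X : complex Rx) (r : forall i, {linear L i -> resm (V i)}) e :
  is_redc r -> hom_zero L (resc X) e <-> hom_zero V X e.
Proof.
move=> hr; split=> h phi hphi.
  have [|k hk] := h (fun i j => resl (phi i j) \o r i).
    by move=> i j k l hj hk hl u; rewrite /= hr.2; apply: hphi.
  have /dchoice2[k' hk'] i j : exists k' : {linear V i -> X j}, forall u, k' (r i u) = k i j u.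
    exact: (red_factor (k i j) (hr.1 i)).
  exists k' => i j l t hj hl ht u; have [v <-] := (hr.1 i).1 u.
  by rewrite -hr.2 !hk'; apply: (hk i j l t).
have /dchoice2[phi' hphi'] i j : exists p : {linear V i -> X j}, forall u, p (r i u) = phi i j u.
  exact: (red_factor (phi i j) (hr.1 i)).
have [|k hk] := h phi'.
  move=> i j k l hj hk hl u; have [v <-] := (hr.1 i).1 u.
  by rewrite -hr.2 !hphi'; apply: (hphi i j k l).
exists (fun i j => resl (k i j) \o r i) => i j l t hj hl ht u.
by rewrite /= hr.2 -hphi'; apply: hk.
Qed.

(** The sets of nonvanishing degrees may differ, but not their infima. Index [i] for the twist of
    [G] is controlled by the indices [i] and [i - 1] for [G], and the lowest class for [G] could
    only be hit by [tau] from two degrees further down. *)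
Lemma depth_res (X : complex Rx) : bounded_homology X -> depth m (resc X) = depth n X.
Proof.
move=> Xb; have [L [eps [tau [tauC [r [Lproj Lmod L0 heps hr]]]]]] := residue_lift.
have Xb' : bounded_homology (resc X) by [].
rewrite (depthE Gproj Gqiso) // (depthE Lproj heps) //.
have [b hb] := depth_set_ge Gmod G0 Xb; have [a ha] := depth_set_ge Lmod L0 Xb'.
apply/eqP; rewrite eq_le; apply/andP; split.
  rewrite -[leRHS]adde0; apply: (infimum_int_le ha hb) => i Bi.
  have [[B0 _]|[b0 [Bb0 b0min _]]] := infimum_int hb; first by rewrite B0 in Bi.
  exists b0; last by rewrite addr0 b0min.
  move=> /(hom_zero_red X (- b0) hr) hV; apply: Bb0; apply: (hom_zero_twist_inv hV).
  apply: contrapT => h; have := b0min (b0 - 1 - 1); rewrite /depth_set /=.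
  have -> : - (b0 - 1 - 1) = - b0 + 1 + 1 by lia.
  by move=> /(_ h); lia.
rewrite -[leRHS]adde0; apply: (infimum_int_le hb ha) => i Ai.
have [Bi|Bi] := pselect (depth_set G X i); first by exists i; rewrite ?addr0.
exists (i - 1); last by lia.
move=> h1; apply: Ai; apply/(hom_zero_red X (- i) hr); apply: hom_zero_twist.
  exact: contrapT.
by have <- : - (i - 1) = - i + 1 by lia.
Qed.

(** The Ext group of the residue field into [Z] in degree [j + 1] over [R] is the one into [C] in
    degree [j] over R/x. *)
Lemma depth_rees (Z : complex R) (C : complex Rx) (q : forall i, {linear Z i -> resm (C i)}) :
  is_redc q -> (forall i, xfree x (Z i)) -> bounded_homology Z ->
  depth m Z = (depth n C + 1%:E)%E.
Proof.
move=> hq Zfree Zb; have Cb := red_bounded hq Zfree Zb.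
have [L [eps [tau [tauC [r [Lproj Lmod L0 heps hr]]]]]] := residue_lift.
have [k [k' kK kK']] := residue_iso.
have [I ZI] := injective_resolution_exists Zb.
have AB j : depth_set L Z (j + 1) <-> depth_set G C j.
  rewrite /depth_set /= -(ext_injective _ Lproj heps ZI).
  rewrite -(ext_injective _ Gproj Gqiso (rees_resolution hx hq Zfree ZI)).
  rewrite (@rees_ext _ x I _ _ k k' (- j) kK kK').
  by have -> : - (j + 1) = - j - 1 by lia.
rewrite (depthE Gproj Gqiso) // (depthE Lproj heps) //.
have [b hb] := depth_set_ge Gmod G0 Cb; have [a ha] := depth_set_ge Lmod L0 Zb.
apply/eqP; rewrite eq_le; apply/andP; split.
  by apply: (infimum_int_le ha hb) => i /AB Ai; exists (i + 1).
rewrite -leeBrDr // -EFinN; apply: (infimum_int_le hb ha) => i Ai.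
by exists (i - 1) => //; apply/AB; rewrite subrK.
Qed.

End DepthChange.

(** * The inequality over [R] and over [R/x] *)

Lemma depth_quasi_iso (S : comPzRingType) (n : set S) (X Y : complex S) (f : chain_map X Y) :
  quasi_iso f -> bounded_homology X -> depth n X = depth n Y.
Proof.
move=> hf Xb.
have /dchoice[e he] (M : lmodType S) : exists e : {linear freem S M -> M}, forall b, e (delta b) = b.
  exact: freem_lift.
have e_surj (M : lmodType S) (v : M) : exists u, e M u = v by exists (delta v).
have hG := fres_aug_qiso e_surj (quo n : lmodType S).
have Gproj : K_projective (fres e_surj (quo n : lmodType S)).
  by apply: fres_K_projective => M; apply: freem_projective.
apply: (depth_qiso Gproj hG hf) => //.
exact: (bounded_homology_qiso hf).1.
Qed.

Lemma quasi_iso_ext (S : comPzRingType) (X Y : complex S) (f g : chain_map X Y) :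
  (forall i u, f i u = g i u) -> quasi_iso f -> quasi_iso g.
Proof.
move=> fg /quasi_isoP hf; apply/quasi_isoP => l k m hl hm; have [f1 f2] := hf l k m hl hm.
split=> [u u0 [w hw]|v v0]; first by apply: f1 => //; exists w; rewrite fg.
by have [u [u0 [w hw]]] := f2 v v0; exists u; split=> //; exists w; rewrite -fg.
Qed.

Lemma ring_bounded (S : comPzRingType) : bounded_homology (ring_complex S).
Proof.
exists 0, 0 => i hi u _; exists 0 => //; rewrite linear0.
have {hi} /negPf i0 : i != 0 by move: hi; lia.
by move: u; rewrite /= /ring_cobj i0 => u; rewrite [RHS]thinmx0.
Qed.

Section LdepChange.
Variables (R : comPzRingType) (x : R).
Hypothesis hx : GRing.lreg x.
Local Notation Rx := (quo [set x]).
Local Notation pi := (@quo_pi R [set x]).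

Lemma projective_xfree (M : lmodType R) : projective_module M -> xfree x M.
Proof.
move=> hM; have [p hp] := freem_lift (fun u : M => u).
have [|s hs] := hM _ _ p idfun; first by move=> v; exists (delta v).
move=> u xu; rewrite -[u]/(idfun u) -hs (@xfree_freem R x hx M (s u)) ?linear0 //.
by rewrite -linearZ_LR xu linear0.
Qed.

Lemma ring_xfree i : xfree x (ring_complex R i).
Proof.
apply: projective_xfree; rewrite /= /ring_cobj; case: (i == 0); first exact: regular_projective.
exact: zerom_projective.
Qed.

Lemma ring_redc : exists q : forall i, {linear ring_complex R i -> resm (ring_complex Rx i)},
  is_redc q.
Proof.
have /dchoice[q hq] i : exists q : {linear ring_cobj R i -> resm (ring_cobj Rx i)}, is_red q.
  rewrite /ring_cobj; case: (i == 0).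
    have ql : linear (fun r : R^o => pi r : resm (Rx^o : lmodType Rx)).
      by move=> s u v; rewrite rmorphD rmorphM.
    exists (lin_of ql); split=> [v|u /quo_pi_eq0[s ->]]; first by exists (quo_repr v); apply: quo_reprK.
    by exists s; rewrite mulrC.
  exists \0; split=> [v|u _]; first by exists 0; rewrite [RHS](zerom_eq0 (v : zerom Rx)).
  by exists 0; rewrite scaler0; apply: thinmx0.
by exists q; split=> // i j u; apply: linear0.
Qed.

Lemma hom_quo_K_projective (P : complex R) (P' : complex Rx) (p : forall i, {linear P i -> resm (P' i)}) :
  is_redc p -> K_projective P -> K_projective P'.
Proof.
move=> hp hP; apply: K_projective_hom_zero => A A0.
by apply/(hom_zero_red A 0 hp); apply: K_projective_hom.
Qed.

Lemma noetherian_cover (X : complex R) : noetherian R -> complex_fg X ->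
  exists (C : complex R) (c : chain_map C X),
  [/\ quasi_iso c, complex_fg C, forall i, xfree x (C i) &
      forall (P : complex R) (f : chain_map P X), (forall i, projective_module (P i)) ->
        exists g : chain_map P C, forall i u, c i (g i u) = f i u].
Proof.
move=> hR Xfg.
have /dchoice[F hF] i : exists F : {k : nat & {linear powm R k -> X i}}, forall v, exists u, projT2 F u = v.
  by have [k [f hf]] := powm_surj (Xfg i); exists (existT _ k f).
pose p i : {linear powm R (projT1 (F i)) -> X i} := projT2 (F i).
have p_surj i v : exists u, p i u = v := hF i v.
have [D [D_shape pD]] := cover_diff_exists (X := X) (fun i => @powm_projective R (projT1 (F i))) p_surj.
have p_free i : xfree x (powm R (projT1 (F i))) by apply/projective_xfree/powm_projective.
exists (cover_cx D_shape pD), (cover_map D_shape pD); split.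
- exact: cover_qiso.
- move=> i; apply: fg_prodm; first exact: powm_fg.
  exact/fg_subm_smod/powm_noeth.
- move=> i [a k] /prodm_eq0[/p_free a0 k0]; apply/prodm_eq0; split=> //.
  apply: (@cover_inc_inj _ _ _ p); rewrite linear0; apply: p_free.
  by rewrite -linearZ_LR k0 linear0.
- move=> P f hP; exact: cover_lift.
Qed.

Lemma quoc_qiso (A B : complex R) (f : chain_map A B) :
  (forall i, xfree x (A i)) -> (forall i, xfree x (B i)) -> quasi_iso f ->
  exists g : chain_map (quoc x A) (quoc x B), quasi_iso g.
Proof.
move=> Af Bf hf; have hA := quoc_red x A; have hB := quoc_red x B.
have /dchoice[g hg] i : exists g : {linear quoc x A i -> quoc x B i},
    forall u, g (quom_proj x _ u) = quom_proj x _ (f i u).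
  exact: (red_factor (quom_proj x (B i) \o f i) (hA.1 i)).
have gC i j u : j = i - 1 -> g j (diff (quoc x A) i j u) = diff (quoc x B) i j (g i u).
  move=> _; have [v <-] := (hA.1 i).1 u.
  by rewrite -hA.2 !hg -hB.2 cmap_comm.
exists (mk_chain_map gC); exact: (red_qiso hA hB Af Bf _ hf).
Qed.

Variable m : set R.
Hypotheses (m_ideal : is_ideal m) (xm : m x).
Local Notation n := (pi @` m).

Lemma depth_ring : depth m (ring_complex R) = (depth n (ring_complex Rx) + 1%:E)%E.
Proof.
have [q hq] := ring_redc.
exact: (depth_rees hx m_ideal xm hq ring_xfree (@ring_bounded R)).
Qed.

Lemma ldep_quo : derived_ldep R m -> derived_ldep Rx n.
Proof.
move=> ldep X Y T Xfg Yfg [P [Pproj Pmod [p hp]] [t ht]] Xb Yb Tb.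
(* The terms of [P] need not be liftable; [Q] replaces [P], and its tensor product [U] with [Y]
   replaces [T]. *)
have [Q [f [g [k [Ql gf hk]]]]] := liftable_retract hx Pmod.
have Qproj := retract_K_projective hk Pproj.
have gq := retract_qiso gf hk.
have [U [t2 ht2]] := total_tensor_exists Q Y.
have [F hF] := retract_tensor gf hk ht ht2.
(* Over [R] the complex [L] resolves [X]. As [x] kills [Y], its tensor product with [Y] is that of
   the twist of [Q], which is the twist of [U]. *)
have [L [tau [tauC [r [l [hr hl Lmod Lproj _]]]]]] := lift_exists hx Ql Qproj.
have [tauU [tauUE tauUC]] := tensor_tau ht2 tauC.
have hW := tensor_red_src (twist_total_tensor ht2 tauC tauUE tauUC) hr.
have Ub : bounded_homology U by apply/(bounded_homology_qiso hF).
have Wb := twist_bounded tauUC Ub.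
have := ldep (resc X) (resc Y) (resc (twist tauUC)) (resc_fg Xfg) (resc_fg Yfg) _ Xb Yb Wb.
rewrite !(depth_res hx m_ideal xm) // depth_ring => h.
(* The summand 1 from [depth_ring] makes up for the -1 in [depth_twist]. *)
apply: (le_trans (h _)); last first.
  rewrite -(depth_quasi_iso n hF Ub).
  have h1 := depth_twist m tauUC Ub.
  apply: (le_trans (leeD2r _ h1)).
  by rewrite addeACA -EFinD addNr adde0.
exists L; last by eexists; exact: hW.
split=> //; exists (comp_map (resc_map p) (comp_map (resc_map g) l)).
by apply: comp_qiso; [apply: comp_qiso|].
Qed.

Lemma ldep_unquo : noetherian R -> derived_ldep Rx n -> derived_ldep R m.
Proof.
move=> hR ldep X Y T Xfg Yfg [P [Pproj Pmod [p hp]] [t ht]] Xb Yb Tb.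
(* [P] is torsion-free as well, but its terms need not be finitely generated. [C] therefore stands
   in for [X] in the hypothesis over R/x, and [P], lifted to [C], serves as its resolution. *)
have [C [c [hc Cfg Cfree Clift]]] := noetherian_cover hR Xfg.
have [D [d [hd Dfg Dfree _]]] := noetherian_cover hR Yfg.
have [g hg] := Clift P p Pmod.
have gq : quasi_iso g.
  by apply: (qiso_comp_r hc); apply: (quasi_iso_ext _ hp) => i u; apply/esym/hg.
have Pfree i : xfree x (P i) by apply: projective_xfree.
have [U [u hu]] := total_tensor_exists P D.
have [F hF] := tensor_qiso ht hu Pproj hd.
have Cb : bounded_homology C by apply/(bounded_homology_qiso hc).
have Db : bounded_homology D by apply/(bounded_homology_qiso hd).
have Ub : bounded_homology U by apply/(bounded_homology_qiso hF).
have Ufree := xfree_tensor hu Pmod Dfree.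
rewrite -(depth_quasi_iso m hc Cb) -(depth_quasi_iso m hd Db) -(depth_quasi_iso m hF Ub).
rewrite depth_ring (depth_rees hx m_ideal xm (quoc_red x C) Cfree Cb).
rewrite (depth_rees hx m_ideal xm (quoc_red x D) Dfree Db).
rewrite (depth_rees hx m_ideal xm (quoc_red x U) Ufree Ub).
(* Each of the four depths carries a summand 1, two on either side. *)
rewrite !(addeACA _ 1%:E); apply: leeD2r.
apply: ldep; [exact: quoc_fg|exact: quoc_fg| |exact: red_bounded (quoc_red x C) _ _|
  exact: red_bounded (quoc_red x D) _ _|exact: red_bounded (quoc_red x U) _ _].
exists (quoc x P); last exact: tensor_red hu (quoc_red x P) (quoc_red x D) (quoc_red x U).
split; [exact: hom_quo_K_projective (quoc_red x P) Pproj|by move=> i; apply: quom_projective|].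
exact: quoc_qiso gq.
Qed.

End LdepChange.

(* R/x is [quo [set x]], and its maximal ideal is the image of m. *)
Theorem proposition4p1 (R : comPzRingType) (m : set R)
    (hR : noetherian_local R m) (x : R) (xm : m x) (hx : GRing.lreg x) :
  derived_ldep R m <->
  derived_ldep (quo [set x]) (@quo_pi R [set x] @` m).
Proof.
have [noethR [[m_ideal _ _] _]] := hR.
split; [exact: ldep_quo|exact: ldep_unquo].
Qed.
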